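(* Let $V$ be a vector space of dimension $n\ge 1$ over $\Bbbk$ and let $\mathbf B=\bigoplus_{i\ge 0}\mathbf B_i$ be the coordinate algebra of the maximal Clifford space associated with $V$. Then $\mathbf B$ is the multiplicity-free direct sum of all irreducible polynomial representations of $\mathrm{GL}(V)$. More precisely, there is an isomorphism of graded $\mathrm{GL}(V)$-representations $$\mathbf B=\bigoplus_{i=0}^\infty \mathbf B_i\;\cong\;\bigoplus_{i=0}^\infty\Bigl(\bigoplus_{\alpha\in \mathrm{YD}_n,\ |\alpha|=i}\Sigma^\alpha V\Bigr),$$ where $\mathbf B_i$ is the $i$-th graded component of $\mathbf B$ and corresponds to the $i$-th summand on the right.
   Context: $\Bbbk$ is a field of characteristic zero. $\mathbb P(E)$ denotes the projective space of one-dimensional subspaces of $E$, so $H^0(\mathbb P(E),\mathcal O(1))=E^\vee$. Put $U=\mathrm{Sym}^2V^\vee$, the space of all quadratic forms on $V$, and work on $\mathbb P(U)=\mathbb P(\mathrm{Sym}^2V^\vee)$. Let $\mathbf q\colon \mathrm{Sym}^2V\otimes\mathcal O\to\mathcal O(1)$ be the tautological epimorphism; write $\mathbf q(v,w)$ for the image of $v\cdot w$. Clifford sheaves: for $i\in\mathbb Z$ set $\mathcal C\ell_i=\bigoplus_{s\in\mathbb Z}\bigwedge^{i-2s}V\otimes\mathcal O(s)$ (with $\bigwedge^jV=0$ unless $0\le j\le n$). Clifford multiplication is the associative $\mathcal O$-bilinear product $\mathcal C\ell_i\otimes\mathcal C\ell_j\to\mathcal C\ell_{i+j}$ with unit $1\in\bigwedge^0V\otimes\mathcal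 O$ determined by $$v\cdot(w_1\wedge\dots\wedge w_m)=v\wedge w_1\wedge\dots\wedge w_m+\sum_{t=1}^m(-1)^{t-1}\mathbf q(v,w_t)\,w_1\wedge\dots\wedge\widehat{w_t}\wedge\dots\wedge w_m .$$ Thus $\mathcal C\ell_0$ is a sheaf of algebras (even Clifford algebras) and all $\mathcal C\ell_i$ are $\mathcal C\ell_0$-bimodules, $\mathrm{GL}(V)$-equivariant in the natural way. The maximal Clifford space is $(\mathbb P(\mathrm{Sym}^2V^\vee),\mathcal C\ell_0)$, and its coordinate algebra is the graded algebra $$\mathbf B=\bigoplus_{i\ge 0}\mathbf B_i,\qquad \mathbf B_i=\mathrm{Hom}_{\mathcal C\ell_0}(\mathcal C\ell_0,\mathcal C\ell_i)=H^0(\mathbb P(\mathrm{Sym}^2V^\vee),\mathcal C\ell_i),$$ with product induced by Clifford multiplication; $\mathrm{GL}(V)$ acts on it by graded algebra automorphisms. $\mathrm{YD}_n$ is the set of Young diagrams $\alpha=(\alpha_1\ge\dots\ge\alpha_n\ge0)$ with at most $n$ rows, $|\alpha|=\sum\alpha_i$, and $\Sigma^\alpha V$ is the irreducible polynomial representation (Schur functor) of $\mathrm{GL}(V)$ of highest weight $\alpha$ (so $\Sigma^{(m)}V=\mathrm{Sym}^mV$, $\Sigma^{(1^m)}V=\bigwedge^mV$). *)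

(* Defs.v *)
From HB Require Import structures.
From mathcomp Require Import all_boot all_fingroup all_algebra.
From mathcomp.multinomials Require Import freeg mpoly.

Set Implicit Arguments.
Unset Strict Implicit.
Unset Printing Implicit Defensive.

Import GRing.Theory.
Local Open Scope ring_scope.

(* A representation of GL(V) on a k-subspace [rep_mem] of an ambient k-module. *)
(* The action is only meaningful for invertible g; the subspace and action     *)
(* laws are not part of the record, they follow from the explicit formulas of  *)
(* the instances below.                                                        *)
Record glrep (k : fieldType) (V : vectType k) := GLRep {
  rep_space : lmodType k;
  rep_mem : rep_space -> Prop;
  rep_act : 'End(V) -> rep_space -> rep_space
}.

Record glrep_iso (k : fieldType) (V : vectType k) (A B : glrep V)
    (phi : rep_space A -> rep_space B) : Prop := GLRepIso {
  iso_mem : forall x, rep_mem x -> rep_mem (phi x);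
  iso_linear : forall (c : k) x y, rep_mem x -> rep_mem y ->
    phi (c *: x + y) = c *: phi x + phi y;
  iso_inj : forall x y, rep_mem x -> rep_mem y -> phi x = phi y -> x = y;
  iso_surj : forall z, rep_mem z -> exists2 x, rep_mem x & phi x = z;
  iso_equivariant : forall (g : 'End(V)) x, lker g == 0%VS -> rep_mem x ->
    phi (rep_act g x) = rep_act g (phi x)
}.

Definition graded_glrep (k : fieldType) (V : vectType k) := nat -> glrep V.

Definition graded_glrep_isomorphic (k : fieldType) (V : vectType k)
    (A B : graded_glrep V) : Prop :=
  exists phi : forall i, rep_space (A i) -> rep_space (B i),
    forall i, glrep_iso (@phi i).

Record graded_glalgebra (k : fieldType) (V : vectType k) := GradedGLAlgebra {
  galg_rep :> graded_glrep V;
  galg_one : rep_space (galg_rep 0%N);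
  galg_mul : forall i j, rep_space (galg_rep i) -> rep_space (galg_rep j) ->
    rep_space (galg_rep (i + j)%N)
}.

(* Entry (a, b) of the matrix of g in the basis e: g e_b = \sum_a g_(a,b) e_a. *)
Definition gl_entry (k : fieldType) (V : vectType k) (n : nat) (e : n.-tuple V)
    (g : 'End(V)) (a b : 'I_n) : k := coord e a (g (tnth e b)).

(* (a, b) with a <= b indexes the basis vector e_a . e_b of Sym^2 V. *)
Definition sym2_basis (n : nat) : {set 'I_n * 'I_n} :=
  [set p : 'I_n * 'I_n | (p.1 <= p.2)%N].

(* Sym(U^dual), the homogeneous coordinate ring of P(U), U = Sym^2 V^dual. *)
Definition coord_ring (k : fieldType) (n : nat) := {mpoly k[#|sym2_basis n|]}.

(* The linear form q(e_a, e_b) in H^0(P(U), O(1)) = Sym^2 V: the variable      *)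
(* indexed by the unordered pair {a, b}.                                       *)
Definition qform (k : fieldType) (n : nat) (a b : 'I_n) : coord_ring k n :=
  \sum_(i < #|sym2_basis n| | enum_val i \in [:: (a, b); (b, a)]) 'X_i.

Definition coord_ring_act (k : fieldType) (V : vectType k) (n : nat)
    (e : n.-tuple V) (g : 'End(V)) (p : coord_ring k n) : coord_ring k n :=
  p \mPo [tuple \sum_(c < n) \sum_(d < n)
            (gl_entry e g c (enum_val i).1 * gl_entry e g d (enum_val i).2)
              *: qform k c d
          | i < #|sym2_basis n|].

(* All the sheaves O(s) embed in the constant sheaf K = Frac Sym(U^dual).      *)
Definition coord_frac (k : fieldType) (n : nat) : Type :=
  {fraction {mpoly k[#|sym2_basis n|]}}.

HB.instance Definition _ (k : fieldType) (n : nat) :=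
  GRing.Field.on (coord_frac k n).

Section CoordFracLmodule.
Variables (k : fieldType) (n : nat).

Definition to_frac (p : coord_ring k n) : coord_frac k n := FracField.tofrac p.

Definition coord_frac_scale (c : k) (f : coord_frac k n) : coord_frac k n :=
  to_frac c%:MP * f.

Fact coord_frac_scaleA (c d : k) (f : coord_frac k n) :
  coord_frac_scale c (coord_frac_scale d f) = coord_frac_scale (c * d) f.
Proof. by rewrite /coord_frac_scale /to_frac mpolyCM rmorphM mulrA. Qed.

Fact coord_frac_scale1 : left_id 1 coord_frac_scale.
Proof. by move=> f; rewrite /coord_frac_scale /to_frac mpolyC1 rmorph1 mul1r. Qed.

Fact coord_frac_scaleDr : right_distributive coord_frac_scale +%R.
Proof. by move=> c f f'; rewrite /coord_frac_scale mulrDr. Qed.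

Fact coord_frac_scaleDl (f : coord_frac k n) :
  {morph coord_frac_scale^~ f : c d / c + d}.
Proof.
by move=> c d; rewrite /coord_frac_scale /to_frac mpolyCD rmorphD mulrDl.
Qed.

HB.instance Definition _ := GRing.Zmodule_isLmodule.Build k (coord_frac k n)
  coord_frac_scaleA coord_frac_scale1 coord_frac_scaleDr coord_frac_scaleDl.

End CoordFracLmodule.

(* For invertible g, [coord_ring_act] is injective, so this does not depend on *)
(* the representative.                                                         *)
Definition coord_frac_act (k : fieldType) (V : vectType k) (n : nat)
    (e : n.-tuple V) (g : 'End(V)) (f : coord_frac k n) : coord_frac k n :=
  let r := generic_quotient.repr (f : {fraction {mpoly k[#|sym2_basis n|]}}) in
  to_frac (coord_ring_act e g \n_r) / to_frac (coord_ring_act e g \d_r).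

(* The sections of O(s) over the open set l != 0, for a linear form l: the     *)
(* degree s part of the localization Sym(U^dual)[1/l].                         *)
Definition twist_section (k : fieldType) (n : nat) (s : int)
    (l : coord_ring k n) (f : coord_frac k n) : Prop :=
  exists (m d : nat) (p : coord_ring k n),
    [/\ d%:Z = s + m%:Z, p \is d.-homog & f = to_frac p / to_frac l ^+ m].

(* The exterior algebra of V over K: x J is the coefficient of                 *)
(* e_(j_1) /\ ... /\ e_(j_m), where J = {j_1 < ... < j_m}.                     *)
Definition ext_frac (k : fieldType) (n : nat) :=
  {ffun {set 'I_n} -> coord_frac k n}.

(* e_J has a component in Cl_i only if |J| = i - 2 s, and then it is O(s) e_J. *)
Definition clifford_section (k : fieldType) (n i : nat)
    (l : coord_ring k n) (x : ext_frac k n) : Prop :=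
  forall J : {set 'I_n},
    x J = 0 \/ exists2 s : int, #|J|%:Z = i%:Z - 2 * s & twist_section s l (x J).

(* Global sections of Cl_i: rational sections that are regular on each of the  *)
(* open sets l != 0, which cover P(U).                                         *)
Definition clifford_global_section (k : fieldType) (n i : nat)
    (x : ext_frac k n) : Prop :=
  forall l : coord_ring k n, l \is 1.-homog -> l != 0 -> clifford_section i l x.

Definition ext_one (k : fieldType) (n : nat) : ext_frac k n :=
  [ffun J => (J == set0)%:R].

Definition ext_fscale (k : fieldType) (n : nat) (f : coord_frac k n)
    (x : ext_frac k n) : ext_frac k n := [ffun J => f * x J].

(* e_a /\ x *)
Definition ext_wedge (k : fieldType) (n : nat) (a : 'I_n) (x : ext_frac k n) :
    ext_frac k n :=
  [ffun J : {set 'I_n} =>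
     if a \in J then (-1) ^+ #|[set c in J | (c < a)%N]| * x (J :\ a) else 0].

(* w_1 /\ ... /\ w_m |-> \sum_t (-1)^(t-1) q(e_a, w_t) (omit w_t) *)
Definition ext_contract (k : fieldType) (n : nat) (a : 'I_n)
    (x : ext_frac k n) : ext_frac k n :=
  [ffun J : {set 'I_n} =>
     \sum_(b < n | b \notin J)
       (-1) ^+ #|[set c in J | (c < b)%N]| * to_frac (qform k a b) * x (b |: J)].

Definition clifford_mul1 (k : fieldType) (n : nat) (a : 'I_n)
    (x : ext_frac k n) : ext_frac k n := ext_wedge a x + ext_contract a x.

(* (e_(s_1) /\ ... /\ e_(s_m)) . y for m = size s, where associativity and the *)
(* formula for v . (w_1 /\ ... /\ w_m) force                                   *)
(*   (v /\ w) . y = v . (w . y) - (contraction of w by v) . y.                 *)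
Fixpoint clifford_mul_wedge (k : fieldType) (n m : nat) (s : seq 'I_n)
    (y : ext_frac k n) : ext_frac k n :=
  match m, s with
  | m'.+1, a :: s' =>
      clifford_mul1 a (clifford_mul_wedge m' s' y)
      - \sum_(t < size s')
          ext_fscale ((-1) ^+ t * to_frac (qform k a (nth a s' t)))
            (clifford_mul_wedge m' (take t s' ++ drop t.+1 s') y)
  | _, _ => y
  end.

Definition clifford_mul (k : fieldType) (n : nat) (x y : ext_frac k n) :
    ext_frac k n :=
  \sum_(J : {set 'I_n}) ext_fscale (x J) (clifford_mul_wedge #|J| (enum J) y).

(* g e_(j_1) /\ ... /\ g e_(j_m) for J = {j_1 < ... < j_m} *)
Definition ext_act_basis (k : fieldType) (V : vectType k) (n : nat)
    (e : n.-tuple V) (g : 'End(V)) (J : {set 'I_n}) : ext_frac k n :=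
  foldr (fun j y => \sum_(a < n) gl_entry e g a j *: ext_wedge a y)
    (ext_one k n) (enum J).

Definition ext_act (k : fieldType) (V : vectType k) (n : nat)
    (e : n.-tuple V) (g : 'End(V)) (x : ext_frac k n) : ext_frac k n :=
  \sum_(J : {set 'I_n})
    ext_fscale (coord_frac_act e g (x J)) (ext_act_basis e g J).

(* All the components share the ambient space [ext_frac k n], on which both    *)
(* the product and the GL(V)-action are defined.                               *)
Definition clifford_rep (k : fieldType) (V : vectType k) (n : nat)
    (e : n.-tuple V) : graded_glrep V :=
  fun i => GLRep (@clifford_global_section k n i) (ext_act e).

Definition clifford_coordinate_algebra (k : fieldType) (V : vectType k)
    (n : nat) (e : n.-tuple V) : graded_glalgebra V :=
  @GradedGLAlgebra k V (clifford_rep e) (ext_one k n)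
    (fun _ _ => @clifford_mul k n).

(* Young diagrams with at most n rows and d boxes; as all rows have length at  *)
(* most d, they form a finite type.                                            *)
Definition young_diagram (n d : nat) : finType :=
  {a : n.-tuple 'I_d.+1 | sorted geq (map val a) && (sumn (map val a) == d)}.

Definition row_lengths (n d : nat) (al : young_diagram n d) : seq nat :=
  map val (val al).

(* The boxes are numbered row by row. *)
Definition box_row (n d : nat) (al : young_diagram n d) (r : 'I_d) : nat :=
  reshape_index (row_lengths al) r.

Definition box_col (n d : nat) (al : young_diagram n d) (r : 'I_d) : nat :=
  reshape_offset (row_lengths al) r.

Definition row_group (n d : nat) (al : young_diagram n d) : {set 'S_d} :=
  [set s : 'S_d | [forall r, box_row al (s r) == box_row al r]].

Definition col_group (n d : nat) (al : young_diagram n d) : {set 'S_d} :=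
  [set s : 'S_d | [forall r, box_col al (s r) == box_col al r]].

(* The d-th tensor power of V: t I is the coefficient of                       *)
(* e_(I 0) (x) ... (x) e_(I (d-1)).                                            *)
Definition tensor (k : fieldType) (n d : nat) :=
  {ffun {ffun 'I_d -> 'I_n} -> k^o}.

Definition tensor_act (k : fieldType) (V : vectType k) (n d : nat)
    (e : n.-tuple V) (g : 'End(V)) (t : tensor k n d) : tensor k n d :=
  [ffun I : {ffun 'I_d -> 'I_n} => \sum_(J : {ffun 'I_d -> 'I_n})
     (\prod_(r < d) gl_entry e g (I r) (J r)) * t J].

Definition tensor_perm (k : fieldType) (n d : nat) (s : 'S_d)
    (t : tensor k n d) : tensor k n d :=
  [ffun I : {ffun 'I_d -> 'I_n} => t [ffun r => I (s r)]].

Definition young_symmetrizer (k : fieldType) (n d : nat)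
    (al : young_diagram n d) (t : tensor k n d) : tensor k n d :=
  \sum_(p in row_group al) \sum_(s in col_group al)
    (-1) ^+ s *: tensor_perm p (tensor_perm s t).

Definition schur_mem (k : fieldType) (n d : nat) (al : young_diagram n d)
    (t : tensor k n d) : Prop :=
  exists u : tensor k n d, t = young_symmetrizer al u.

Definition schur_sum_rep (k : fieldType) (V : vectType k) (n : nat)
    (e : n.-tuple V) : graded_glrep V :=
  fun d => @GLRep k V {ffun young_diagram n d -> tensor k n d}
    (fun f => forall al, schur_mem al (f al))
    (fun g f => [ffun al => tensor_act e g (f al)]).

(* Main.v *)
(** The component B_d is the sum over m + 2s = d of the GL(V)-representations
    /\^m V (x) Sym^s (Sym^2 V), that is of T eps_m, where T is the d-th tensor
    power of V and eps_m, in the group algebra A of S_d, is the signed sum over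
    the centralizer of an involution with m fixed points, the sign being that
    of the permutation of the fixed points. The sum of the left ideals A eps_m
    is thus the involution model of S_d, of dimension at most the number of
    involutions. For a diagram alpha with Young symmetrizer c_alpha, flipping
    the boxes 2j and 2j+1 of each row gives an involution with as many fixed
    points as alpha has odd rows, and the coefficient at 1 of the product of
    c_alpha with its signed centralizer sum is a positive integer; so A c_alpha
    embeds in A eps_m for m the number of odd rows of alpha. Lattice words of
    shape alpha give independent elements of A c_alpha, and lattice words of
    length d are as numerous as the involutions of S_d, both numbers satisfying
    N(d+2) = N(d+1) + (d+1) N(d). Hence these embeddings exhaust the A eps_m,
    each A c_alpha occurring exactly once, and applying them to T gives the
    theorem. *)

From Stdlib Require Import FunctionalExtensionality ClassicalEpsilon.
Require Import Defs.
From HB Require Import structures.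
From mathcomp Require Import all_boot all_order all_fingroup all_algebra.
From mathcomp.multinomials Require Import freeg mpoly.
From mathcomp Require Import zify.

Set Implicit Arguments.
Unset Strict Implicit.
Unset Printing Implicit Defensive.

(** * Counting lattice words *)

(** No semisimplicity is invoked, and the ground field may be any field of characteristic zero. An
    embedding of A c_alpha into A eps_m is a pair E, G with c E eps G c = c: right multiplication by
    E eps, undone by right multiplication by G c. The obstacle is to produce G, as sums of squares
    may vanish in the field; but all the elements concerned have integer coefficients, and for these
    x times its image under inversion of the group is nonzero as soon as x is. The count takes place
    in A, with diagrams of up to d rows and without reference to n. Its outcome is an identity eps_m
    = sum of z_alpha c_alpha E_alpha eps_m, which gives surjectivity on tensors; the pairs E, G and
    the orthogonality of distinct c_alpha give injectivity; diagrams with more than n rows drop out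
    because c_alpha kills T. As sections are families of fractions, T eps_m is reached through an
    explicit map from T, which pairs the slots exchanged by the involution and wedges the fixed
    ones; it kills exactly what eps_m kills. *)

Section LatticeWords.
Variable M : nat.
Implicit Types (al be : nat -> nat) (h : (nat -> nat) -> nat) (w : seq nat).

Definition nonincr al := forall i, al i.+1 <= al i.
Definition addbox al i := fun j => al j + (j == i).
Definition rembox al i := fun j => al j - (j == i).
Definition addable al i := (i == 0) || (al i < al i.-1).
Definition removable al i := al i.+1 < al i.

(** Raising and lowering operators of Young's lattice, acting on functions of shapes. Rows are cut
    off at [M], which loses nothing as long as row [M.-1] is empty. *)
Definition up h al := \sum_(i < M | addable al i) h (addbox al i).
Definition down h al := \sum_(i < M | removable al i) h (rembox al i).

Definition vanishes_from L al := forall i, L <= i -> al i = 0.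

Lemma nonincr_add al i : nonincr al -> addable al i -> nonincr (addbox al i).
Proof.
move=> part_al add_i j; rewrite /addbox; have := part_al j.
move: add_i; rewrite /addable.
case: (eqVneq j.+1 i) => [<- /=|_]; last by lia.
by lia.
Qed.

Lemma vanishes_add al i L :
  vanishes_from L al -> addable al i -> vanishes_from L.+1 (addbox al i).
Proof.
move=> al0; rewrite /addable => add_i j ltLj; rewrite /addbox al0 1?ltnW //.
case: eqP => // ji; move: add_i; rewrite -ji.
by rewrite (al0 j.-1); case: j ltLj {ji}.
Qed.

(** Adding a box to one row and removing one from another row commute; only the pairs of moves that
    return to [al] make a difference. *)
Lemma down_up h al : 0 < M -> nonincr al -> vanishes_from M.-1 al ->
  up (down h) al = down (up h) al + h al.
Proof.
move=> M_gt0 part_al al0.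
have add_rem i : addable al i -> removable (addbox al i) i.
  by rewrite /removable /addbox eqxx; have := part_al i; lia.
have rem_add i : removable al i -> addable (rembox al i) i.
  rewrite /addable /removable /rembox; case: i => //= i.
  by have := part_al i; lia.
have add_remK i : rembox (addbox al i) i = al.
  by apply: functional_extensionality => j; rewrite /rembox /addbox addnK.
have rem_addK i : removable al i -> addbox (rembox al i) i = al.
  rewrite /removable => ri; apply: functional_extensionality => j.
  rewrite /addbox /rembox subnK //; case: eqP => // ->.
  exact: leq_ltn_trans ri.
(* Row 0 is always addable, and row i+1 is addable exactly when row i is removable. As row [M.-1] is
   empty, there is one more addable row than removable ones. *)
have diag : \sum_(i < M | addable al i) h al =
            \sum_(i < M | removable al i) h al + h al.
  case: M M_gt0 al0 => // m _ /= al0.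
  rewrite big_mkcond [in RHS]big_mkcond big_ord_recl [in RHS]big_ord_recr /=.
  rewrite {2}/removable !al0 // ltnn addn0 addnC; congr (_ + _).
have off i j : i != j -> addable al i && removable (addbox al i) j =
    removable al j && addable (rembox al j) i.
  move=> iNj; rewrite /addable /removable /addbox /rembox.
  case: i iNj => [|i] /=; first by lia.
  by case: (eqVneq j i) => [->|jNi]; lia.
have offE i j : i != j -> rembox (addbox al i) j = addbox (rembox al j) i.
  move=> iNj; apply: functional_extensionality => l; rewrite /rembox /addbox.
  by case: (eqVneq l j) => [->|_]; rewrite ?subn0 // eq_sym (negPf iNj) !addn0.
rewrite /up /down.
under eq_bigr => i add_i.
  rewrite (bigD1 i) ?add_rem //= add_remK; over.
under [in RHS]eq_bigr => i rem_i.
  rewrite (bigD1 i) ?rem_add //= rem_addK //; over.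
rewrite !big_split /= diag -addnA [h al + _]addnC addnA; congr (_ + _ + _).
rewrite [LHS](exchange_big_dep xpredT) //= [RHS]big_mkcond /=.
apply: eq_bigr => j _; case: ifP => rem_j.
  apply: eq_big => [i|i /andP[_ /andP[_ jNi]]]; last by rewrite offE // eq_sym.
  rewrite [j == i]eq_sym; have [|iNj] := eqVneq i j; first by rewrite !andbF.
  by rewrite !andbT off ?rem_j.
apply: big1_seq => i /andP[/andP[add_i /andP[rem_ji jNi]] _].
by have := off i j; rewrite eq_sym rem_j add_i rem_ji => /(_ jNi).
Qed.

Lemma up1 al : 0 < M -> vanishes_from M.-1 al ->
  up (fun=> 1) al = down (fun=> 1) al + 1.
Proof.
rewrite /up /down; case: M => // m _ /= al0.
rewrite big_mkcond [in RHS]big_mkcond big_ord_recl [in RHS]big_ord_recr /=.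
by rewrite {2}/removable !al0 // ltnn addn0 addnC.
Qed.

Lemma eq_iter_up m h h' al L :
    nonincr al -> vanishes_from L al ->
    (forall be, nonincr be -> vanishes_from (L + m) be -> h be = h' be) ->
  iter m up h al = iter m up h' al.
Proof.
elim: m al L => [|m IHm] al L part_al al0 eq_h /=.
  by apply: eq_h; rewrite ?addn0.
apply: eq_bigr => i add_i; apply: (IHm _ L.+1).
- exact: nonincr_add.
- exact: vanishes_add.
- by move=> be part_be be0; apply: eq_h; rewrite // addnS -addSn.
Qed.

Lemma iter_upD m h h' al :
  iter m up (fun be => h be + h' be) al = iter m up h al + iter m up h' al.
Proof.
elim: m al => // m IHm al /=; rewrite /up -big_split.
by apply: eq_bigr => i _; apply: IHm.
Qed.

(** The commutation relation [down_up] is used [m] times. Each added box may open one more row,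
    whence the bound [L + m <= M]. *)
Lemma iter_up_down m h al L :
    nonincr al -> vanishes_from L al -> L + m <= M ->
  iter m up (down h) al = down (iter m up h) al + m * iter m.-1 up h al.
Proof.
elim: m al L => [|m IHm] al L part_al al0 leM; first by rewrite addn0.
rewrite iterS {1}/up.
under eq_bigr => i add_i.
  rewrite (IHm _ L.+1); [|exact: nonincr_add|exact: vanishes_add|by lia].
  over.
rewrite big_split /= -big_distrr /= -/(up (down _) al) down_up //; last first.
- by move=> i lei; apply: al0; lia.
- by lia.
rewrite -/(up (iter m up h)) -addnA; congr (_ + _).
rewrite mulSn; congr (_ + _); case: m {IHm leM} => //.
Qed.

Definition nlattice m := iter m up (fun=> 1) (fun=> 0).

Lemma nlattice1 : 0 < M -> nlattice 1 = 1.
Proof.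
move=> M_gt0; rewrite /nlattice /= up1 //.
by rewrite /down big1 // => i.
Qed.

(** By [up1] the innermost [up], applied to the constant 1, becomes [down] plus 1; [iter_up_down]
    moves [down] outwards, where it vanishes on the empty shape. *)
Lemma nlatticeSS m : m.+2 <= M ->
  nlattice m.+2 = nlattice m.+1 + m.+1 * nlattice m.
Proof.
move=> leM; rewrite /nlattice iterSr.
rewrite (@eq_iter_up _ _ (fun be => down (fun=> 1) be + 1) _ 0) //; last first.
  move=> be _ be0; apply: up1; first by lia.
  by move=> i lei; apply: be0; lia.
rewrite iter_upD (@iter_up_down _ _ _ 0) //; last by lia.
by rewrite /= {1}/down big1 // addnC.
Qed.

(** The letters name the rows that successively receive a box, each intermediate shape staying a
    partition. *)
Fixpoint is_lattice al w :=
  if w is i :: w' then addable al i && is_lattice (addbox al i) w' else true.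

Lemma card_is_lattice m al :
  #|[set t : m.-tuple 'I_M | is_lattice al (map val t)]| = iter m up (fun=> 1) al.
Proof.
elim: m al => [|m IHm] al.
  rewrite (_ : [set _ | _] = setT) ?cardsT ?card_tuple //.
  by apply/setP=> t; rewrite !inE tuple0.
rewrite iterS -sum1dep_card big_mkcond.
pose cons_t (p : 'I_M * m.-tuple 'I_M) := [tuple of p.1 :: p.2].
rewrite (reindex cons_t) /=; last first.
  exists (fun t : m.+1.-tuple 'I_M => (thead t, [tuple of behead t])) => [[i t]|t] _.
    by congr (_, _); apply: val_inj.
  by rewrite /cons_t /= [RHS]tuple_eta.
rewrite -(pair_big predT predT (fun i (t : m.-tuple 'I_M) =>
   if is_lattice al (val i :: map val t) then 1 else 0)) /=.
rewrite /up [RHS]big_mkcond; apply: eq_bigr => i _; case: ifP => add_i.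
  by rewrite -IHm -sum1dep_card [RHS]big_mkcond.
by rewrite big1.
Qed.

Lemma is_lattice_prefix al w m : nonincr al -> is_lattice al w ->
  nonincr (fun i => al i + count_mem i (take m w)).
Proof.
elim: w al m => [|j w IHw] al m part_al /=.
  by move=> _ i; rewrite !addn0.
case/andP=> add_j lat_w; case: m => [|m] /= i; first by rewrite !addn0.
have := IHw _ m (nonincr_add part_al add_j) lat_w i.
by rewrite /addbox !(eq_sym j) !addnA.
Qed.

End LatticeWords.

Import GroupScope.

(** * Counting involutions *)

Section Involutions.
Variable T : finType.
Implicit Types (t : {perm T}) (X : {set T}).

Definition invols X := [set t | perm_on X t && (t * t == 1)].

Lemma involsP X t :
  reflect ((forall x, x \notin X -> t x = x) /\ involutive t) (t \in invols X).
Proof.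
rewrite inE; apply: (iffP andP) => [[on_t /eqP tt1]|[on_t tK]]; split.
- by move=> x; apply: out_perm.
- by move=> x; rewrite -permM tt1 perm1.
- apply/subsetP=> x; rewrite inE; apply: contraR => xX.
  by rewrite on_t.
- by apply/eqP/permP=> x; rewrite permM tK perm1.
Qed.

(** Sort by the image [y] of [x]. If [y] is [x], the involution lives on [X]; otherwise composing
    with the transposition of [x] and [y] leaves an involution of [X :\ y]. An upper bound is enough
    for the final count. *)
Lemma card_involsU1 X x : x \notin X ->
  (#|invols (x |: X)| <= #|invols X| + \sum_(y in X) #|invols (X :\ y)|)%N.
Proof.
move=> xX; rewrite -sum1_card (partition_big (fun t => aperm x t) predT) //=.
rewrite (bigD1 x) //= leq_add //.
  rewrite sum1dep_card subset_leq_card //; apply/subsetP=> t.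
  rewrite inE => /andP[/involsP[on_t tK] /eqP tx]; apply/involsP; split=> // z zX.
  have [->//|zNx] := eqVneq z x.
  by apply: on_t; rewrite !inE negb_or zNx.
rewrite big_mkcond [leqRHS]big_mkcond; apply: leq_sum => y _ /=.
case: (boolP (y \in X)) => yX; last first.
  case: ifP => // yNx; rewrite big1 // => t /andP[/involsP[on_t tK] /eqP txy].
  have : t x \notin x |: X by rewrite -[t x]/(aperm x t) txy !inE negb_or yNx.
  by move/on_t; rewrite tK -[t x]/(aperm x t) txy => xy; rewrite xy eqxx in yNx.
have yNx : y != x by apply: contraNneq xX => <-.
rewrite yNx sum1dep_card -(card_imset _ (mulIg (tperm x y))) subset_leq_card //.
apply/subsetP=> _ /imsetP[t + ->].
rewrite inE => /andP[/involsP[on_t tK] /eqP/= tx].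
have ty : t y = x by rewrite -tx -[aperm x t]/(t x) tK.
apply/involsP; split=> z; rewrite !permM.
  rewrite !inE negb_and negbK; have [-> _|zNy /= zX] := eqVneq z y.
    by rewrite ty tpermL.
  have [->|zNx] := eqVneq z x; first by rewrite -[t x]/(aperm x t) tx tpermR.
  by rewrite on_t ?tpermD 1?eq_sym // !inE negb_or zNx.
have [->|zNx] := eqVneq z x.
  by rewrite -[t x]/(aperm x t) tx tpermR -[t x]/(aperm x t) tx tpermR.
have [->|zNy] := eqVneq z y; first by rewrite ty tpermL ty tpermL.
have tzNx : t z != x by apply: contraNneq zNy => tzx; rewrite -tx -tzx /aperm tK.
have tzNy : t z != y by apply: contraNneq zNx => tzy; rewrite -ty -tzy tK.
by rewrite (tpermD (_ : x != t z)) 1?eq_sym // tK tpermD // eq_sym.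
Qed.

Lemma card_invols M X : (#|X| <= M)%N -> (#|invols X| <= nlattice M #|X|)%N.
Proof.
have [m] := ubnP #|X|; elim: m X => // m IHm X ltX leM.
have invols0 : #|invols set0| = 1%N.
  rewrite (_ : invols set0 = [set 1]) ?cards1 //; apply/setP=> t.
  rewrite [RHS]inE; apply/involsP/eqP => [[on_t _]|->].
    by apply/permP=> x; rewrite on_t ?inE // perm1.
  by split=> x; rewrite !perm1.
have [->|[x xX]] := set_0Vmem X; first by rewrite invols0 cards0.
have cX : #|X| = #|X :\ x|.+1 by rewrite (cardsD1 x) xX.
rewrite -{1}(setD1K xX); apply: leq_trans (card_involsU1 _) _; first by rewrite !inE eqxx.
have [X0|[y0 y0X]] := set_0Vmem (X :\ x).
  by rewrite cX X0 big_set0 invols0 cards0 nlattice1 ?addn0 //; lia.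
have cX2 : #|X :\ x| = #|X :\ x :\ y0|.+1 by rewrite (cardsD1 y0) y0X.
rewrite cX cX2 nlatticeSS -?cX2 -?cX //; apply: leq_add.
  by apply: IHm; lia.
rewrite -sum_nat_const; apply: leq_sum => y yX.
have cy : #|X :\ x :\ y| = #|X :\ x :\ y0|.
  by apply: succn_inj; rewrite -cX2 (cardsD1 y (X :\ x)) yX.
by rewrite -cy; apply: IHm; lia.
Qed.

End Involutions.

Import Order.Theory GRing.Theory Num.Theory.
Local Open Scope ring_scope.

(** * The group algebra *)

Definition galg (k : fieldType) (gT : finGroupType) := {ffun gT -> k^o}.

HB.instance Definition _ (k : fieldType) (gT : finGroupType) :=
  Vector.on (galg k gT).

Section GroupAlgebra.
Variables (k : fieldType) (gT : finGroupType).
Local Notation A := (galg k gT).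
Implicit Types (x y z : A) (g h : gT).

Definition gmul x y : A := [ffun g => \sum_h x h * y (h^-1 * g)%g].

Definition gelt g : A := [ffun h => (h == g)%:R].

Fact gmulDl : left_distributive gmul +%R.
Proof.
move=> x y z; apply/ffunP=> g; rewrite !ffunE -big_split /=.
by apply: eq_bigr => h _; rewrite ffunE mulrDl.
Qed.

Fact gmulDr : right_distributive gmul +%R.
Proof.
move=> x y z; apply/ffunP=> g; rewrite !ffunE -big_split /=.
by apply: eq_bigr => h _; rewrite ffunE mulrDr.
Qed.

Fact gmulA : associative gmul.
Proof.
move=> x y z; apply/ffunP=> g; rewrite !ffunE.
under eq_bigr => h _ do rewrite ffunE mulr_sumr.
under [RHS]eq_bigr => h _ do rewrite ffunE mulr_suml.
rewrite [RHS]exchange_big /=; apply: eq_bigr => h _.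
rewrite [RHS](reindex_inj (mulgI h)) /=; apply: eq_bigr => h' _.
by rewrite mulrA mulKg invMg mulgA.
Qed.

Fact gmul1l : left_id (gelt 1) gmul.
Proof.
move=> x; apply/ffunP=> g; rewrite ffunE (bigD1 1%g) //= ffunE eqxx mul1r.
rewrite invg1 mul1g big1 ?addr0 // => h /negPf hN1.
by rewrite ffunE hN1 mul0r.
Qed.

Fact gmul1r : right_id (gelt 1) gmul.
Proof.
move=> x; apply/ffunP=> g; rewrite ffunE (bigD1 g) //= ffunE mulVg eqxx mulr1.
rewrite big1 ?addr0 // => h /negPf hNg.
by rewrite ffunE -eq_mulVg1 hNg mulr0.
Qed.

Fact gelt1_neq0 : gelt 1 != 0.
Proof.
by apply/eqP=> /ffunP/(_ 1%g)/eqP; rewrite !ffunE eqxx oner_eq0.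
Qed.

HB.instance Definition _ := GRing.Zmodule_isNzRing.Build (galg k gT)
  gmulA gmul1l gmul1r gmulDl gmulDr gelt1_neq0.

Fact gscaleAl (c : k) x y : c *: (x * y) = (c *: x) * y.
Proof.
apply/ffunP=> g; rewrite !ffunE scaler_sumr.
by apply: eq_bigr => h _; rewrite ffunE scalerAl.
Qed.

HB.instance Definition _ :=
  GRing.Lmodule_isLalgebra.Build k (galg k gT) gscaleAl.

Fact gscaleAr (c : k) x y : c *: (x * y) = x * (c *: y).
Proof.
apply/ffunP=> g; rewrite !ffunE scaler_sumr.
by apply: eq_bigr => h _; rewrite ffunE scalerAr.
Qed.

HB.instance Definition _ :=
  GRing.Lalgebra_isAlgebra.Build k (galg k gT) gscaleAr.

Lemma gmulE x y g : (x * y) g = \sum_h x h * y (h^-1 * g)%g.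
Proof. by rewrite ffunE. Qed.

Lemma gelt_mull g x h : (gelt g * x) h = x (g^-1 * h)%g.
Proof.
rewrite gmulE (bigD1 g) //= ffunE eqxx mul1r big1 ?addr0 // => h' /negPf hN.
by rewrite ffunE hN mul0r.
Qed.

Lemma gelt_mulr g x h : (x * gelt g) h = x (h * g^-1)%g.
Proof.
rewrite gmulE (bigD1 (h * g^-1)%g) //= ffunE invMg invgK mulgKV.
rewrite eqxx mulr1 big1 ?addr0 // => h' hN.
rewrite ffunE -(inj_eq (mulgI h')) mulKVg -(inj_eq (mulIg g^-1%g)) mulgK eq_sym.
by rewrite (negPf hN) mulr0.
Qed.

Lemma geltM g h : gelt (g * h) = gelt g * gelt h.
Proof.
apply/ffunP=> h'; rewrite gelt_mull !ffunE.
by rewrite -(inj_eq (mulgI g^-1%g)) mulKg.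
Qed.

Lemma galg_expand x : x = \sum_g x g *: gelt g.
Proof.
apply/ffunP=> h; rewrite sum_ffunE (bigD1 h) //= !ffunE eqxx.
rewrite big1 => [|g gNh]; first by rewrite addr0 [RHS]mulr1.
by rewrite !ffunE eq_sym (negPf gNh) scaler0.
Qed.

(** The linear anti-automorphism inverting the group elements, in the role of a transpose. *)
Definition gtau x : A := [ffun g => x g^-1%g].

Lemma gtauK : involutive gtau.
Proof. by move=> x; apply/ffunP=> g; rewrite !ffunE invgK. Qed.

Lemma gtauM x y : gtau (x * y) = gtau y * gtau x.
Proof.
apply/ffunP=> g; rewrite !(ffunE, gmulE).
rewrite (reindex_inj (mulgI g^-1%g)) /=; apply: eq_bigr => h _.
by rewrite !ffunE invMg !invgK mulgK invMg invgK mulrC.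
Qed.

Fact gtau_linear : linear gtau.
Proof. by move=> c x y; apply/ffunP=> g; rewrite !ffunE. Qed.

HB.instance Definition _ := GRing.isLinear.Build k A A _ gtau gtau_linear.

Lemma gtau_gelt g : gtau (gelt g) = gelt g^-1%g.
Proof. by apply/ffunP=> h; rewrite !ffunE eq_invg_sym eq_sym. Qed.

Lemma gtau_eq0 x : (gtau x == 0) = (x == 0).
Proof. by rewrite -(inj_eq (inv_inj gtauK)) gtauK linear0. Qed.

Lemma galg_sandwich x z y :
  x * z * y = \sum_g z g *: (x * gelt g * y).
Proof.
rewrite {1}[z]galg_expand mulr_sumr mulr_suml; apply: eq_bigr => g _.
by rewrite -scalerAr -scalerAl.
Qed.

(** Integrality keeps sums of squares of coefficients from vanishing, which an arbitrary field of
    characteristic zero does not. *)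
Definition gint x := forall g, exists m : int, x g = m%:~R.

Lemma gint_gelt g : gint (gelt g).
Proof. by move=> h; exists ((h == g)%:R); rewrite ffunE; case: eqP. Qed.

Lemma gint_sign b x : gint x -> gint ((-1) ^+ b *: x).
Proof.
move=> ix g; have [m xg] := ix g; exists ((-1) ^+ b * m).
by rewrite ffunE xg /GRing.scale /= rmorphM rmorph_sign.
Qed.

Lemma gint_sum (I : finType) (P : pred I) (F : I -> A) :
  (forall i, P i -> gint (F i)) -> gint (\sum_(i | P i) F i).
Proof.
move=> iF; apply: (big_ind gint) => // [g|x y ix iy g].
  by exists 0; rewrite ffunE.
by have [m xg] := ix g; have [p yg] := iy g; exists (m + p);
   rewrite ffunE xg yg rmorphD.
Qed.

Lemma gint_mul x y : gint x -> gint y -> gint (x * y).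
Proof.
move=> ix iy g; rewrite gmulE.
apply: (big_ind (fun a : k => exists m : int, a = m%:~R)).
- by exists 0.
- by move=> a b [m ->] [p ->]; exists (m + p); rewrite rmorphD.
- move=> h _; have [m ->] := ix h; have [p ->] := iy (h^-1 * g)%g.
  by exists (m * p); rewrite rmorphM.
Qed.

Lemma pnatr_neq0 (char0 : [pchar k] =i pred0) m :
  (m%:R == 0 :> k) = (m == 0%N).
Proof. by move/pcharf0P: char0 => ->. Qed.

Lemma intr_eq0_char0 (char0 : [pchar k] =i pred0) (m : int) :
  (m%:~R == 0 :> k) = (m == 0).
Proof.
case: m => m; first exact: pnatr_neq0.
by rewrite NegzE rmorphN oppr_eq0; apply: (pnatr_neq0 char0 m.+1).
Qed.

(* The coefficient of [x * gtau x] at 1 is a sum of squares of integers. *)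
Lemma gint_mul_tau_neq0 (char0 : [pchar k] =i pred0) x :
  gint x -> x != 0 -> x * gtau x != 0.
Proof.
move=> ix xN0.
have [f fE] : exists f : gT -> int, forall g, x g = (f g)%:~R.
  exact: (fin_all_exists (P := fun g m => x g = m%:~R) ix).
have [g xgN0] : exists g, x g != 0.
  apply/existsP; apply: contraNT xN0 => /existsPn x0.
  by apply/eqP/ffunP=> g; rewrite ffunE; apply/eqP; rewrite -[_ == _]negbK x0.
apply/eqP=> /ffunP/(_ 1%g); rewrite gmulE ffunE.
under eq_bigr => h _.
  have -> : x h * gtau x (h^-1 * 1)%g = (`|f h| ^ 2)%N%:R.
    rewrite ffunE mulg1 invgK fE -expr2 -rmorphXn /=.
    by rewrite -[RHS]/(_%:Z%:~R) PoszM abszE -expr2 real_normK ?num_real.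
  over.
rewrite -natr_sum => /eqP; rewrite pnatr_neq0 // sum_nat_eq0 => /forallP/(_ g).
by rewrite /= expn_eq0 andbT absz_eq0 -(intr_eq0_char0 char0) -fE (negPf xgN0).
Qed.


End GroupAlgebra.

(** * Young symmetrizers *)

Section FibreStabilizers.
Variables (k : fieldType) (d : nat).
Implicit Types (f : 'I_d -> nat) (p q g : 'S_d).

(** Taking [f] to be the row or the column coordinate gives the row and the column group. *)
Definition fstab f : {set 'S_d} := [set s : 'S_d | [forall r, f (s r) == f r]].

Lemma fstabP f p : reflect (forall r, f (p r) = f r) (p \in fstab f).
Proof. by rewrite inE; apply: 'forall_eqP. Qed.

Fact fstab_group_set f : group_set (fstab f).
Proof.
apply/group_setP; split=> [|p q /fstabP fp /fstabP fq].
  by apply/fstabP=> r; rewrite perm1.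
by apply/fstabP=> r; rewrite permM fq fp.
Qed.
Canonical fstab_group f := group (fstab_group_set f).

Definition gsym f : galg k 'S_d := \sum_(p in fstab f) gelt k p.
Definition galt f : galg k 'S_d := \sum_(q in fstab f) (-1) ^+ q *: gelt k q.

Lemma sign_odd_permM p q :
  (-1) ^+ (p * q)%g = (-1) ^+ p * (-1) ^+ q :> k.
Proof. by rewrite odd_permM signr_addb. Qed.

Lemma gsymMl f p : p \in fstab f -> gelt k p * gsym f = gsym f.
Proof.
move=> fp; rewrite /gsym mulr_sumr [RHS](reindex_inj (mulgI p)) /=.
by apply: eq_big => [q|q _]; rewrite ?groupMl // geltM.
Qed.

Lemma galtMr f p : p \in fstab f -> galt f * gelt k p = (-1) ^+ p *: galt f.
Proof.
move=> fp; rewrite /galt mulr_suml scaler_sumr [RHS](reindex_inj (mulIg p)) /=.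
apply: eq_big => [q|q _]; rewrite ?groupMr // geltM -scalerAl scalerA.
by rewrite sign_odd_permM mulrC -mulrA -signr_addb addbb mulr1.
Qed.

Lemma gtau_gsym f : gtau (gsym f) = gsym f.
Proof.
rewrite /gsym linear_sum [RHS](reindex_inj invg_inj) /=.
by apply: eq_big => [q|q _]; rewrite ?groupV // gtau_gelt.
Qed.

Lemma gtau_galt f : gtau (galt f) = galt f.
Proof.
rewrite /galt linear_sum [RHS](reindex_inj invg_inj) /=.
by apply: eq_big => [q|q _]; rewrite ?groupV // linearZ /= gtau_gelt odd_permV.
Qed.

Lemma gint_gsym f : gint (gsym f).
Proof. by apply: gint_sum => p _; apply: gint_gelt. Qed.

Lemma gint_galt f : gint (galt f).
Proof. by apply: gint_sum => p _; apply/gint_sign/gint_gelt. Qed.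

(* A transposition of the column group conjugate to one of the row group makes *)
(* the product equal to its opposite.                                          *)
Lemma galt_gelt_gsym0 (char0 : [pchar k] =i pred0) f f' g r r' :
  r != r' -> f r = f r' -> f' (g r) = f' (g r') ->
  galt f * gelt k g * gsym f' = 0.
Proof.
move=> rNr' frr' fgrr'.
have tP (h : 'I_d -> nat) x y : h x = h y -> tperm x y \in fstab h.
  by move=> hxy; apply/fstabP=> z; case: tpermP => // ->.
set z := _ * _; have zN : z = - z.
  rewrite {1}/z -[gsym f'](gsymMl (tP _ _ _ fgrr')) mulrA.
  rewrite -(mulrA (galt f)) -geltM -tpermJ conjgE mulKVg geltM mulrA.
  rewrite galtMr ?tP // odd_tperm rNr' expr1 scaleN1r.
  by rewrite !mulNr.
have : 2%:R *: z = 0 by rewrite scaler_nat mulr2n {1}zN addNr.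
by move/eqP; rewrite scaler_eq0 pnatr_neq0 // => /eqP.
Qed.

End FibreStabilizers.

Section Diagrams.
Variable d : nat.
Implicit Types (row col : 'I_d -> nat).

(** The boxes are the elements of ['I_d] in any numbering; the occupied positions only have to be
    distinct and closed towards the corner. *)
Definition is_diagram row col :=
  injective (fun r => (row r, col r)) /\
  forall r i j, (i <= row r)%N -> (j <= col r)%N ->
    exists2 r', row r' = i & col r' = j.

(** The partial sums of row lengths, compared by the dominance order; also used for fillings [f] in
    place of [row]. *)
Definition row_count row i := #|[set r | (row r < i)%N]|.

Lemma card_lt_inj (T : finType) (A : {set T}) (f : T -> nat) i :
  {in A &, injective f} -> (forall x, x \in A -> (f x < i)%N) -> (#|A| <= i)%N.
Proof.
move=> f_inj f_lt; rewrite cardE -(size_map f) -(size_iota 0 i).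
apply: uniq_leq_size => [|y /mapP[x]].
  rewrite map_inj_in_uniq ?enum_uniq // => x y.
  by rewrite !mem_enum; apply: f_inj.
by rewrite mem_enum => xA ->; rewrite mem_iota f_lt.
Qed.

Lemma card_ge_surj (T : finType) (A : {set T}) (f : T -> nat) i :
  (forall j, (j < i)%N -> exists2 x, x \in A & f x = j) -> (i <= #|A|)%N.
Proof.
move=> f_surj; rewrite cardE -(size_map f) -(size_iota 0 i).
apply: uniq_leq_size => [|j]; first exact: iota_uniq.
rewrite mem_iota /= => /f_surj[x xA <-].
by apply: map_f; rewrite mem_enum.
Qed.

Section Columns.
Variables (row col : 'I_d -> nat) (Drc : is_diagram row col).

Lemma diagram_eq r r' : row r = row r' -> col r = col r' -> r = r'.
Proof. by move=> er ec; apply: Drc.1; rewrite er ec. Qed.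

(** Either column [c] reaches row [i], and then it has at least [i] boxes above that row while
    injectivity allows at most [i] values below [i]; or the right-hand side counts the whole
    column. *)
Lemma column_count (f : 'I_d -> nat) c i :
  {in [set r | col r == c] &, injective f} ->
  (#|[set r | (f r < i)%N & col r == c]| <=
   #|[set r | (row r < i)%N & col r == c]|)%N.
Proof.
move=> f_inj.
have [/existsP[r /andP[/eqP rc ri]]|/existsPn all_lt] :=
    boolP [exists r, (col r == c) && (i <= row r)%N].
  apply: (@leq_trans i).
    apply: (card_lt_inj (f := f)) => [x y|x]; rewrite !inE; last by case/andP.
    by move=> /andP[_ xc] /andP[_ yc]; apply: f_inj; rewrite inE.
  apply: (card_ge_surj (f := row)) => j ji.
  have [r' r'j r'c] := Drc.2 r j c (leq_trans (ltnW ji) ri) (eq_leq (esym rc)).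
  by exists r'; rewrite // inE r'j ji r'c eqxx.
apply/subset_leq_card/subsetP=> r; rewrite !inE => /andP[_ rc].
by have := all_lt r; rewrite rc /= -ltnNge => ->.
Qed.

Lemma card_column_sum (P : pred 'I_d) :
  #|[set r | P r]| = (\sum_(c < (\max_r col r).+1)
                        #|[set r | P r & col r == c]|)%N.
Proof.
rewrite -sum1_card (partition_big (fun r => inord (col r) : 'I_(\max_r col r).+1) predT) //=.
apply: eq_bigr => c _; rewrite -sum1_card; apply: eq_bigl => r.
by rewrite !inE -val_eqE /= inordK // ltnS; apply: leq_bigmax.
Qed.

Lemma row_count_le (f : 'I_d -> nat) i :
  (forall r r', r != r' -> col r = col r' -> f r != f r') ->
  (row_count f i <= row_count row i)%N.
Proof.
move=> f_inj; rewrite /row_count !(card_column_sum (fun r => _ < i)%N).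
apply: leq_sum => c _; apply: column_count => r r'; rewrite !inE.
move=> /eqP rc /eqP r'c frr'; apply/eqP; apply: contraTT isT => rNr'.
by have := f_inj r r' rNr'; rewrite rc r'c frr' eqxx => /(_ erefl).
Qed.

Lemma row_count_perm (f : 'I_d -> nat) (g : 'S_d) i :
  row_count (fun r => f (g r)) i = row_count f i.
Proof.
rewrite /row_count -[RHS](card_preimset _ (@perm_inj _ g)).
by apply: eq_card => r; rewrite !inE.
Qed.

(** The bounds of [column_count] for [row (g r)] have the same total as the counts for [row], so
    they are equalities column by column. Hence the column of [r] has a box in row [row (g r)];
    sending [r] to that box defines [q]. *)
Lemma row_col_factor (g : 'S_d) :
  (forall r r', r != r' -> col r = col r' -> row (g r) != row (g r')) ->
  exists q p, [/\ q \in fstab col, p \in fstab row & g = (q * p)%g].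
Proof.
move=> g_inj.
have g_injc c : {in [set r | col r == c] &, injective (fun r => row (g r))}.
  move=> r r'; rewrite !inE => /eqP rc /eqP r'c frr'.
  apply/eqP; apply: contraTT isT => rNr'.
  by have := g_inj r r' rNr'; rewrite rc r'c frr' eqxx => /(_ erefl).
have eq_cnt i (c : 'I_(\max_r col r).+1) :
    #|[set r | (row (g r) < i)%N & col r == c]| =
    #|[set r | (row r < i)%N & col r == c]|.
  have := leqif_sum (fun (c : 'I_(\max_r col r).+1) (_ : xpredT c) =>
                       leqif_eq (@column_count (fun r => row (g r)) c i (g_injc c))).
  rewrite -!(card_column_sum (fun r => _ < i)%N) => -[_].
  rewrite -[X in (X == _) = _]/(row_count (fun r => row (g r)) i) row_count_perm.
  by rewrite eqxx => /esym/forallP/(_ c)/= /eqP.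
have boxP r : exists r', (row r' == row (g r)) && (col r' == col r).
  (* Otherwise the column of [r] would lie entirely above row [row (g r)], and [r] would be missing
     from the left side of [eq_cnt] only. *)
  apply/existsP; apply: contraTT isT => /existsPn noBox.
  have cP : (col r < (\max_r col r).+1)%N by rewrite ltnS leq_bigmax.
  have := eq_cnt (row (g r)) (Ordinal cP); rewrite /=.
  have -> : [set r' | (row r' < row (g r))%N & col r' == col r] =
            [set r' | col r' == col r].
    apply/setP=> r'; rewrite !inE andbC; case: eqP => //= r'c.
    apply: contraTT isT; rewrite -leqNgt => ler'.
    have [r2 r2r r2c] := Drc.2 _ _ _ ler' (leqnn _).
    by have := noBox r2; rewrite r2r r2c r'c !eqxx.
  move=> eq_c; have /proper_card : [set r' | (row (g r') < row (g r))%N & col r' == col r]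
      \proper [set r' | col r' == col r].
    apply/properP; split; first by apply/subsetP=> r'; rewrite !inE => /andP[].
    by exists r; rewrite !inE ?eqxx // ltnn.
  by rewrite eq_c ltnn.
pose qf r := xchoose (boxP r).
have qrow r : row (qf r) = row (g r) by case/andP: (xchooseP (boxP r)) => /eqP.
have qcol r : col (qf r) = col r by case/andP: (xchooseP (boxP r)) => _ /eqP.
have q_inj : injective qf.
  move=> r r' eq_q; apply/eqP; apply: contraTT isT => rNr'.
  have := g_inj r r' rNr'; rewrite -!qrow -(qcol r) -(qcol r') eq_q eqxx.
  by move/(_ erefl).
exists (perm q_inj), ((perm q_inj)^-1 * g)%g; split; last by rewrite mulKVg.
  by apply/fstabP=> r; rewrite permE qcol.
apply/fstabP=> r; rewrite permM -[in RHS](permKV (perm q_inj) r).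
by rewrite [in RHS]permE qrow.
Qed.

End Columns.

Section Symmetrizer.
Variables (k : fieldType) (char0 : [pchar k] =i pred0).
Implicit Types x : galg k 'S_d.

Definition gyoung row col : galg k 'S_d := galt k col * gsym k row.

Lemma gint_gyoung row col : gint (gyoung row col).
Proof. by apply: gint_mul; [apply: gint_galt | apply: gint_gsym]. Qed.

(** By linearity [x] is one permutation [g]. If [g] sends two boxes of a column to the same row, the
    product vanishes; otherwise [g] is a column permutation times a row permutation, and the outer
    factors absorb both. *)
Lemma galt_gsym_scalar row col x : is_diagram row col ->
  exists a : k, galt k col * x * gsym k row = a *: gyoung row col.
Proof.
move=> Drc; rewrite galg_sandwich.
apply: (big_ind (fun z => exists a : k, z = a *: gyoung row col)).
- by exists 0; rewrite scale0r.
- by move=> _ _ [a ->] [b ->]; exists (a + b); rewrite scalerDl.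
move=> g _.
have [/'forall_forallP g_inj|] := boolP [forall r, forall r',
    (r != r') && (col r == col r') ==> (row (g r) != row (g r'))].
  have [|q [p [Cq Rp ->]]] := @row_col_factor _ _ Drc g.
    by move=> r r' rN rc; have := g_inj r r'; rewrite rN rc eqxx.
  exists (x (q * p)%g * (-1) ^+ q).
  by rewrite geltM mulrA -mulrA gsymMl // galtMr // -scalerAl scalerA.
case/forallPn=> r /forallPn[r']; rewrite negb_imply negbK.
move=> /andP[/andP[rN /eqP rc] /eqP rr]; exists 0.
by rewrite (galt_gelt_gsym0 char0 rN rc rr) scaler0 scale0r.
Qed.

Lemma galt_gsym_dominance row col row' x : is_diagram row col ->
  galt k col * x * gsym k row' != 0 ->
  forall i, (row_count row' i <= row_count row i)%N.
Proof.
move=> Drc xN0 i.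
have [/forallP g0|/forallPn[g gN0]] :=
    boolP [forall g, galt k col * gelt k g * gsym k row' == 0].
  rewrite galg_sandwich big1 ?eqxx // in xN0 => g _.
  by rewrite (eqP (g0 g)) scaler0.
rewrite -(row_count_perm _ g); apply: (row_count_le Drc) => r r' rN rc.
by apply: contraNneq gN0 => rr; rewrite (galt_gelt_gsym0 char0 rN rc rr).
Qed.

(** The outer factors [galt k col] and [gsym k row'] give one inequality; the inner ones,
    [gsym k row] and [galt k col'], give the reverse one once [gtau] has exchanged their order. *)
Lemma gyoung_mul_neq0 row col row' col' x :
    is_diagram row col -> is_diagram row' col' ->
    gyoung row col * x * gyoung row' col' != 0 ->
  row_count row =1 row_count row'.
Proof.
move=> D D' xN0 i; apply/eqP; rewrite eqn_leq; apply/andP; split.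
  apply: (galt_gsym_dominance D' (x := gtau x)).
  rewrite -gtau_eq0 !gtauM gtauK gtau_gsym gtau_galt mulrA.
  apply: contraNneq xN0 => eq0; rewrite /gyoung !mulrA -!(mulrA (galt k col)) mulrA.
  by rewrite eq0 mulr0 mul0r.
apply: (galt_gsym_dominance D (x := gsym k row * x * galt k col')).
by move: xN0; rewrite /gyoung !mulrA.
Qed.

End Symmetrizer.
End Diagrams.

(** * Involutions and signed centralizers *)

Lemma restr_permJ (T : finType) (S S' : {set T}) (g h : {perm T}) :
    (forall x, (g x \in S') = (x \in S)) -> h \in 'N(S | 'P) ->
  restr_perm S' (h ^ g) = (restr_perm S h ^ g)%g.
Proof.
move=> gS hN.
have hgN : (h ^ g)%g \in 'N(S' | 'P).
  apply/astabsP=> x; rewrite -(permKV g x) /= apermE permJ !gS.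
  exact: (astabsP hN).
apply/permP=> x; rewrite -(permKV g x); set y := (g^-1)%g x; rewrite permJ.
have [yS|yNS] := boolP (y \in S).
  by rewrite !restr_permE ?gS // permJ.
by rewrite !(out_perm (restr_perm_on _ _)) ?gS.
Qed.

Section SignedCentralizer.
Variables (k : fieldType) (d : nat).
Implicit Types (t g h : 'S_d).

Definition fixpts t : {set 'I_d} := [set r | t r == r].

Lemma fixptsP t r : reflect (t r = r) (r \in fixpts t).
Proof. by rewrite inE; apply: eqP. Qed.

Lemma perm_cent1P t h : reflect (forall r, h (t r) = t (h r)) (h \in 'C[t]).
Proof.
apply: (iffP cent1P) => [/permP ht r|ht].
  by have := ht r; rewrite !permM.
by apply/permP=> r; rewrite !permM.
Qed.

Lemma cent1_norm_fixpts t h : h \in 'C[t] -> h \in 'N(fixpts t | 'P).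
Proof.
move/perm_cent1P=> ht; apply/astabsP=> r; rewrite /= apermE !inE -ht.
exact: (inj_eq perm_inj).
Qed.

Definition fodd t h : bool := odd_perm (restr_perm (fixpts t) h).

Lemma foddM t g h : g \in 'C[t] -> h \in 'C[t] ->
  fodd t (g * h)%g = fodd t g (+) fodd t h.
Proof.
by move=> Cg Ch; rewrite /fodd morphM ?odd_permM ?cent1_norm_fixpts.
Qed.

Lemma foddV t h : h \in 'C[t] -> fodd t h^-1 = fodd t h.
Proof. by move=> Ch; rewrite /fodd morphV ?odd_permV ?cent1_norm_fixpts. Qed.

Lemma mem_fixptsJ t g r : (g r \in fixpts (t ^ g)) = (r \in fixpts t).
Proof. by rewrite !inE permJ (inj_eq perm_inj). Qed.

Lemma foddJ t g h : h \in 'C[t] -> fodd (t ^ g) (h ^ g) = fodd t h.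
Proof.
move=> Ch; rewrite /fodd (@restr_permJ _ (fixpts t)) ?odd_permJ //.
  exact: mem_fixptsJ.
exact: cent1_norm_fixpts.
Qed.

Definition geps t : galg k 'S_d := \sum_(h in 'C[t]) (-1) ^+ fodd t h *: gelt k h.

Lemma gepsE t h : geps t h = if h \in 'C[t] then (-1) ^+ fodd t h else 0.
Proof.
rewrite sum_ffunE; case: ifP => [Ch|Ch].
  rewrite (bigD1 h) //= !ffunE eqxx [_ *: _]mulr1 big1 ?addr0 // => g /andP[_].
  by rewrite !ffunE eq_sym => /negPf->; rewrite scaler0.
rewrite big1 // => g Cg; rewrite !ffunE; case: eqP => [hg|_].
  by rewrite hg Cg in Ch.
by rewrite scaler0.
Qed.

Lemma gepsMl t h : h \in 'C[t] -> gelt k h * geps t = (-1) ^+ fodd t h *: geps t.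
Proof.
move=> Ch; apply/ffunP=> g; rewrite gelt_mull ffunE !gepsE.
rewrite groupMl ?groupV //; case: ifP => Cg; last by rewrite scaler0.
by rewrite foddM ?groupV // foddV // signr_addb.
Qed.

Lemma geps_sqr t : geps t * geps t = #|'C[t]|%:R *: geps t.
Proof.
rewrite {1}/geps mulr_suml (eq_bigr (fun=> geps t)) => [|h Ch].
  by rewrite sumr_const scaler_nat.
by rewrite -scalerAl gepsMl // scalerA -signr_addb addbb scale1r.
Qed.

Lemma gtau_geps t : gtau (geps t) = geps t.
Proof.
apply/ffunP=> h; rewrite ffunE !gepsE groupV.
by case: ifP => // Ch; rewrite foddV.
Qed.

Lemma gepsJ t g : geps (t ^ g) = gelt k g^-1 * geps t * gelt k g.
Proof.
apply/ffunP=> h; rewrite gelt_mulr gelt_mull !gepsE.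
set x := (_ * (_ * _))%g; have -> : h = (x ^ g)%g.
  by rewrite conjgE /x invgK -!mulgA mulVg mulg1 mulKg.
by rewrite cent1J memJ_conjg; case: ifP => // Ch; rewrite foddJ.
Qed.

Lemma gint_geps t : gint (geps t).
Proof. by apply: gint_sum => h _; apply/gint_sign/gint_gelt. Qed.

Lemma card_cent1_neq0 (char0 : [pchar k] =i pred0) t : #|'C[t]|%:R != 0 :> k.
Proof. by rewrite pnatr_neq0 // -lt0n cardG_gt0. Qed.

End SignedCentralizer.

(** * The column-pairing involution of a diagram *)

Section Flip.
Variables (d : nat) (row col : 'I_d -> nat) (Drc : is_diagram row col).

Definition flipc c := if odd c then c.-1 else c.+1.

Lemma flipcK : involutive flipc.
Proof.
by case=> [|c] //; rewrite /flipc /=; case oc: (odd c); rewrite /= oc.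
Qed.

Lemma odd_flipc c : odd (flipc c) = ~~ odd c.
Proof. by rewrite /flipc; case: c => [|c] //=; case oc: (odd c); rewrite /= oc. Qed.

Lemma flipc_neq c : flipc c != c.
Proof. by apply: contraTneq isT => fc; have := odd_flipc c; rewrite fc; case: odd. Qed.

(** The default fixes a box whose partner is missing, which is the last box of a row of odd
    length. *)
Definition flip_fun r : 'I_d :=
  odflt r [pick r' | (row r' == row r) && (col r' == flipc (col r))].

Lemma flip_funP r : 
  (row (flip_fun r) = row r /\ col (flip_fun r) = flipc (col r)) \/
  (flip_fun r = r /\ forall r', row r' = row r -> col r' <> flipc (col r)).
Proof.
rewrite /flip_fun; case: pickP => [r' /andP[/eqP ? /eqP ?]|noP]; [left|right] => //.
by split=> // r' er ec; have := noP r'; rewrite er ec !eqxx.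
Qed.

Lemma flip_fun_box r r' :
  row r' = row r -> col r' = flipc (col r) -> flip_fun r = r'.
Proof.
move=> er ec; have [[er2 ec2]|[_ noB]] := flip_funP r; last by have := noB _ er.
by apply: (diagram_eq Drc); rewrite ?er2 ?ec2.
Qed.

Lemma flip_funK : involutive flip_fun.
Proof.
move=> r; have [[er ec]|[e _]] := flip_funP r; last by rewrite !e.
by apply: flip_fun_box; rewrite ?er ?ec ?flipcK.
Qed.

Definition flip : 'S_d := perm (inv_inj flip_funK).

Lemma flipE r : flip r = flip_fun r. Proof. exact: permE. Qed.

Lemma flip_invol : (flip * flip = 1)%g.
Proof. by apply/permP=> r; rewrite permM !flipE flip_funK perm1. Qed.

Lemma row_flip r : row (flip r) = row r.
Proof. by rewrite flipE; have [[->]|[->]] := flip_funP r. Qed.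

Lemma col_flip r : r \notin fixpts flip -> col (flip r) = flipc (col r).
Proof.
by rewrite inE flipE; have [[_ -> //]|[-> _]] := flip_funP r; rewrite eqxx.
Qed.

Lemma flip_box r r' :
  row r' = row r -> col r' = flipc (col r) -> flip r = r'.
Proof. by rewrite flipE; apply: flip_fun_box. Qed.

(** A fixed box lies in an even column and has no right neighbour, so it ends its row. *)
Lemma flip_fixpts_inj r r' : r \in fixpts flip -> r' \in fixpts flip ->
  row r = row r' -> r = r'.
Proof.
have noB s : s \in fixpts flip -> forall s', row s' = row s -> col s' <> flipc (col s).
  move=> /fixptsP fs s' er ec; have := flip_box er ec.
  by rewrite fs => ss'; have := flipc_neq (col s); rewrite -ec ss' eqxx.
have even_col s : s \in fixpts flip -> ~~ odd (col s).
  move=> fs; apply/negP=> os.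
  have le_c : (flipc (col s) <= col s)%N by rewrite /flipc os leq_pred.
  have [s' er ec] := Drc.2 s (row s) (flipc (col s)) (leqnn _) le_c.
  by have := noB _ fs _ er.
have lt_col s s' : s \in fixpts flip -> s' \in fixpts flip ->
    row s = row s' -> ~ (col s < col s')%N.
  move=> fs fs' er lt_c; have le_c : (flipc (col s) <= col s')%N.
    by rewrite /flipc (negPf (even_col _ fs)).
  have [s2 er2 ec2] := Drc.2 s' (row s') (flipc (col s)) (leqnn _) le_c.
  by have := noB _ fs s2; rewrite er2 => /(_ (esym er)).
move=> fr fr' er; apply: (diagram_eq Drc) => //.
case: (ltngtP (col r) (col r')) => // lt_c.
  by have := lt_col _ _ fr fr' er.
by have := lt_col _ _ fr' fr (esym er).
Qed.

Section FlipSign.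
Variables (q p : 'S_d) (Cq : q \in fstab col) (Rp : p \in fstab row).
Hypothesis Ct : (q * p)%g \in 'C[flip].

Let rowq r : row ((q * p)%g r) = row (q r).
Proof. by rewrite permM (fstabP _ _ Rp). Qed.

(** As [p] keeps rows, [q r] has the same row as [(q * p) r], and [q] keeps columns; so [q (flip r)]
    has the coordinates of the partner of [q r]. *)
Lemma flip_col_notin_fixpts r : r \notin fixpts flip -> q (flip r) = flip (q r).
Proof.
move=> Nr; apply/esym/flip_box.
  by rewrite -!rowq (perm_cent1P _ _ Ct) row_flip.
by rewrite !(fstabP _ _ Cq) col_flip.
Qed.

Let qmoved r : (q r \in fixpts flip) = (r \in fixpts flip).
Proof.
(* The permutation [q] maps the finite set of moved boxes into itself, hence onto itself. *)
have sub : [set q r | r in ~: fixpts flip] \subset ~: fixpts flip.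
  apply/subsetP=> _ /imsetP[x Nx ->]; rewrite in_setC in Nx.
  rewrite in_setC inE -flip_col_notin_fixpts // (inj_eq perm_inj).
  by move: Nx; rewrite inE.
have eqs : [set q r | r in ~: fixpts flip] = ~: fixpts flip.
  by apply/eqP; rewrite eqEcard sub card_imset ?leqnn //; apply: perm_inj.
apply: negb_inj; rewrite -[RHS]in_setC -[LHS]in_setC -{1}eqs mem_imset //.
exact: perm_inj.
Qed.

Lemma flip_col_cent : q \in 'C[flip].
Proof.
apply/perm_cent1P=> r; have [fr|/flip_col_notin_fixpts//] := boolP (r \in fixpts flip).
rewrite (fixptsP _ _ fr); have := fr; rewrite -qmoved => /fixptsP->.
by [].
Qed.

(** Both images are fixed by [flip] and lie in one row, which has at most one fixed box. *)
Lemma flip_col_fixpts r : r \in fixpts flip -> (q * p)%g r = q r.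
Proof.
move=> fr; apply: flip_fixpts_inj; last exact: rowq.
  apply/fixptsP; rewrite -(perm_cent1P _ _ Ct); congr (_ _).
  exact/fixptsP.
by rewrite qmoved.
Qed.

Lemma flip_fodd_col : fodd flip (q * p)%g = odd_perm (restr_perm (fixpts flip) q).
Proof.
rewrite /fodd; congr (odd_perm _); apply/permP=> r.
have [fr|fr] := boolP (r \in fixpts flip).
  by rewrite !restr_permE ?cent1_norm_fixpts ?flip_col_cent // flip_col_fixpts.
by rewrite !(out_perm (restr_perm_on _ _)).
Qed.

(** The fixed boxes, the moved boxes in even columns and those in odd columns are each preserved by
    [q]. Its restrictions to the last two sets are conjugate by [flip], so their signs cancel; on
    the fixed boxes it agrees with [q * p]. *)
Lemma flip_odd_col : odd_perm q = fodd flip (q * p)%g.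
Proof.
pose S b := [set r | (r \notin fixpts flip) && (odd (col r) == b)].
have NS b : q \in 'N(S b | 'P).
  by apply/astabsP=> r; rewrite /= apermE inE qmoved (fstabP _ _ Cq) [RHS]inE.
have Ct_flip r : r \notin fixpts flip -> odd (col (flip r)) = ~~ odd (col r).
  by move=> Nr; rewrite col_flip // odd_flipc.
have flipS r : (flip r \in S true) = (r \in S false).
  rewrite !in_set (_ : (flip (flip r) == flip r) = (flip r == r)); last first.
    exact: (inj_eq perm_inj).
  have [//|Nr] := boolP (flip r == r).
  by rewrite Ct_flip ?inE //; case: odd.
have NF := cent1_norm_fixpts flip_col_cent.
have qE : q = (restr_perm (fixpts flip) q *
               (restr_perm (S false) q * restr_perm (S true) q))%g.
  apply/permP=> r; rewrite !permM.
  have [fr|Nr] := boolP (r \in fixpts flip).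
    rewrite (restr_permE NF fr) !(out_perm (restr_perm_on (S _) _)) //;
      by rewrite inE qmoved fr.
  rewrite (out_perm (restr_perm_on _ _) Nr).
  have [oc|oc] := boolP (odd (col r)).
    rewrite (out_perm (restr_perm_on (S false) _)); last by rewrite inE oc andbF.
    by rewrite restr_permE ?NS // inE Nr oc.
  have rS : r \in S false by rewrite inE Nr (negPf oc).
  rewrite (restr_permE (NS false) rS) (out_perm (restr_perm_on _ _)) //.
  by rewrite inE (fstabP _ _ Cq) (negPf oc) andbF.
have SE : restr_perm (S true) q = (restr_perm (S false) q ^ flip)%g.
  rewrite -(restr_permJ flipS (NS false)); congr (restr_perm _ _).
  by rewrite conjgE (cent1P flip_col_cent) mulKg.
by rewrite flip_fodd_col [in LHS]qE !odd_permM SE odd_permJ addbb addbF.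
Qed.

End FlipSign.

Section GyoungEps.
Variables (k : fieldType) (char0 : [pchar k] =i pred0).

(** The coefficient at 1 counts the pairs [q], [p] whose product commutes with [flip], because
    [flip_odd_col] makes the sign of [q] cancel that of [geps]. The pair of identities is one of
    them. *)
Lemma gyoung_geps_neq0 : gyoung k row col * geps k flip != 0.
Proof.
apply: contraTneq isT => /ffunP/(_ 1%g)/eqP; rewrite !ffunE.
rewrite -gmulE /gyoung.
have -> : galt k col * gsym k row =
    \sum_(q in fstab col) \sum_(p in fstab row) (-1) ^+ q *: gelt k (q * p)%g.
  rewrite /galt mulr_suml; apply: eq_bigr => q _.
  rewrite /gsym mulr_sumr; apply: eq_bigr => p _.
  by rewrite geltM scalerAl.
rewrite mulr_suml sum_ffunE.
have termE q p : q \in fstab col -> p \in fstab row ->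
    ((-1) ^+ q *: gelt k (q * p)%g * geps k flip) 1%g =
    ((q * p)%g \in 'C[flip])%:R.
  move=> Cq Rp; rewrite -scalerAl ffunE gelt_mull mulg1 gepsE groupV.
  case: ifP => Ct; last by rewrite scaler0.
  rewrite foddV // -(flip_odd_col Cq Rp Ct) /GRing.scale /=.
  by rewrite -signr_addb addbb.
under eq_bigr => q Cq.
  rewrite mulr_suml sum_ffunE; under eq_bigr => p Rp do rewrite (termE q p Cq Rp).
  rewrite -natr_sum; over.
rewrite -natr_sum pnatr_neq0 // -leqn0 leqNgt.
rewrite (bigD1 1%g) ?group1 //= (bigD1 1%g) ?group1 //= mulg1 group1.
by [].
Qed.

End GyoungEps.
End Flip.

(** * Left ideals of the group algebra and triangularity *)

Lemma span_independent_family (K : fieldType) (V : vectType K) (I : finType)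
    (A : {set I}) (v : I -> V) (U : {vspace V}) :
    (forall i, i \in A -> v i \in U) ->
    (forall c : I -> K, \sum_(i in A) c i *: v i = 0 ->
       forall i, i \in A -> c i = 0) ->
  (#|A| <= \dim U)%N /\
  ((\dim U <= #|A|)%N ->
   forall u, u \in U -> exists c : I -> K, u = \sum_(i in A) c i *: v i).
Proof.
move=> vU v_free; pose X := [tuple v (enum_val j) | j < #|A|].
pose ext (c : 'I_#|A| -> K) i := \sum_(j | enum_val j == i) c j.
have extE c j : ext c (enum_val j) = c j.
  by apply: big_pred1 => j'; rewrite /= (inj_eq enum_val_inj).
have sumE c : \sum_(j < #|A|) c j *: X`_j = \sum_(i in A) ext c i *: v i.
  rewrite [RHS]big_enum_val /=; apply: eq_bigr => j _.
  by rewrite extE nth_mktuple.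
have freeX : free X.
  apply/freeP=> c; rewrite sumE => /v_free c0 j.
  by rewrite -extE c0 ?enum_valP.
have XU : (<<X>> <= U)%VS.
  by apply/span_subvP=> _ /mapP[j _ ->]; apply/vU/enum_valP.
have dimX : \dim <<X>> = #|A| by rewrite (eqnP freeX) size_tuple.
split=> [|dimU u Uu]; first by rewrite -dimX dimvS.
have eXU : (<<X>> == U)%VS by rewrite eqEdim XU dimX.
rewrite -(eqP eXU) in Uu.
by exists (ext (fun j => coord X j u)); rewrite -sumE; apply: coord_span.
Qed.

Section RightMultiplication.
Variables (k : fieldType) (gT : finGroupType) (y : galg k gT).

Definition gmulr (x : galg k gT) : galg k gT := x * y.

Fact gmulr_linear : linear gmulr.
Proof. by move=> c x z; rewrite /gmulr mulrDl scalerAl. Qed.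

HB.instance Definition _ :=
  GRing.isLinear.Build k (galg k gT) (galg k gT) _ gmulr gmulr_linear.

Definition gideal : {vspace galg k gT} := limg (linfun gmulr).

Lemma mem_gideal x : x * y \in gideal.
Proof. by rewrite -[x * y]/(gmulr x) -(lfunE gmulr) memv_img ?memvf. Qed.

End RightMultiplication.

Section Symmetrizers.
Variables (k : fieldType) (char0 : [pchar k] =i pred0) (d : nat).
Variables (row col : 'I_d -> nat) (Drc : is_diagram row col).
Local Notation c := (gyoung k row col).

Lemma gyoungE : c =
  \sum_(q in fstab col) \sum_(p in fstab row) (-1) ^+ q *: gelt k (q * p)%g.
Proof.
rewrite /gyoung /galt mulr_suml; apply: eq_bigr => q _.
rewrite /gsym mulr_sumr; apply: eq_bigr => p _.
by rewrite geltM scalerAl.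
Qed.

Lemma gyoung_supp h : c h != 0 ->
  exists q p, [/\ q \in fstab col, p \in fstab row & h = (q * p)%g].
Proof.
move=> ch; have [/existsP[q /andP[Cq /existsP[p /andP[Rp /eqP hE]]]]|noqp] :=
  boolP [exists q in fstab col, exists p in fstab row, h == (q * p)%g].
  by exists q, p.
case/eqP: ch; rewrite gyoungE sum_ffunE big1 // => q Cq.
rewrite sum_ffunE big1 // => p Rp; rewrite !ffunE.
case: eqP => [hE|]; last by rewrite scaler0.
case/existsP: noqp; exists q; rewrite Cq; apply/existsP; exists p.
by rewrite Rp hE eqxx.
Qed.

Lemma gyoung1 : c 1%g = 1.
Proof.
rewrite gyoungE sum_ffunE (bigD1 1%g) ?group1 //= sum_ffunE.
have uniq1 q p : q \in fstab col -> p \in fstab row -> (q * p = 1)%g -> q = 1%g.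
  move=> Cq Rp qp1; apply/permP=> r; rewrite perm1; apply: (diagram_eq Drc).
    by rewrite -(fstabP _ _ Rp) -permM qp1 perm1.
  exact: (fstabP _ _ Cq).
rewrite (bigD1 1%g) ?group1 //= !ffunE mulg1 eqxx odd_perm1 scale1r.
rewrite !big1 ?addr0 // => [q /andP[Cq qN1]|p /andP[Rp pN1]].
  rewrite sum_ffunE big1 // => p Rp; rewrite !ffunE eq_sym.
  by case: eqP => [/(uniq1 _ _ Cq Rp)/eqP|]; rewrite ?(negPf qN1) ?scaler0.
by rewrite !ffunE mul1g eq_sym (negPf pN1) scaler0.
Qed.

(** Right multiplication by [E * geps k t] embeds the left ideal of [c] into that of [geps k t], and
    right multiplication by [G * c] retracts it. Positivity is used twice: it makes
    [c * eps * gsym k row * galt k col] nonzero, then also the product of this element with its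
    [gtau], which forces the scalar supplied by [galt_gsym_scalar] to be invertible. *)
Lemma gyoung_geps_dual t g : flip Drc = (t ^ g)%g ->
  exists E G, c * (E * geps k t) * G * c = c.
Proof.
move=> flipE.
have xN0 := gyoung_geps_neq0 Drc char0.
have ix : gint (c * geps k (flip Drc)).
  by apply: gint_mul; [apply: gint_gyoung | apply: gint_geps].
have := gint_mul_tau_neq0 char0 ix xN0.
set eps := geps k (flip Drc) in xN0 ix *.
have epsE : eps = gelt k g^-1%g * geps k t * gelt k g by rewrite /eps flipE gepsJ.
have -> : c * eps * gtau (c * eps) =
    #|'C[flip Drc]|%:R *: (c * eps * gsym k row * galt k col).
  rewrite !gtauM gtau_gsym gtau_galt gtau_geps !mulrA -(mulrA c eps) geps_sqr.
  by rewrite -scalerAr -!scalerAl.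
rewrite scaler_eq0 (negPf (card_cent1_neq0 char0 _)) /= => zN0.
have iz : gint (c * eps * gsym k row * galt k col).
  by do 2![apply: gint_mul; last by [apply: gint_galt | apply: gint_gsym]].
have := gint_mul_tau_neq0 char0 iz zN0.
rewrite !gtauM gtau_gsym gtau_galt gtau_geps => wN0.
have [a aE] := galt_gsym_scalar char0
  (gsym k row * eps * gsym k row * galt k col * galt k col) Drc.
have aN0 : a != 0.
  apply: contraNneq wN0 => a0; move: aE; rewrite a0 scale0r !mulrA => eq0.
  by rewrite /gyoung eq0 !mul0r.
exists (gelt k g^-1%g), (a^-1 *: (gelt k g * gsym k row * galt k col)).
rewrite -scalerAr -scalerAl -[RHS](scalerK aN0) -aE epsE /gyoung !mulrA.
by [].
Qed.

(** The boxes are filled in the order [s 0], [s 1], and so on; increase down the columns is all that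
    triangularity requires. *)
Definition std_filling (s : 'S_d) :=
  forall x y, col (s x) = col (s y) -> (row (s x) < row (s y))%N -> (x < y)%N.

Let word (s : 'S_d) : d.-tuplelexi nat := [tuple row (s x) | x < d].

Let word_mul s q p : p \in fstab row -> word (s * (q * p))%g = word (s * q)%g.
Proof.
move=> Rp; apply: eq_from_tnth => x; rewrite !tnth_mktuple.
by rewrite mulgA permM (fstabP _ _ Rp).
Qed.

(** At the first place [x] where the words differ, [q] moves the box [s x] within its column. Were
    it moved up, the new box would be listed before [x], among boxes that [q] fixes. *)
Let word_lt s q : std_filling s -> q \in fstab col ->
  word s = word (s * q)%g \/ (word s < word (s * q)%g)%O.
Proof.
move=> std_s Cq; have [->|wN] := eqVneq (word s) (word (s * q)%g); [by left|right].
have [x0 x0P] : exists x, row (s x) != row ((s * q)%g x).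
  apply/existsP; apply: contraNT wN => /existsPn eq_w.
  apply/eqP/eq_from_tnth=> x; rewrite !tnth_mktuple; apply/eqP.
  by have := eq_w x; rewrite negbK.
case: (@arg_minnP _ x0 (fun x => row (s x) != row ((s * q)%g x))
         (fun x : 'I_d => x : nat) x0P) => x xP x_min.
have box_eq (y : 'I_d) : (y < x)%N -> q (s y) = s y.
  move=> yx; apply: (diagram_eq Drc); last exact: (fstabP _ _ Cq).
  apply/esym/eqP; apply: contraTT yx; rewrite -leqNgt -permM; exact: x_min.
apply/ltxi_tuplePlt; exists x => [y yx|]; rewrite !tnth_mktuple.
  by rewrite permM box_eq.
rewrite ltEnat /= ltn_neqAle xP /= leqNgt; apply/negP => lt_row.
rewrite permM in lt_row xP; pose y := (s^-1)%g (q (s x)).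
have sy : s y = q (s x) by rewrite permKV.
have yx : (y < x)%N by apply: std_s; rewrite sy // (fstabP _ _ Cq).
have := box_eq y yx; rewrite {2}sy => /perm_inj sysx.
by move: xP; rewrite -sy sysx eqxx.
Qed.

(* The words of the terms of [gelt s * gyoung row col] are at least that of    *)
(* [s] in the lexicographic order, whence a triangular system.                 *)
Lemma gyoung_independent (I : finType) (A : {set I}) (s : I -> 'S_d)
    (a : I -> k) :
    (forall i, i \in A -> std_filling (s i)) ->
    {in A &, forall i j, (forall x, row (s i x) = row (s j x)) -> i = j} ->
    \sum_(i in A) a i *: (gelt k (s i) * c) = 0 ->
  forall i, i \in A -> a i = 0.
Proof.
move=> std_s s_inj sum0 i0 Ai0; apply/eqP; apply: contraTT isT => ai0.
have P0 : (i0 \in A) && (a i0 != 0) by rewrite Ai0.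
case: (@Order.TotalTheory.arg_minP _ _ _ i0 (fun i => (i \in A) && (a i != 0))
         (fun i => word (s i)) P0) => i /andP[Ai aiN0] i_min.
case/eqP: aiN0; move/ffunP/(_ (s i)): sum0.
rewrite sum_ffunE ffunE (bigD1 i) //= ffunE gelt_mull mulVg gyoung1.
rewrite big1 => [|j /andP[Aj jNi]]; first by rewrite addr0 [_ *: _]mulr1.
rewrite ffunE gelt_mull; have [->|ajN0] := eqVneq (a j) 0; first by rewrite scale0r.
have [->|] := eqVneq (c ((s j)^-1 * s i)%g) 0; first by rewrite scaler0.
case/gyoung_supp=> q [p [Cq Rp sE]].
have {}sE : s i = (s j * (q * p))%g by rewrite -sE mulKVg.
have eq_w : word (s i) = word (s j * q)%g by rewrite sE word_mul.
have le_w : (word (s i) <= word (s j))%O by apply: i_min; rewrite Aj.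
have [eq_w2|] := word_lt (std_s j Aj) Cq; last by rewrite -eq_w ltNge le_w.
case/eqP: jNi; apply: s_inj => // x.
have := congr1 (fun w => tnth w x) (etrans eq_w2 (esym eq_w)).
by rewrite !tnth_mktuple.
Qed.

End Symmetrizers.

(** * Diagrams of partitions and fillings by lattice words *)

Section YoungDiagrams.
Variables (n d : nat).
Implicit Types (al be : young_diagram n d).
Local Open Scope nat_scope.

Lemma row_lengths_nth_le al i j : i <= j ->
  nth 0 (row_lengths al) j <= nth 0 (row_lengths al) i.
Proof.
move=> leij; have [ltj|] := ltnP j (size (row_lengths al)); last first.
  by move=> lej; rewrite nth_default.
have /andP[srt _] := valP al; move: srt; rewrite -/(row_lengths al) => srt.
have geq_trans : transitive geq by move=> x y z /= lexy leyz; apply: leq_trans leyz lexy.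
apply: (sorted_leq_nth geq_trans (leqnn : reflexive geq) 0 srt) => //.
by rewrite inE (leq_ltn_trans leij).
Qed.

Lemma sumn_row_lengths al : sumn (row_lengths al) = d.
Proof. by have /andP[_ /eqP] := valP al. Qed.

Lemma box_lt al i j : j < nth 0 (row_lengths al) i ->
  flatten_index (row_lengths al) i j < d.
Proof. by move/flatten_indexP; rewrite sumn_row_lengths. Qed.

Lemma box_exists al i j : j < nth 0 (row_lengths al) i ->
  exists2 r, box_row al r = i & box_col al r = j.
Proof.
move=> ltj; exists (Ordinal (box_lt ltj)); rewrite /box_row /box_col /=.
  exact: flatten_indexKl.
exact: flatten_indexKr.
Qed.

Lemma box_col_lt al r : box_col al r < nth 0 (row_lengths al) (box_row al r).
Proof. by apply: reshape_offsetP; rewrite sumn_row_lengths. Qed.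

Lemma young_is_diagram al : is_diagram (box_row al) (box_col al).
Proof.
split=> [r r' [er ec]|r i j lei lej].
  apply: val_inj; rewrite /= -(reshape_indexK (row_lengths al) r).
  by rewrite -(reshape_indexK (row_lengths al) r') -/(box_row al r) er -/(box_col al r) ec.
apply: box_exists; apply: leq_ltn_trans lej (leq_trans (box_col_lt al r) _).
exact: row_lengths_nth_le.
Qed.

Lemma card_box_row al i :
  #|[set r | box_row al r == i]| = nth 0 (row_lengths al) i.
Proof.
apply/eqP; rewrite eqn_leq; apply/andP; split.
  apply: (card_lt_inj (f := box_col al)) => [r r'|r]; rewrite !inE.
    move=> /eqP ri /eqP r'i ec.
    by apply: (diagram_eq (young_is_diagram al)); rewrite // ri r'i.
  by move/eqP=> <-; apply: box_col_lt.
apply: (card_ge_surj (f := box_col al)) => j /box_exists[r ri rj].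
by exists r; rewrite // inE ri.
Qed.

Lemma row_count_inj al be :
  row_count (box_row al) =1 row_count (box_row be) -> al = be.
Proof.
move=> eq_rc; have row_countS (ga : young_diagram n d) i :
    row_count (box_row ga) i.+1 = row_count (box_row ga) i + nth 0 (row_lengths ga) i.
  rewrite -card_box_row /row_count -cardsUI.
  have -> : [set r | box_row ga r < i] :&: [set r | box_row ga r == i] = set0.
    by apply/setP=> r; rewrite !inE; case: ltngtP.
  rewrite cards0 addn0; congr #|pred_of_set _|; apply/setP=> r.
  by rewrite !inE ltnS leq_eqVlt orbC.
apply/val_inj/val_inj/(inj_map val_inj).
apply: (@eq_from_nth _ 0); first by rewrite !size_map !size_tuple.
move=> i _; have := row_countS al i; rewrite eq_rc eq_rc row_countS.
by move/addnI=> ->.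
Qed.

End YoungDiagrams.

Section LatticeFillings.
Variables (d : nat) (t : d.-tuple 'I_d).
Hypothesis lat_t : is_lattice (fun=> 0%N) (map val t).
Local Open Scope nat_scope.

Let w := map val t.
Let cnt i m := count_mem i (take m w).

Let size_w : size w = d. Proof. by rewrite size_map size_tuple. Qed.

Let nth_w (x : 'I_d) : nth 0 w x = tnth t x.
Proof. by rewrite (nth_map x) ?size_tuple // -tnth_nth. Qed.

Let cntS i (x : 'I_d) : cnt i x.+1 = cnt i x + (tnth t x == i :> nat).
Proof.
rewrite /cnt (take_nth 0) ?size_w // -cats1 count_cat /= nth_w.
by rewrite addn0.
Qed.

Let cnt_mono i m m' : m <= m' -> cnt i m <= cnt i m'.
Proof.
by move=> /subnKC <-; rewrite /cnt takeD count_cat leq_addr.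
Qed.

Let cnt_row_le i j m : i <= j -> cnt j m <= cnt i m.
Proof.
move/subnKC <-; elim: (j - i) => [|l IHl]; first by rewrite addn0.
rewrite addnS; apply: leq_trans _ IHl.
exact: (is_lattice_prefix m (fun=> leqnn 0) lat_t).
Qed.

Let sum_cnt : \sum_(i < d) cnt i d = d.
Proof.
rewrite /cnt take_oversize ?size_w // -[RHS]size_w.
have : all (fun x => x < d) w by apply/allP=> _ /mapP[x _ ->]; apply: ltn_ord.
elim: (w) => [|x s IHs] /=; first by rewrite big1.
case/andP=> ltx /IHs {}IHs; rewrite big_split /= IHs -[RHS]add1n; congr (_ + _).
rewrite (bigD1 (Ordinal ltx)) //= eqxx big1 // => i /negPf.
by rewrite -val_eqE /= eq_sym => ->.
Qed.

Let shape : d.-tuple 'I_d.+1 := [tuple inord (cnt i d) | i < d].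

Let shapeE : map val shape = mkseq (fun i => cnt i d) d.
Proof.
rewrite /mkseq -val_enum_ord -!map_comp; apply: eq_map => i /=.
rewrite inordK // ltnS; apply: leq_trans (count_size _ _) _.
by rewrite size_take size_w ltnn.
Qed.

Let shape_ok : sorted geq (map val shape) && (sumn (map val shape) == d).
Proof.
rewrite shapeE; apply/andP; split.
  apply: (path_sorted (x := d)); apply/(pathP 0) => i; rewrite size_mkseq => lti.
  case: i lti => [|i] lti /=; rewrite nth_mkseq //.
    by apply: leq_trans (count_size _ _) _; rewrite size_take size_w ltnn.
  by rewrite nth_mkseq; [apply: cnt_row_le | apply: ltnW].
rewrite sumnE /mkseq big_map.
have -> : iota 0 d = index_iota 0 d by rewrite /index_iota subn0.
by rewrite big_mkord sum_cnt.
Qed.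

Let al : young_diagram d d := exist _ shape shape_ok.

Let nth_al (i : 'I_d) : nth 0 (row_lengths al) i = cnt i d.
Proof. by rewrite /row_lengths /= shapeE nth_mkseq. Qed.

(** A letter [i] fills the first free box of row [i], whose column is the number of earlier letters
    [i]. *)
Lemma lattice_filling : exists be : young_diagram d d, exists s : 'S_d,
  (forall x, box_row be (s x) = tnth t x) /\
  std_filling (box_row be) (box_col be) s.
Proof.
have cnt_lt (x : 'I_d) : cnt (tnth t x) x < nth 0 (row_lengths al) (tnth t x).
  rewrite nth_al; apply: leq_trans (cnt_mono _ (ltn_ord x)).
  by rewrite cntS eqxx addn1.
pose sf (x : 'I_d) : 'I_d := Ordinal (box_lt (cnt_lt x)).
have sf_row x : box_row al (sf x) = tnth t x by apply: flatten_indexKl (cnt_lt x).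
have sf_col x : box_col al (sf x) = cnt (tnth t x) x by apply: flatten_indexKr (cnt_lt x).
(* If [y] came before [x], then just after [y] its row would hold more boxes than the row of [x],
   which is not below it, against the lattice property. *)
have sf_std x y : box_col al (sf x) = box_col al (sf y) ->
    box_row al (sf x) <= box_row al (sf y) -> x <= y.
  rewrite !sf_row !sf_col => ec ler; rewrite leqNgt; apply/negP=> ltyx.
  have := cntS (tnth t y) y; rewrite eqxx addn1 -ec.
  have := cnt_row_le y.+1 ler; have := cnt_mono (tnth t x) ltyx; lia.
have sf_inj : injective sf.
  by move=> x y exy; apply/val_inj/eqP; rewrite eqn_leq !sf_std ?exy.
exists al, (perm sf_inj); split=> [x|x y]; rewrite !permE // => ec ltr.
rewrite ltn_neqAle sf_std ?(ltnW ltr) // andbT.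
by apply: contraTneq ltr => exy; rewrite (val_inj exy) ltnn.
Qed.

End LatticeFillings.

(** * Conjugacy of labelled involutions *)

Lemma perm_eq_matching (T : finType) (Y : eqType) (A B : {set T}) (f f' : T -> Y) :
    perm_eq [seq f x | x <- enum A] [seq f' x | x <- enum B] ->
  exists rho : T -> T, {in A &, injective rho} /\
    (forall x, x \in A -> rho x \in B /\ f' (rho x) = f x).
Proof.
have [->|[x0 x0A]] := set_0Vmem A.
  by exists id; split=> x; rewrite inE.
case/(perm_iotaP (f x0)) => s s_perm eq_f.
have sz : size (enum A) = size s by rewrite -(size_map f) eq_f size_map.
have szB : size s = size (enum B).
  by rewrite (perm_size s_perm) size_iota size_map.
pose ix x := nth 0%N s (index x (enum A)).
have ix_lt x : x \in A -> (ix x < size (enum B))%N.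
  move=> xA; have : ix x \in s by rewrite mem_nth // -sz index_mem mem_enum.
  by rewrite (perm_mem s_perm) mem_iota size_map.
exists (fun x => nth x0 (enum B) (ix x)); split=> [x y xA yA|x xA].
  move/eqP; rewrite nth_uniq ?enum_uniq ?ix_lt // nth_uniq; first 1 last.
  - by rewrite -sz index_mem mem_enum.
  - by rewrite -sz index_mem mem_enum.
  - by rewrite (perm_uniq s_perm) iota_uniq.
  move/eqP=> eq_ix; have := congr1 (nth x0 (enum A)) eq_ix.
  by rewrite !nth_index ?mem_enum.
split; first by rewrite -mem_enum mem_nth ?ix_lt.
have := congr1 (fun u => nth (f x0) u (index x (enum A))) eq_f.
rewrite (nth_map x0) ?index_mem ?mem_enum // nth_index ?mem_enum // => ->.
rewrite (nth_map 0%N) -?sz ?index_mem ?mem_enum //.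
by rewrite (nth_map x0) ?ix_lt.
Qed.

Section LabelledInvolutions.
Variables (d : nat) (X Y : eqType) (u : X -> X -> Y).
Hypothesis u_pair : forall a b a' b', u a b = u a' b' ->
  (a = a' /\ b = b') \/ (a = b' /\ b = a').

(** One end of each 2-cycle. *)
Definition lowpts (t : 'S_d) : {set 'I_d} := [set r : 'I_d | (r < t r)%N].

(** Fixed points and 2-cycles are matched by their labels. It serves twice: with constant labels, to
    conjugate involutions having equally many fixed points; with [t' = t], to show that index
    functions with the same monomial and the same fixed labels differ by an element of the
    centralizer. *)
Lemma invol_conj (t t' : 'S_d) (I I' : 'I_d -> X) :
    involutive t -> involutive t' ->
    perm_eq [seq I r | r <- enum (fixpts t)] [seq I' r | r <- enum (fixpts t')] ->
    perm_eq [seq u (I r) (I (t r)) | r <- enum (lowpts t)]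
            [seq u (I' r) (I' (t' r)) | r <- enum (lowpts t')] ->
  exists g : 'S_d, t' = (t ^ g)%g /\ forall r, I r = I' (g r).
Proof.
move=> tK t'K /perm_eq_matching[eta [eta_inj etaP]].
move=> /perm_eq_matching[rho [rho_inj rhoP]].
have lowC (v : 'S_d) r : involutive v -> v r != r -> r \notin lowpts v -> v r \in lowpts v.
  by move=> vK vr; rewrite !inE vK -leqNgt leq_eqVlt val_eqE (negPf vr).
have low_moved (v : 'S_d) r : r \in lowpts v -> v r != r.
  by rewrite inE; apply: contraTneq => ->; rewrite ltnn.
have low_low (v : 'S_d) r : involutive v -> r \in lowpts v -> v r \notin lowpts v.
  by move=> vK; rewrite !inE vK -leqNgt; apply: ltnW.
(* The label of a cycle records its two ends only up to order, so a lower end may have to go to the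
   upper end of the matched cycle. *)
pose hi r := if (I r == I' (rho r)) && (I (t r) == I' (t' (rho r)))
             then rho r else t' (rho r).
have hiP r : r \in lowpts t -> I' (hi r) = I r /\ I' (t' (hi r)) = I (t r).
  move=> /rhoP[_ eq_u]; rewrite /hi; case: ifP => [/andP[/eqP-> /eqP->]//|].
  by rewrite t'K; case: (u_pair eq_u) => [[<- <-]|[<- <-]]; rewrite ?eqxx.
pose lo (v : 'S_d) r := if r \in lowpts v then r else v r.
pose g0 r := if t r == r then eta r
             else if r \in lowpts t then hi r else t' (hi (t r)).
have lo_hi r : r \in lowpts t -> lo t' (hi r) = rho r.
  move=> /rhoP[rl _]; rewrite /hi; case: ifP => _; rewrite /lo ?rl //.
  by rewrite (negPf (low_low _ _ t'K rl)) t'K.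
have g0t r : g0 (t r) = t' (g0 r).
  rewrite /g0 tK; case: (eqVneq (t r) r) => [tr|tr].
    have [|] := etaP r; first by rewrite inE tr.
    by rewrite inE tr => /eqP->.
  have [rl|rl] := boolP (r \in lowpts t).
    by rewrite (negPf (low_low _ _ tK rl)).
  by rewrite lowC // t'K.
have hi_moved r : r \in lowpts t -> t' (hi r) != hi r.
  move=> /rhoP[rl _]; rewrite /hi; case: ifP => _; first exact: low_moved.
  by rewrite t'K eq_sym low_moved.
have g0_fix r : (t' (g0 r) == g0 r) = (t r == r).
  rewrite /g0; case: (eqVneq (t r) r) => [tr|tr].
    by have [|] := etaP r; rewrite inE ?tr.
  have [rl|rl] := boolP (r \in lowpts t); first exact: (negPf (hi_moved _ rl)).
  by rewrite t'K eq_sym; apply: (negPf (hi_moved _ (lowC _ _ tK tr rl))).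
have lo_g0 r : t r != r -> lo t' (g0 r) = rho (lo t r).
  move=> tr; rewrite /g0 (negPf tr) {2}/lo; case: ifP => rl; first exact: lo_hi.
  have tl : t r \in lowpts t by apply: lowC; rewrite ?rl.
  rewrite -(lo_hi _ tl) /lo t'K; have [hl|hl] := boolP (hi (t r) \in lowpts t').
    by rewrite (negPf (low_low _ _ t'K hl)).
  by rewrite lowC ?hi_moved.
have lo_low (v : 'S_d) r : involutive v -> v r != r -> lo v r \in lowpts v.
  by move=> vK vr; rewrite /lo; have [//|/lowC->] := boolP (r \in lowpts v).
have g0_inj : injective g0.
  move=> r r' eg; have := g0_fix r; rewrite eg g0_fix.
  case: (eqVneq (t r) r) => [tr /eqP tr'|tr /eqP/eqP tr'].
    move: eg; rewrite /g0 tr tr' !eqxx; apply: eta_inj; rewrite inE ?tr ?tr' //.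
  have tr2 : t r' != r' by rewrite tr'.
  have : lo t r = lo t r'.
    by apply: rho_inj; rewrite ?lo_low // -!lo_g0 // eg.
  have g_moved : g0 (t r') != g0 r' by rewrite g0t g0_fix.
  rewrite /lo; do 2!case: ifP => _; first by [].
  - by move=> rtr; move: g_moved; rewrite -rtr eg eqxx.
  - by move=> trr; move: g_moved; rewrite -trr tK trr eg eqxx.
  - exact: perm_inj.
exists (perm g0_inj); split.
  apply/permP=> z; rewrite -(permKV (perm g0_inj) z) permJ !permE.
  by rewrite -g0t.
move=> r; rewrite permE /g0; case: ifP => [tr|/negbT tr].
  by have [|_ ->] := etaP r; rewrite ?inE.
case: ifP => rl; first by have [->] := hiP r rl.
have tl : t r \in lowpts t by apply: lowC; rewrite ?rl.
by have [_ ->] := hiP (t r) tl; rewrite tK.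
Qed.

End LabelledInvolutions.

Lemma card_fix_low d (t : 'S_d) : involutive t ->
  (#|fixpts t| + #|lowpts t|.*2 = d)%N.
Proof.
move=> tK; rewrite -addnn -{2}(card_imset (lowpts t) (@perm_inj _ t)) addnA.
rewrite -[RHS]card_ord -cardsT -cardsUI.
have -> : fixpts t :&: lowpts t = set0.
  by apply/setP=> r; rewrite !inE; case: eqP => //= ->; rewrite ltnn.
have mem_t r : (r \in [set t x | x in lowpts t]) = (t r < r)%N.
  by rewrite -{1}[r]tK mem_imset ?inE ?tK //; apply: perm_inj.
rewrite cards0 addn0 -cardsUI.
have -> : (fixpts t :|: lowpts t) :&: [set t x | x in lowpts t] = set0.
  by apply/setP=> r; rewrite inE mem_t !inE -val_eqE /=; case: ltngtP.
rewrite cards0 addn0; congr #|pred_of_set _|; apply/setP=> r.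
by rewrite inE mem_t !inE -val_eqE /=; case: ltngtP.
Qed.

Lemma invol_conj_card d (t t' : 'S_d) : involutive t -> involutive t' ->
  #|fixpts t| = #|fixpts t'| -> exists g : 'S_d, t' = (t ^ g)%g.
Proof.
move=> tK t'K eqf.
have eql : #|lowpts t| = #|lowpts t'|.
  apply/double_inj/(@addnI #|fixpts t|).
  by rewrite card_fix_low // eqf card_fix_low.
have all_tt (A B : {set 'I_d}) : #|A| = #|B| ->
    perm_eq [seq tt | _ <- enum A] [seq tt | _ <- enum B].
  move=> eqAB; suff -> : [seq tt | _ <- enum A] = [seq tt | _ <- enum B] by [].
  by apply: (@eq_from_nth _ tt) => [|i _]; rewrite ?size_map -?cardE //; case: nth; case: nth.
have [|g [tg _]] := @invol_conj d _ _ (fun _ _ => tt) _ t t' (fun=> tt) (fun=> tt)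
    tK t'K (all_tt _ _ eqf) (all_tt _ _ eql); last by exists g.
by move=> [] [] [] [] _; left.
Qed.

(** * Decomposition of the involution model *)

Section InvolutionModel.
Variables (k : fieldType) (char0 : [pchar k] =i pred0) (d : nat).
Local Notation A := (galg k 'S_d).
Implicit Types (al be : young_diagram d d) (t : 'S_d).

Definition gyd al : A := gyoung k (box_row al) (box_col al).

Lemma gyd_orth al be (x : A) : al != be -> gyd al * x * gyd be = 0.
Proof.
move=> alNbe; apply/eqP; apply: contraNT alNbe => xN0; apply/eqP/row_count_inj.
exact: (gyoung_mul_neq0 char0 (young_is_diagram al) (young_is_diagram be) xN0).
Qed.

Definition is_invol_fix (m : nat) t := (t * t == 1)%g && (#|fixpts t| == m).

(** When no involution has [m] fixed points the value 1 is a dummy, excluded by requiring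
    [is_invol_fix m (std_invol m)]. *)
Definition std_invol (m : nat) : 'S_d := odflt 1%g [pick t | is_invol_fix m t].

Lemma is_invol_fixP m t :
  reflect (involutive t /\ #|fixpts t| = m) (is_invol_fix m t).
Proof.
apply: (iffP andP) => [[/eqP tt /eqP ft]|[tK ft]]; split.
- by move=> r; rewrite -permM tt perm1.
- by [].
- by apply/eqP/permP=> r; rewrite permM tK perm1.
- by rewrite ft.
Qed.

Lemma std_involP m t : is_invol_fix m t -> is_invol_fix m (std_invol m).
Proof. by rewrite /std_invol; case: pickP => //= /(_ t) ->. Qed.

Lemma std_invol_conj m t : is_invol_fix m t ->
  exists g : 'S_d, t = (std_invol m ^ g)%g.
Proof.
move=> tm; have /is_invol_fixP[sK sf] := std_involP tm.
by have /is_invol_fixP[tK tf] := tm; apply: invol_conj_card; rewrite // sf.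
Qed.

Definition fixnum al : nat := #|fixpts (flip (young_is_diagram al))|.

Lemma fixnum_invol al : is_invol_fix (fixnum al) (flip (young_is_diagram al)).
Proof. by rewrite /is_invol_fix flip_invol !eqxx. Qed.

Lemma fixnum_dual al : exists EG : A * A,
  gyd al * (EG.1 * geps k (std_invol (fixnum al))) * EG.2 * gyd al = gyd al.
Proof.
have [g flipE] := std_invol_conj (fixnum_invol al).
have [E [G EG]] := gyoung_geps_dual char0 flipE.
by exists (E, G).
Qed.

(** Since [geps k t] absorbs the centralizer up to sign, one representative of each coset suffices
    to span; the index of the centralizer is the size of the class. *)
Lemma dim_gideal_geps t : (\dim (gideal (geps k t)) <= #|t ^: [set: 'S_d]|)%N.
Proof.
rewrite -index_cent1 setTI.
pose X := [seq gelt k (repr C) * geps k t | C <- enum (lcosets 'C[t] [set: 'S_d])].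
have -> : #|[set: 'S_d] : 'C[t]| = size X.
  by rewrite size_map -cardE card_lcosets.
apply: leq_trans (dim_span X); apply: dimvS.
apply/subvP=> _ /memv_imgP[x _ ->]; rewrite lfunE /= /gmulr.
rewrite {1}[x]galg_expand mulr_suml; apply: memv_suml => g _.
rewrite -scalerAl memvZ //.
have gC : (g *: 'C[t])%g \in lcosets 'C[t] [set: 'S_d].
  by apply/lcosetsP; exists g; rewrite ?inE.
have /lcosetP[h Ch rE] : repr (g *: 'C[t])%g \in (g *: 'C[t])%g.
  exact: (mem_repr g (lcoset_refl _ g)).
have : gelt k (repr (g *: 'C[t])%g) * geps k t \in <<X>>%VS.
  apply/memv_span/map_f; by rewrite mem_enum.
rewrite rE geltM -mulrA gepsMl // -scalerAr => /(memvZ ((-1) ^+ fodd t h)).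
by rewrite scalerA -signr_addb addbb scale1r.
Qed.

Local Notation word := {w : d.-tuple 'I_d | is_lattice (fun=> 0%N) (map val w)}.

(** For different [m] the classes are disjoint sets of involutions, and [card_invols] compares
    involutions with lattice words. *)
Lemma sum_card_std_class :
  (\sum_(m < d.+1 | is_invol_fix m (std_invol m)) #|std_invol m ^: [set: 'S_d]|
     <= #|{: word}|)%N.
Proof.
have le_invols : (\sum_(m < d.+1 | is_invol_fix m (std_invol m))
    #|std_invol m ^: [set: 'S_d]| <= #|invols [set: 'I_d]|)%N.
  rewrite -[leqRHS]sum1_card (partition_big (fun t => inord #|fixpts t| : 'I_d.+1) predT) //=.
  rewrite big_mkcond; apply: leq_sum => m _; case: ifP => // mm.
  rewrite sum1dep_card subset_leq_card //; apply/subsetP=> _ /imsetP[g _ ->].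
  have /is_invol_fixP[sK sf] := mm.
  have fixJ : #|fixpts (std_invol m ^ g)| = m.
    rewrite -[RHS]sf -(card_preimset _ (@perm_inj _ g)).
    by apply: eq_card => r; rewrite inE mem_fixptsJ.
  rewrite inE; apply/andP; split; last by rewrite fixJ inord_val.
  apply/involsP; split=> r; first by rewrite inE.
  by rewrite -[r](permKV g) !permJ sK.
apply: leq_trans le_invols _.
have := @card_invols _ d [set: 'I_d]; rewrite cardsT card_ord => /(_ (leqnn d)).
rewrite /nlattice -card_is_lattice card_sig => /leq_trans; apply.
by rewrite subset_leq_card //; apply/subsetP=> w; rewrite !inE.
Qed.

(** Each lattice word yields an element of one of the ideals of the [geps], and the elements in a
    given ideal are independent. Their total number is at least the sum of the class sizes, which
    bound the dimensions; so they form bases, and the claim is the expansion of [geps] itself. *)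
Theorem geps_decomposition (E G : young_diagram d d -> A) :
    (forall al, gyd al * (E al * geps k (std_invol (fixnum al))) * G al * gyd al
                = gyd al) ->
  forall m : nat, is_invol_fix m (std_invol m) ->
  exists z : young_diagram d d -> A, geps k (std_invol m) =
    \sum_(al | fixnum al == m) z al * gyd al * (E al * geps k (std_invol m)).
Proof.
move=> dual m0 m0_ok.
have [be /fin_all_exists[s sP]] := fin_all_exists (fun w : word => lattice_filling (valP w)).
pose v (w : word) : A := gelt k (s w) * gyd (be w) *
  (E (be w) * geps k (std_invol (fixnum (be w)))).
pose W (m : nat) := [set w : word | fixnum (be w) == m].
have vU m w : w \in W m -> v w \in gideal (geps k (std_invol m)).
  by rewrite inE => /eqP <-; rewrite /v mulrA mem_gideal.
have v_free m a : \sum_(w in W m) a w *: v w = 0 -> forall w, w \in W m -> a w = 0.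
  move=> sum0 w0 Ww0; pose B := [set w in W m | be w == be w0].
  apply: (@gyoung_independent _ _ _ _ (young_is_diagram (be w0)) _ B s a).
  - by move=> w; rewrite inE => /andP[_ /eqP <-]; have [] := sP w.
  - move=> w w'; rewrite !inE => /andP[_ /eqP ew] /andP[_ /eqP ew'] eq_row.
    apply/val_inj/eq_from_tnth=> x; apply: val_inj.
    have [rw _] := sP w.
    by have [rw' _] := sP w'; rewrite /= -rw -rw' ew ew' eq_row.
  (* Right multiplication by [y] kills the words of other shapes and undoes the embedding for the
     shape of [w0], which reduces to [gyoung_independent]. *)
  - pose y := G (be w0) * gyd (be w0).
    have vy w : be w = be w0 -> v w * y = gelt k (s w) * gyd (be w0).
      by move=> ew; rewrite -[in RHS]dual /v ew /y !mulrA.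
    have vy0 w : be w != be w0 -> v w * y = 0.
      move=> ew; rewrite -[RHS](mulr0 (gelt k (s w))).
      rewrite -(gyd_orth (E (be w) * geps k (std_invol (fixnum (be w))) * G (be w0)) ew).
      by rewrite /v /y !mulrA.
    transitivity (\sum_(w in W m) a w *: (v w * y)); last first.
      rewrite -[RHS](mul0r y) -[X in _ = X * y]sum0 [RHS]mulr_suml.
      by apply: eq_bigr => w _; rewrite scalerAl.
    rewrite [RHS](bigID (fun w => be w == be w0)) /=.
    rewrite [X in _ + X]big1 => [|w /andP[_ ew]]; last by rewrite vy0 ?scaler0.
    rewrite addr0; apply: eq_big => [w|w]; first by rewrite inE.
    by rewrite inE => /andP[_ /eqP ew]; rewrite vy // ew.
  - by rewrite inE Ww0 eqxx.
have W_ok m : ~~ is_invol_fix m (std_invol m) -> #|W m| = 0%N.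
  move=> mN; apply: eq_card0 => w; rewrite inE; apply: contraNF mN => /eqP <-.
  exact: (std_involP (fixnum_invol _)).
have fix_lt al : (fixnum al < d.+1)%N by rewrite ltnS -[leqRHS]card_ord max_card.
have W_le m : is_invol_fix m (std_invol m) ->
    (#|W m| <= #|std_invol m ^: [set: 'S_d]|)%N.
  move=> _; have [le_dim _] := span_independent_family (@vU m) (@v_free m).
  exact: leq_trans le_dim (dim_gideal_geps _).
have m0_lt : (m0 < d.+1)%N.
  by have /is_invol_fixP[_ <-] := m0_ok; rewrite ltnS -[leqRHS]card_ord max_card.
(* Term by term [W_le] bounds [#|W m|] by the class size, while the totals compare the other way; so
   equality holds at [m0]. *)
have dimW : (\dim (gideal (geps k (std_invol m0))) <= #|W m0|)%N.
  apply: leq_trans (dim_gideal_geps _) _.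
  have sumW : #|{: word}| = (\sum_(m < d.+1 | is_invol_fix m (std_invol m)) #|W m|)%N.
    rewrite -sum1_card (partition_big (fun w => inord (fixnum (be w)) : 'I_d.+1)
      (fun m : 'I_d.+1 => is_invol_fix m (std_invol m))) /=.
      apply: eq_bigr => m _; rewrite sum1dep_card; apply: eq_card => w.
      by rewrite !inE -val_eqE /= inordK.
    by move=> w _; rewrite inordK //; apply: (std_involP (fixnum_invol _)).
  have := sum_card_std_class; rewrite sumW.
  rewrite (bigD1 (Ordinal m0_lt)) //= [leqRHS](bigD1 (Ordinal m0_lt)) //=.
  have : (\sum_(i < d.+1 | is_invol_fix i (std_invol i) && (i != Ordinal m0_lt)) #|W i| <=
     \sum_(i < d.+1 | is_invol_fix i (std_invol i) && (i != Ordinal m0_lt))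
       #|std_invol i ^: [set: 'S_d]|)%N.
    by apply: leq_sum => i /andP[/W_le].
  move=> le1 le2; rewrite -(leq_add2r (\sum_(i < d.+1 |
    is_invol_fix i (std_invol i) && (i != Ordinal m0_lt)) #|W i|)).
  exact: leq_trans (leq_add (leqnn _) le1) le2.
have [_ /(_ dimW)] := span_independent_family (@vU m0) (@v_free m0).
move/(_ (1 * geps k (std_invol m0)) (mem_gideal _ _)) => [a].
rewrite mul1r => aE.
exists (fun al => \sum_(w in W m0 | be w == al) a w *: gelt k (s w)).
rewrite {1}aE (partition_big be (fun al => fixnum al == m0)) /=; last first.
  by move=> w; rewrite inE.
apply: eq_bigr => al /eqP al_m0; rewrite 2!mulr_suml; apply: eq_bigr => w.
by case/andP=> _ /eqP ew; rewrite /v ew al_m0 -!scalerAl.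
Qed.

End InvolutionModel.

(** * The action of the group algebra on tensors *)

Section TensorAction.
Variables (k : fieldType) (n d : nat).
Local Notation T := (tensor k n d).
Local Notation A := (galg k 'S_d).
Implicit Types (u v : T) (x y : A) (g h : 'S_d) (I : {ffun 'I_d -> 'I_n}).

Definition tact x u : T := \sum_g x g *: tensor_perm g u.

Fact tensor_perm_linear g : linear (@tensor_perm k n d g).
Proof. by move=> c u v; apply/ffunP=> I; rewrite !ffunE. Qed.

HB.instance Definition _ g :=
  GRing.isLinear.Build k T T _ (@tensor_perm k n d g) (tensor_perm_linear g).

Fact tact_linear x : linear (tact x).
Proof.
move=> c u v; rewrite /tact scaler_sumr -big_split; apply: eq_bigr => g _ /=.
by rewrite linearP scalerDr !scalerA mulrC.
Qed.

HB.instance Definition _ x := GRing.isLinear.Build k T T _ (tact x) (tact_linear x).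

Lemma tactDl x y u : tact (x + y) u = tact x u + tact y u.
Proof.
rewrite /tact -big_split; apply: eq_bigr => g _.
by rewrite ffunE scalerDl.
Qed.

Lemma tactZl (c : k) x u : tact (c *: x) u = c *: tact x u.
Proof.
by rewrite /tact scaler_sumr; apply: eq_bigr => g _; rewrite ffunE scalerA.
Qed.

Lemma tact0l u : tact 0 u = 0.
Proof. by rewrite -(scale0r 0) tactZl scale0r. Qed.

Lemma tact_suml (J : finType) (P : pred J) (F : J -> A) u :
  tact (\sum_(j | P j) F j) u = \sum_(j | P j) tact (F j) u.
Proof.
by apply: (big_morph (fun x => tact x u)) => [x y|]; rewrite ?tactDl ?tact0l.
Qed.

Lemma tact_gelt g u : tact (gelt k g) u = tensor_perm g u.
Proof.
rewrite /tact (bigD1 g) //= ffunE eqxx scale1r big1 ?addr0 // => h /negPf hNg.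
by rewrite ffunE hNg scale0r.
Qed.

Lemma tensor_permM g h u :
  tensor_perm h (tensor_perm g u) = tensor_perm (g * h)%g u.
Proof.
apply/ffunP=> I; rewrite !ffunE; congr (u _).
by apply/ffunP=> r; rewrite !ffunE permM.
Qed.

(** The left factor acts first: tensors are a right module, and the left ideal of [y] corresponds to
    the image of [tact y]. *)
Lemma tactM x y u : tact y (tact x u) = tact (x * y) u.
Proof.
rewrite [in RHS](galg_expand x) mulr_suml tact_suml {2}/tact linear_sum.
apply: eq_bigr => g _; rewrite linearZ -scalerAl tactZl; congr (_ *: _).
rewrite [in RHS](galg_expand y) mulr_sumr tact_suml; apply: eq_bigr => h _.
by rewrite tensor_permM -scalerAr tactZl -geltM tact_gelt.
Qed.

Lemma young_symmetrizerE (al : young_diagram n d) u :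
  young_symmetrizer al u = tact (gyoung k (box_row al) (box_col al)) u.
Proof.
rewrite gyoungE tact_suml /young_symmetrizer exchange_big; apply: eq_bigr => q _.
rewrite tact_suml; apply: eq_bigr => p _.
by rewrite tactZl tact_gelt tensor_permM.
Qed.

Lemma tensor_antisym0 (char0 : [pchar k] =i pred0) u g I :
  tensor_perm g u = - u -> [ffun r => I (g r)] = I -> u I = 0.
Proof.
move=> ug Ig; have := congr1 (fun w : T => w I) ug; rewrite !ffunE Ig => uI.
have : u I *+ 2 = 0 by rewrite mulr2n {1}uI addNr.
move/eqP; rewrite -scaler_nat scaler_eq0 pnatr_neq0 //=.
by move/eqP.
Qed.

(** The first column has more than [n] boxes, so two of them carry the same basis vector; their
    transposition is an odd column permutation fixing the index, so the coefficient is its own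
    opposite. *)
Lemma tact_gyoung_tall (char0 : [pchar k] =i pred0) (row col : 'I_d -> nat) u :
    is_diagram row col -> (exists r, (n <= row r)%N) ->
  tact (gyoung k row col) u = 0.
Proof.
move=> D [r0 r0n]; rewrite -tactM; suff -> : tact (galt k col) u = 0 by rewrite linear0.
apply/ffunP=> I; rewrite [RHS]ffunE.
have box (i : 'I_n.+1) : exists r, (row r == i) && (col r == 0%N).
  have [r ri rc] := D.2 r0 i 0%N (leq_trans (leq_ord i) r0n) isT.
  by exists r; rewrite ri rc !eqxx.
pose b i := xchoose (box i).
have brow i : row (b i) = i by case/andP: (xchooseP (box i)) => /eqP.
have bcol i : col (b i) = 0%N by case/andP: (xchooseP (box i)) => _ /eqP.
have /injectivePn[i [j iNj eqI]] : ~~ injectiveb (fun i : 'I_n.+1 => I (b i)).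
  by apply/negP=> /injectiveP/leq_card; rewrite !card_ord ltnn.
have bN : b i != b j.
  by apply: contraNneq iNj => eb; apply/eqP/val_inj; rewrite -[LHS]brow eb brow.
apply: (tensor_antisym0 char0 (g := tperm (b i) (b j))); last first.
  by apply/ffunP=> r; rewrite ffunE; case: tpermP => // ->.
rewrite -tact_gelt tactM galtMr ?tactZl ?odd_tperm ?bN ?expr1 ?scaleN1r //.
by apply/fstabP=> r; case: tpermP => // ->; rewrite !bcol.
Qed.

Lemma tensor_act_perm (V : vectType k) (e : n.-tuple V) (g : 'End(V)) h u :
  tensor_act e g (tensor_perm h u) = tensor_perm h (tensor_act e g u).
Proof.
apply/ffunP=> I; rewrite !ffunE.
pose f (J : {ffun 'I_d -> 'I_n}) : {ffun 'I_d -> 'I_n} := [ffun r => J (h r)].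
have f_bij : {on [pred _ | true], bijective f}.
  exists (fun J : {ffun 'I_d -> 'I_n} => [ffun r => J (h^-1%g r)]) => J _.
    by apply/ffunP=> r; rewrite !ffunE permKV.
  by apply/ffunP=> r; rewrite !ffunE permK.
rewrite [RHS](reindex f) //=; apply: eq_bigr => J _; rewrite ffunE; congr (_ * _).
rewrite (reindex_inj (@perm_inj _ h)) /=; apply: eq_bigr => r _.
by rewrite !ffunE.
Qed.

Fact tensor_act_linear (V : vectType k) (e : n.-tuple V) (g : 'End(V)) :
  linear (@tensor_act k V n d e g).
Proof.
move=> c u v; apply/ffunP=> I; rewrite !ffunE scaler_sumr -big_split.
apply: eq_bigr => J _; rewrite !ffunE mulrDr; congr (_ + _).
by rewrite [RHS]mulrCA.
Qed.

HB.instance Definition _ (V : vectType k) (e : n.-tuple V) (g : 'End(V)) :=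
  GRing.isLinear.Build k T T _ (@tensor_act k V n d e g) (tensor_act_linear e g).

Lemma tensor_act_tact (V : vectType k) (e : n.-tuple V) (g : 'End(V)) x u :
  tensor_act e g (tact x u) = tact x (tensor_act e g u).
Proof.
rewrite /tact linear_sum; apply: eq_bigr => h _.
by rewrite linearZ /= tensor_act_perm.
Qed.

End TensorAction.

(** * Changing the number of rows allowed to a diagram *)

Section ResizeDiagram.
Local Open Scope nat_scope.

Lemma sumn_take_nth (s : seq nat) m : sumn (take m s) = \sum_(i < m) nth 0 s i.
Proof.
elim: s m => [|x s IHs] [|m] /=; rewrite ?big_ord0 //.
  by rewrite big1 // => i _; rewrite nth_nil.
by rewrite big_ord_recl /= IHs.
Qed.

Lemma row_lengths_nth_eq0 n d (al : young_diagram n d) i :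
  d <= i -> nth 0 (row_lengths al) i = 0.
Proof.
move=> ledi; apply/eqP; rewrite -leqn0 leqNgt; apply/negP=> gt0.
suff : i.+1 <= #|'I_d| by rewrite card_ord ltnNge ledi.
rewrite -cardsT; apply: (card_ge_surj (f := box_row al)) => j; rewrite ltnS => leji.
have [|r rj _] := @box_exists n d al j 0.
  exact: leq_trans gt0 (row_lengths_nth_le al leji).
by exists r; rewrite ?inE.
Qed.

Lemma eq_nth_boxes n m d (al : young_diagram n d) (be : young_diagram m d) :
    (forall i, nth 0 (row_lengths be) i = nth 0 (row_lengths al) i) ->
  box_row be =1 box_row al /\ box_col be =1 box_col al.
Proof.
move=> eq_nth; have key r : flatten_index (row_lengths be) (box_row al r) (box_col al r) = r.
  rewrite -[RHS](reshape_indexK (row_lengths al) r) /flatten_index.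
  congr (_ + _); rewrite !sumn_take_nth; apply: eq_bigr => i _; exact: eq_nth.
have lt_col r : box_col al r < nth 0 (row_lengths be) (box_row al r).
  by rewrite eq_nth box_col_lt.
split=> r; rewrite /box_row /box_col -{1}(key r).
  exact: flatten_indexKl.
exact: flatten_indexKr.
Qed.

Lemma resize_diagram n m d (al : young_diagram n d) :
    (forall i, m <= i -> nth 0 (row_lengths al) i = 0) ->
  exists be : young_diagram m d,
    forall i, nth 0 (row_lengths be) i = nth 0 (row_lengths al) i.
Proof.
move=> al0; have le_d i : nth 0 (row_lengths al) i < d.+1.
  rewrite ltnS -card_box_row -[leqRHS]card_ord; exact: max_card.
pose sh : m.-tuple 'I_d.+1 := [tuple inord (nth 0 (row_lengths al) i) | i < m].
have shE : map val sh = mkseq (nth 0 (row_lengths al)) m.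
  rewrite /mkseq -val_enum_ord -!map_comp; apply: eq_map => i /=.
  by rewrite inordK.
have sh_nth i : nth 0 (map val sh) i = nth 0 (row_lengths al) i.
  rewrite shE; have [ltim|leim] := ltnP i m; first by rewrite nth_mkseq.
  by rewrite nth_default ?size_mkseq // al0.
have sh_ok : sorted geq (map val sh) && (sumn (map val sh) == d).
  apply/andP; split.
    apply: (path_sorted (x := d)); apply/(pathP 0) => i _.
    by case: i => [|i]; rewrite /= !sh_nth; [rewrite -ltnS | apply: row_lengths_nth_le].
  rewrite -[X in _ == X](sumn_row_lengths al).
  pose N := maxn (size (map val sh)) (size (row_lengths al)).
  rewrite -[map val sh](@take_oversize _ N) ?leq_maxl //.
  rewrite -[row_lengths al](@take_oversize _ N) ?leq_maxr // !sumn_take_nth.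
  by apply/eqP/eq_bigr => i _; apply: sh_nth.
by exists (exist _ sh sh_ok).
Qed.

End ResizeDiagram.

(** * Exterior products of basis vectors *)

Section Anticommuting.
Variables (k : fieldType) (U : lmodType k) (X : eqType) (w : X -> U -> U) (u0 : U).
Hypothesis wZ : forall a c x, w a (c *: x) = c *: w a x.
Hypothesis w_anti : forall a b x, w a (w b x) = - w b (w a x).
Hypothesis w_sqr : forall a x, w a (w a x) = 0.
Implicit Types (a b : X) (s : seq X).

(** Kept abstract in [w], which will stand for the product by basis vectors, by their images under
    [g], or by one arbitrary vector per slot. *)
Definition wprod s : U := foldr w u0 s.

Let wN a x : w a (- x) = - w a x.
Proof. by rewrite -scaleN1r wZ scaleN1r. Qed.

Let w0 a : w a 0 = 0.
Proof. by have := wZ a 0 0; rewrite !scale0r. Qed.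

Lemma wprod_move s1 a s2 :
  wprod (s1 ++ a :: s2) = (-1) ^+ size s1 *: wprod (a :: s1 ++ s2).
Proof.
elim: s1 => [|b s1 IHs] /=; first by rewrite expr0 scale1r.
by rewrite IHs wZ /= w_anti exprS mulN1r scaleNr scalerN.
Qed.

Lemma wprod_not_uniq s : ~~ uniq s -> wprod s = 0.
Proof.
elim: s => //= a s IHs; rewrite negb_and negbK => /orP[|/IHs ->]; last exact: w0.
by case/splitPr=> s1 s2; rewrite wprod_move wZ /= w_sqr scaler0.
Qed.

Lemma wprod_swap s1 a s2 b s3 :
  wprod (s1 ++ b :: s2 ++ a :: s3) = - wprod (s1 ++ a :: s2 ++ b :: s3).
Proof.
have key : wprod (b :: s2 ++ a :: s3) = - wprod (a :: s2 ++ b :: s3).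
  rewrite -!(cat_cons _ s2) !wprod_move /= -scalerN; congr (_ *: _).
  exact: w_anti.
by elim: s1 => //= c s1 ->; rewrite wN.
Qed.

Let mem_split (T : eqType) (x : T) (s : seq T) :
  x \in s -> exists s1 s2 : seq T, s = s1 ++ x :: s2.
Proof. by case/splitPr=> s1 s2; exists s1, s2. Qed.

Let wprod_tperm_split (T : finType) (h : T -> X) (x y : T) (s1 s2 s3 : seq T) :
    uniq (s1 ++ x :: s2 ++ y :: s3) ->
  wprod [seq h (tperm x y z) | z <- s1 ++ x :: s2 ++ y :: s3] =
  - wprod [seq h z | z <- s1 ++ x :: s2 ++ y :: s3].
Proof.
move=> us; have map_out (s : seq T) : x \notin s -> y \notin s ->
    [seq h (tperm x y z) | z <- s] = [seq h z | z <- s].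
  move=> xs ys; apply/eq_in_map => z zs; rewrite tpermD //.
    by apply: contraNneq xs => ->.
  by apply: contraNneq ys => ->.
have : uniq (x :: y :: s1 ++ s2 ++ s3).
  rewrite -(perm_uniq (s1 := s1 ++ x :: s2 ++ y :: s3)) //.
  by apply/seq.permP=> a; rewrite /= !count_cat /= !count_cat /=; lia.
rewrite /= !in_cons !mem_cat !negb_or.
case/and3P=> /and4P[_ x1 x2 x3] /and3P[y1 y2 y3] _.
rewrite !(map_cat, map_cons) !map_out // tpermL tpermR.
exact: wprod_swap.
Qed.

Lemma wprod_tperm (T : finType) (A : {set T}) (h : T -> X) (x y : T) :
    x \in A -> y \in A -> x != y ->
  wprod [seq h (tperm x y z) | z <- enum A] = - wprod [seq h z | z <- enum A].
Proof.
move=> xA yA xNy; have uA := enum_uniq A.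
have /mem_split[s1 [s2 def_A]] : x \in enum A by rewrite mem_enum.
have : y \in enum A by rewrite mem_enum.
move: uA; rewrite def_A mem_cat in_cons eq_sym (negPf xNy) /= => us.
case/orP=> /mem_split[s3 [s4 def_s]]; move: us; rewrite def_s.
  by rewrite -catA tpermC; apply: wprod_tperm_split.
exact: wprod_tperm_split.
Qed.

Lemma wprod_perm (T : finType) (A : {set T}) (f : T -> X) (p : {perm T}) :
  perm_on A p ->
  wprod [seq f (p x) | x <- enum A] = (-1) ^+ p *: wprod [seq f x | x <- enum A].
Proof.
have [m] := ubnP #|[set x | p x != x]|; elim: m p f => // m IHm p f ltm on_p.
have [p1|/forallPn[x px]] := boolP [forall x, p x == x].
  have -> : p = 1%g by apply/permP=> x; rewrite perm1; apply/eqP/(forallP p1).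
  by rewrite odd_perm1 scale1r; congr wprod; apply: eq_map => x; rewrite perm1.
have xA : x \in A by apply: contraR px => /(out_perm on_p) ->.
have pxA : p x \in A by rewrite perm_closed.
(* This composite fixes [x] and moves no point that [p] fixes, which drives the induction on the
   number of moved points. *)
pose q := (p * tperm x (p x))%g.
have pE z : p z = tperm x (p x) (q z) by rewrite permM tpermK.
have qx : q x = x by rewrite permM tpermR.
have q_fix z : p z = z -> q z = z.
  move=> pz; have [->//|zNx] := eqVneq z x.
  rewrite permM pz tpermD 1?eq_sym //; apply: contraNneq px => zpx.
  by apply/eqP/(@perm_inj _ p); rewrite -zpx pz.
have on_q : perm_on A q.
  apply/subsetP=> z; rewrite inE; apply: contraR => zA.
  by rewrite q_fix ?(out_perm on_p).
have lt_q : (#|[set z | q z != z]| < m)%N.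
  rewrite ltnS in ltm; apply: leq_trans ltm; apply: proper_card; apply/properP; split.
    by apply/subsetP=> z; rewrite !inE; apply: contraNneq => /q_fix ->.
  by exists x; rewrite !inE ?qx ?eqxx.
have -> : [seq f (p z) | z <- enum A] = [seq f (tperm x (p x) (q z)) | z <- enum A].
  by apply: eq_map => z; rewrite -pE.
rewrite (IHm q (fun z => f (tperm x (p x) z)) lt_q on_q) wprod_tperm 1?eq_sym //.
have -> : odd_perm p = ~~ odd_perm q.
  by rewrite odd_permM odd_tperm eq_sym px addbT negbK.
by rewrite signrN scalerN scaleNr.
Qed.

End Anticommuting.

Section SortedEnum.
Variable n : nat.
Implicit Types (J : {set 'I_n}) (a : 'I_n).

Lemma sorted_enum_set J : sorted ltn (map val (enum J)).
Proof.
have : subseq (map val (enum J)) (iota 0 n).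
  by rewrite -val_enum_ord map_subseq // enumT filter_subseq.
move/(subseq_sorted ltn_trans); apply; exact: iota_ltn_sorted.
Qed.

(** The exponent of the sign in [ext_wedge] is the position of [a] in the increasing enumeration. *)
Lemma enum_setU1 J a : a \notin J ->
  exists s1 s2, [/\ enum (a |: J) = s1 ++ a :: s2, enum J = s1 ++ s2 &
                    size s1 = #|[set c in J | (c < a)%N]|].
Proof.
move=> aJ; have aE : a \in enum (a |: J) by rewrite mem_enum !inE eqxx.
have [s1 [s2 def_E]] : exists s1 s2, enum (a |: J) = s1 ++ a :: s2.
  by case/splitPr: aE => s1 s2; exists s1, s2.
have uE := enum_uniq (a |: J); rewrite def_E in uE.
have /and3P[_ as1 /andP[as2 _]] : [&& uniq s1, a \notin s1 & (a \notin s2) && uniq s2].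
  by move: uE; rewrite cat_uniq /= negb_or => /and3P[-> /andP[-> _] ->].
have def_J : enum J = s1 ++ s2.
  have -> : enum J = [seq c <- enum (a |: J) | c != a].
    rewrite /enum_mem -filter_predI; apply: eq_filter => c; rewrite !inE.
    by case: eqP => // ->; rewrite (negPf aJ).
  rewrite def_E filter_cat /= eqxx /=; congr (_ ++ _); apply/all_filterP/allP=> c cs.
    by apply: contraNneq as1 => <-.
  by apply: contraNneq as2 => <-.
exists s1, s2; split=> //.
have srt := sorted_enum_set (a |: J); move: srt.
rewrite def_E map_cat /= => srt.
have lt1 c : c \in s1 -> (c < a)%N.
  move=> cs; move: srt; rewrite (sorted_pairwise ltn_trans) pairwise_cat.
  case/and3P=> /allrelP H _ _; apply: H; first exact: map_f.
  by rewrite in_cons eqxx.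
have lt2 c : c \in s2 -> (a < c)%N.
  move=> cs; move: srt; rewrite (sorted_pairwise ltn_trans) pairwise_cat.
  by case/and3P=> _ _ /= /andP[/allP H _]; apply: H; apply: map_f.
have us1 : uniq s1 by have := enum_uniq J; rewrite def_J cat_uniq => /and3P[].
rewrite -(card_uniqP us1); apply: eq_card => c; rewrite !inE.
rewrite -(mem_enum J) def_J mem_cat; case: (boolP (c \in s1)) => [/lt1->|_] //=.
by case: (boolP (c \in s2)) => // /lt2; case: ltngtP.
Qed.

End SortedEnum.

Section ExteriorBasis.
Variables (k : fieldType) (n : nat).
Local Notation F := (coord_frac k n).
Local Notation E := (ext_frac k n).
Implicit Types (J : {set 'I_n}) (a b c : 'I_n) (x y : E) (f : F).

Definition ext_delta J : E := [ffun J' => (J' == J)%:R].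

Lemma coord_frac_scaleE (c : k) f : c *: f = to_frac c%:MP * f.
Proof. by []. Qed.

Fact ext_wedge_linear a : linear (@ext_wedge k n a).
Proof.
move=> c x y; apply/ffunP=> J; rewrite !ffunE; case: ifP => _.
  by rewrite !coord_frac_scaleE mulrDr mulrCA.
by rewrite scaler0 addr0.
Qed.

HB.instance Definition _ a := GRing.isLinear.Build k E E _ (@ext_wedge k n a)
  (ext_wedge_linear a).

Lemma ext_wedge_sqr a x : ext_wedge a (ext_wedge a x) = 0.
Proof.
by apply/ffunP=> J; rewrite !ffunE !inE eqxx /= mulr0 if_same.
Qed.

Lemma ext_wedge_anti a b x :
  ext_wedge a (ext_wedge b x) = - ext_wedge b (ext_wedge a x).
Proof.
have [->|aNb] := eqVneq a b; first by rewrite ext_wedge_sqr oppr0.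
wlog lt_ab : a b aNb / (a < b)%N => [hw|].
  have [/hw->//|] := ltnP a b; rewrite leq_eqVlt val_eqE eq_sym (negPf aNb) /=.
  by move=> /hw -> //; rewrite ?opprK // eq_sym.
apply/ffunP=> J; rewrite !ffunE !inE (eq_sym b a) aNb /=.
case: (boolP (a \in J)) => aJ; case: (boolP (b \in J)) => bJ;
  rewrite ?mulr0 ?oppr0 //.
have -> : J :\ a :\ b = J :\ b :\ a by rewrite !setDDl setUC.
have -> : [set c in J :\ b | (c < a)%N] = [set c in J | (c < a)%N].
  apply/setP=> c; rewrite !inE; case: eqP => // ->.
  by rewrite ltnNge (ltnW lt_ab) !andbF.
have -> : #|[set c in J | (c < b)%N]| = #|[set c in J :\ a | (c < b)%N]|.+1.
  rewrite (cardsD1 a) !inE aJ lt_ab add1n; congr _.+1; apply: eq_card => c.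
  by rewrite !inE andbA.
by rewrite exprS mulN1r mulNr opprK mulrCA.
Qed.

Lemma ext_wedge_delta a J : a \notin J -> ext_wedge a (ext_delta J) =
  (-1) ^+ #|[set c in J | (c < a)%N]| *: ext_delta (a |: J).
Proof.
move=> aJ; apply/ffunP=> J'; rewrite !ffunE coord_frac_scaleE.
have -> : to_frac ((-1) ^+ #|[set c in J | (c < a)%N]|)%:MP =
    (-1) ^+ #|[set c in J | (c < a)%N]| :> F.
  by rewrite /to_frac !rmorph_sign.
have [->|J'N] := eqVneq J' (a |: J).
  rewrite !inE eqxx setU1K // eqxx; congr ((-1) ^+ #|pred_of_set _| * _).
  apply/setP=> c; rewrite !inE; case: (eqVneq c a) => [->|//].
  by rewrite ltnn !andbF.
rewrite mulr0; case: ifP => // aJ'; case: eqP => [eJ|]; last by rewrite mulr0.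
by case/eqP: J'N; rewrite -eJ setD1K.
Qed.

Definition wedge s : E := wprod (@ext_wedge k n) (ext_one k n) s.

Lemma ext_wedgeZ a (c : k) x : ext_wedge a (c *: x) = c *: ext_wedge a x.
Proof. exact: linearZ. Qed.

(* The increasing enumeration of a set makes all the signs of [ext_wedge]      *)
(* trivial.                                                                    *)
Lemma wedge_enum J : wedge (enum J) = ext_delta J.
Proof.
have [m] := ubnP #|J|; elim: m J => // m IHm J ltm.
have [->|] := set_0Vmem J; first by rewrite enum_set0.
case=> a aJ; have := setD1K aJ; set J1 := J :\ a => defJ.
have aJ1 : a \notin J1 by rewrite !inE eqxx.
have [s1 [s2 [eJ eJ1 sz]]] := enum_setU1 aJ1.
rewrite -defJ eJ /wedge (wprod_move _ ext_wedgeZ ext_wedge_anti) /= -eJ1.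
rewrite -/(wedge (enum J1)) IHm ?ext_wedge_delta //; last first.
  by move: ltm; rewrite (cardsD1 a) aJ.
by rewrite sz scalerA -expr2 sqrr_sign scale1r.
Qed.

Lemma wedgeP s : exists b : bool, wedge s =
  if uniq s then (-1) ^+ b *: ext_delta [set x in s] else 0.
Proof.
have [us|Nus] := boolP (uniq s); last first.
  by exists false; apply: (wprod_not_uniq _ ext_wedgeZ ext_wedge_anti ext_wedge_sqr).
elim: s us => [|a s IHs] /=.
  exists false; rewrite expr0 scale1r; have -> // : [set x in [::]] = set0 :> {set 'I_n}.
  by apply/setP=> c; rewrite !inE.
case/andP=> as1 /IHs[b ->].
rewrite ext_wedgeZ ext_wedge_delta ?inE // scalerA.
rewrite -(signr_odd k #|_|) -signr_addb.
exists (b (+) odd #|[set c in [set x in s] | (c < a)%N]|); congr (_ *: ext_delta _).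
by apply/setP=> c; rewrite !inE.
Qed.

End ExteriorBasis.

Import generic_quotient.

(** * The action on the homogeneous coordinate ring *)

Lemma comp_mpolyA (R : comNzRingType) (n m l : nat) (p : {mpoly R[n]})
    (lp : n.-tuple {mpoly R[m]}) (lq : m.-tuple {mpoly R[l]}) :
  (p \mPo lp) \mPo lq = p \mPo [tuple tnth lp i \mPo lq | i < n].
Proof.
rewrite (comp_mpolyE p lp) raddf_sum [RHS]comp_mpolyE; apply: eq_bigr => m' _ /=.
rewrite comp_mpolyZ rmorph_prod; congr (_ *: _); apply: eq_bigr => i _.
by rewrite rmorphXn tnth_mktuple.
Qed.

Section Qform.
Variables (k : fieldType) (n : nat).
Implicit Types (a b : 'I_n).

Definition pair_low a b := if (a <= b)%N then (a, b) else (b, a).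

Lemma pair_lowC a b : pair_low a b = pair_low b a.
Proof.
rewrite /pair_low; case: (ltngtP a b) => // ab.
by rewrite (val_inj ab).
Qed.

Lemma pair_low_cases a b : pair_low a b = (a, b) \/ pair_low a b = (b, a).
Proof. by rewrite /pair_low; case: ifP; [left | right]. Qed.

Lemma pair_low_inj a b a' b' : pair_low a b = pair_low a' b' ->
  (a = a' /\ b = b') \/ (a = b' /\ b = a').
Proof.
case: (pair_low_cases a b) => ->; case: (pair_low_cases a' b') => -> [-> ->];
  by [left | right].
Qed.

Lemma pair_low_sym2 a b : pair_low a b \in sym2_basis n.
Proof. by rewrite inE /pair_low; case: (leqP a b) => //= /ltnW. Qed.

Definition qidx a b : 'I_#|sym2_basis n| :=
  enum_rank_in (pair_low_sym2 a b) (pair_low a b).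

Lemma enum_val_qidx a b : enum_val (qidx a b) = pair_low a b.
Proof. by rewrite enum_rankK_in ?pair_low_sym2. Qed.

Lemma pair_low_id (p : 'I_n * 'I_n) : p \in sym2_basis n -> pair_low p.1 p.2 = p.
Proof. by rewrite inE /pair_low => ->; case: p. Qed.

Lemma qidx_enum_val (i : 'I_#|sym2_basis n|) :
  qidx (enum_val i).1 (enum_val i).2 = i.
Proof.
by apply: enum_val_inj; rewrite enum_val_qidx pair_low_id ?enum_valP.
Qed.

(** Exactly one of [(a, b)] and [(b, a)] is an index, also when [a = b], so the sum has a single
    term. *)
Lemma qformE a b : qform k a b = 'X_(qidx a b).
Proof.
apply: big_pred1 => i; rewrite [RHS]/= -(inj_eq enum_val_inj) enum_val_qidx.
have evP := pair_low_id (enum_valP i); rewrite !inE /=.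
apply/orP/eqP => [|evE].
  by case=> /eqP evE; rewrite -{1}evP evE //= pair_lowC.
by case: (pair_low_cases a b) evE => -> ->; rewrite eqxx; [left | right].
Qed.

Lemma qformC a b : qform k a b = qform k b a.
Proof.
rewrite !qformE; congr 'X_(_); apply: enum_val_inj.
by rewrite !enum_val_qidx pair_lowC.
Qed.

Lemma mpolyX_qform (i : 'I_#|sym2_basis n|) :
  'X_i = qform k (enum_val i).1 (enum_val i).2.
Proof. by rewrite qformE qidx_enum_val. Qed.

End Qform.

Section CoordRingAction.
Variables (k : fieldType) (V : vectType k) (n : nat) (e : n.-tuple V).
Hypothesis e_basis : basis_of fullv e.
Implicit Types (g : 'End(V)) (p q : coord_ring k n).
Local Notation cact := (coord_ring_act e).
Local Notation ent := (gl_entry e).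

Lemma coord_ring_actM g p q : cact g (p * q) = cact g p * cact g q.
Proof. exact: rmorphM. Qed.

Lemma coord_ring_actD g p q : cact g (p + q) = cact g p + cact g q.
Proof. exact: raddfD. Qed.

Lemma coord_ring_act1 g : cact g 1 = 1.
Proof. exact: rmorph1. Qed.

Lemma coord_ring_act0 g : cact g 0 = 0.
Proof. exact: raddf0. Qed.

Lemma coord_ring_actZ g (c : k) p : cact g (c *: p) = c *: cact g p.
Proof. exact: comp_mpolyZ. Qed.

Lemma coord_ring_act_prod g (I : Type) (r : seq I) (P : pred I) (F : I -> coord_ring k n) :
  cact g (\prod_(i <- r | P i) F i) = \prod_(i <- r | P i) cact g (F i).
Proof. by apply: big_morph; [apply: coord_ring_actM | apply: coord_ring_act1]. Qed.

Lemma coord_ring_act_sum g (I : Type) (r : seq I) (P : pred I) (F : I -> coord_ring k n) :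
  cact g (\sum_(i <- r | P i) F i) = \sum_(i <- r | P i) cact g (F i).
Proof. by apply: big_morph; [apply: coord_ring_actD | apply: coord_ring_act0]. Qed.

Lemma coord_ring_act_qform g a b : cact g (qform k a b) =
  \sum_(c < n) \sum_(d < n) (ent g c a * ent g d b) *: qform k c d.
Proof.
rewrite qformE /coord_ring_act comp_mpolyXU -tnth_nth tnth_mktuple enum_val_qidx.
case: (pair_low_cases a b) => -> //=.
rewrite exchange_big; apply: eq_bigr => c _; apply: eq_bigr => d _.
by rewrite mulrC qformC.
Qed.

Lemma gl_entryM g h a b :
  ent (g \o h)%VF a b = \sum_(c < n) ent g a c * ent h c b.
Proof.
have hE : h (tnth e b) = \sum_(c < n) ent h c b *: tnth e c.
  rewrite {1}(coord_basis e_basis (memvf (h (tnth e b)))).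
  by apply: eq_bigr => c _; rewrite -tnth_nth.
rewrite {1}/gl_entry lfunE /= hE linear_sum /= linear_sum /=.
by apply: eq_bigr => c _; rewrite !linearZ /= mulrC.
Qed.

Lemma gl_entry1 a b : ent \1%VF a b = (a == b)%:R.
Proof.
rewrite /gl_entry lfunE /= (tnth_nth 0) coord_free 1?eq_sym //.
exact: basis_free e_basis.
Qed.

Lemma coord_ring_act_comp g h p : cact g (cact h p) = cact (g \o h)%VF p.
Proof.
rewrite {1 2}/coord_ring_act comp_mpolyA; congr (_ \mPo _).
apply: eq_from_tnth => i; rewrite !tnth_mktuple.
rewrite -/(cact g _) coord_ring_act_sum.
under eq_bigr => c _.
  rewrite coord_ring_act_sum.
  under eq_bigr => d _ do rewrite coord_ring_actZ coord_ring_act_qform.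
  over.
set A := (enum_val i).1; set B := (enum_val i).2.
under [RHS]eq_bigr => c _ do under eq_bigr => d _ do
  rewrite !gl_entryM big_distrlr /= scaler_suml.
under [RHS]eq_bigr => c _ do rewrite exchange_big /=.
rewrite [RHS]exchange_big /=; apply: eq_bigr => c _.
under [RHS]eq_bigr => c' _ do under eq_bigr => d' _ do rewrite scaler_suml.
under [RHS]eq_bigr => c' _ do rewrite exchange_big /=.
rewrite [RHS]exchange_big /=; apply: eq_bigr => d _.
rewrite scaler_sumr; apply: eq_bigr => c' _; rewrite scaler_sumr.
apply: eq_bigr => d' _; rewrite scalerA; congr (_ *: _).
by rewrite mulrACA [ent g c' c * _]mulrC [ent g d' d * _]mulrC.
Qed.

Lemma coord_ring_act_id p : cact \1%VF p = p.
Proof.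
rewrite -[RHS]comp_mpoly_id /coord_ring_act; congr (_ \mPo _).
apply: eq_from_tnth => i; rewrite !tnth_mktuple.
rewrite (bigD1 (enum_val i).1) //= (bigD1 (enum_val i).2) //= !gl_entry1 !eqxx mulr1.
rewrite scale1r -mpolyX_qform !big1 ?addr0 // => [c cN|d dN].
  by rewrite big1 // => d _; rewrite gl_entry1 (negPf cN) mul0r scale0r.
by rewrite !gl_entry1 (negPf dN) mulr0 scale0r.
Qed.

Lemma coord_ring_act_eq0 g p : lker g == 0%VS -> (cact g p == 0) = (p == 0).
Proof.
move=> kg; apply/eqP/eqP=> [gp0|->]; last exact: coord_ring_act0.
by rewrite -[p]coord_ring_act_id -(lker0_compVf kg) -coord_ring_act_comp gp0 coord_ring_act0.
Qed.

Lemma coord_frac_act_to_frac g p : lker g == 0%VS ->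
  coord_frac_act e g (to_frac p) = to_frac (cact g p).
Proof.
move=> kg; rewrite /coord_frac_act.
set r := generic_quotient.repr _.
(* The chosen representative need not be [p / 1]; this relation survives the substitution and
   determines the quotient. *)
have rE : p * \d_r = \n_r.
  have : (\pi_(FracField.type {mpoly k[#|sym2_basis n|]}) (Ratio p 1) ==
          \pi_(FracField.type {mpoly k[#|sym2_basis n|]}) r)%qT.
    by rewrite /r reprK /to_frac; apply/eqP; rewrite piE.
  rewrite FracField.equivf_def !numden_Ratio ?oner_neq0 // mul1r.
  by move/eqP.
have dN0 : cact g \d_r != 0 by rewrite coord_ring_act_eq0 // denom_ratioP.
rewrite -rE coord_ring_actM /to_frac tofracM mulfK //.
by rewrite tofrac_eq0.
Qed.

End CoordRingAction.

(** * Multilinear expansion *)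

Section Multilinear.
Variables (k : fieldType) (n d : nat) (U : lmodType k).
Variable Phi : ('I_d -> 'I_n -> k) -> U.
Hypothesis Phi_ext : forall v v', v =2 v' -> Phi v = Phi v'.

Definition slot_upd (v : 'I_d -> 'I_n -> k) r a : 'I_d -> 'I_n -> k :=
  fun r' c => if r' == r then (c == a)%:R else v r' c.

Hypothesis Phi_slot : forall v r, Phi v = \sum_a v r a *: Phi (slot_upd v r a).

Lemma multilinear_expand (a0 : 'I_n) v :
  Phi v = \sum_(K : {ffun 'I_d -> 'I_n})
    (\prod_r v r (K r)) *: Phi (fun r c => (c == K r)%:R).
Proof.
pose part (s : seq 'I_d) (K : {ffun 'I_d -> 'I_n}) r c :=
  if r \in s then (c == K r)%:R else v r c.
(* Slots not yet expanded carry the dummy value [a0], so that each term of a partial expansion is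
   indexed once. *)
pose supp (s : seq 'I_d) (K : {ffun 'I_d -> 'I_n}) :=
  [forall r, (r \notin s) ==> (K r == a0)].
have key s : uniq s -> Phi v =
    \sum_(K | supp s K) (\prod_(r <- s) v r (K r)) *: Phi (part s K).
  elim: s => [_|x s IHs].
    rewrite (big_pred1 [ffun=> a0]) => [|K].
      by rewrite big_nil scale1r; apply: Phi_ext.
    apply/forallP/eqP => [K0|-> r]; last by rewrite ffunE eqxx.
    by apply/ffunP=> r; rewrite ffunE; apply/eqP/(implyP (K0 r)).
  move=> /= /andP[xs us]; rewrite (IHs us).
  under [LHS]eq_bigr => K _ do rewrite (Phi_slot _ x) scaler_sumr.
  rewrite [LHS]pair_big_dep /=.
  pose set_x (K : {ffun 'I_d -> 'I_n}) a : {ffun 'I_d -> 'I_n} :=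
    [ffun r => if r == x then a else K r].
  rewrite [RHS](reindex_onto (fun p => set_x p.1 p.2)
    (fun K => (set_x K a0, K x))) /=; last first.
    move=> K _; apply/ffunP=> r; rewrite !ffunE.
    by case: eqP => // ->.
  apply: eq_big => [[K a]|[K a] /= /andP[sK _]].
    rewrite /= andbT /supp; apply/idP/andP => [/forallP sK|[/forallP sK /eqP[KE _]]].
      split; first apply/forallP=> r.
        rewrite in_cons negb_or; apply/implyP=> /andP[rx rs].
        by rewrite ffunE (negPf rx) (implyP (sK r)).
      apply/eqP; congr (_, _); last by rewrite ffunE eqxx.
      apply/ffunP=> r; rewrite !ffunE; case: eqP => // ->.
      by apply/esym/eqP/(implyP (sK x)).
    apply/forallP=> r; apply/implyP=> rs; rewrite -KE !ffunE.
    have [//|rx] := eqVneq r x; have := sK r.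
    by rewrite in_cons negb_or rx rs /= ffunE (negPf rx).
  rewrite scalerA big_cons ffunE eqxx mulrC; congr (_ * _ *: _).
  - by rewrite /part (negPf xs).
  - apply: eq_big_seq => r rs; rewrite ffunE; case: eqP => // rx.
    by rewrite -rx rs in xs.
  - apply: Phi_ext => r c; rewrite /slot_upd /part in_cons ffunE.
    by case: eqP.
rewrite (key (index_enum 'I_d)) ?index_enum_uniq //; apply: eq_big => [K|K _].
  by apply/forallP=> r; rewrite mem_index_enum.
by congr (_ *: _); apply: Phi_ext => r c; rewrite /part mem_index_enum.
Qed.

End Multilinear.

(** The sign comes before [w] in the quantifiers: the same sign reorders a product of basis vectors
    and that of their images under [g]. *)
Lemma wprod_sort (n : nat) (s : seq 'I_n) : uniq s -> exists b : bool,
  forall (k : fieldType) (U : lmodType k) (w : 'I_n -> U -> U) (u0 : U),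
    (forall a c x, w a (c *: x) = c *: w a x) ->
    (forall a b x, w a (w b x) = - w b (w a x)) ->
  wprod w u0 s = (-1) ^+ b *: wprod w u0 (enum [set x in s]).
Proof.
elim: s => [_|a s IHs] /=.
  exists false => k U w u0 wZ w_anti; rewrite expr0 scale1r.
  by have -> // : [set x in [::]] = set0 :> {set 'I_n};
     [apply/setP=> c; rewrite !inE | rewrite enum_set0].
case/andP=> as1 /IHs[b IHb]; pose J := [set x in s].
have aJ : a \notin J by rewrite inE.
have [s1 [s2 [eJ eJ1 _]]] := enum_setU1 aJ.
exists (b (+) odd (size s1)) => k U w u0 wZ w_anti.
have -> : [set x in a :: s] = a |: J by apply/setP=> c; rewrite !inE.
rewrite eJ (wprod_move _ wZ w_anti) /= -eJ1 (IHb k U w u0 wZ w_anti) wZ scalerA.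
by rewrite -(signr_odd k (size s1)) -signr_addb addbK.
Qed.

(** * Equivariance of exterior products with polynomial coefficients *)

Section ExteriorAction.
Variables (k : fieldType) (char0 : [pchar k] =i pred0).
Variables (V : vectType k) (n : nat) (e : n.-tuple V).
Hypothesis e_basis : basis_of fullv e.
Local Notation F := (coord_frac k n).
Local Notation E := (ext_frac k n).
Local Notation cact := (coord_ring_act e).
Local Notation ent := (gl_entry e).
Implicit Types (g : 'End(V)) (p q : coord_ring k n) (x y : E) (J : {set 'I_n}).

Lemma ext_fscaleDr (f : F) x y : ext_fscale f (x + y) = ext_fscale f x + ext_fscale f y.
Proof. by apply/ffunP=> J; rewrite !ffunE mulrDr. Qed.

Lemma ext_fscaleDl (f f' : F) x : ext_fscale (f + f') x = ext_fscale f x + ext_fscale f' x.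
Proof. by apply/ffunP=> J; rewrite !ffunE mulrDl. Qed.

Lemma ext_fscaleA (f f' : F) x : ext_fscale f (ext_fscale f' x) = ext_fscale (f * f') x.
Proof. by apply/ffunP=> J; rewrite !ffunE mulrA. Qed.

Lemma ext_fscaleC (c : k) x : ext_fscale (to_frac c%:MP) x = c *: x.
Proof. by apply/ffunP=> J; rewrite !ffunE. Qed.

Lemma ext_fscale0l x : ext_fscale 0 x = 0.
Proof. by apply/ffunP=> J; rewrite !ffunE mul0r. Qed.

Lemma ext_fscale0r (f : F) : ext_fscale f (0 : E) = 0.
Proof. by apply/ffunP=> J; rewrite !ffunE mulr0. Qed.

Lemma ext_fscaleZr (f : F) (c : k) x : ext_fscale f (c *: x) = c *: ext_fscale f x.
Proof. by rewrite -!ext_fscaleC !ext_fscaleA mulrC. Qed.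

Lemma ext_fscaleZl p (c : k) x :
  ext_fscale (to_frac (c *: p)) x = c *: ext_fscale (to_frac p) x.
Proof. by rewrite -mul_mpolyC -ext_fscaleC ext_fscaleA -tofracM. Qed.

Lemma ext_fscale_sumr (f : F) (I : Type) (r : seq I) (P : pred I) (G : I -> E) :
  ext_fscale f (\sum_(i <- r | P i) G i) = \sum_(i <- r | P i) ext_fscale f (G i).
Proof. by apply: big_morph; [apply: ext_fscaleDr | apply: ext_fscale0r]. Qed.

Lemma ext_fscale_suml (I : Type) (r : seq I) (P : pred I) (G : I -> coord_ring k n) x :
  ext_fscale (to_frac (\sum_(i <- r | P i) G i)) x =
  \sum_(i <- r | P i) ext_fscale (to_frac (G i)) x.
Proof.
apply: (big_morph (fun q => ext_fscale (to_frac q) x)) => [p q|].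
  by rewrite /to_frac tofracD ext_fscaleDl.
by rewrite /to_frac tofrac0 ext_fscale0l.
Qed.

Definition vwedge (v : 'I_n -> k) x : E := \sum_a v a *: ext_wedge a x.

Lemma vwedgeZ v (c : k) x : vwedge v (c *: x) = c *: vwedge v x.
Proof.
rewrite /vwedge scaler_sumr; apply: eq_bigr => a _.
by rewrite ext_wedgeZ !scalerA mulrC.
Qed.

Lemma vwedge_anti u v x : vwedge u (vwedge v x) = - vwedge v (vwedge u x).
Proof.
rewrite /vwedge.
under eq_bigr => a _ do rewrite linear_sum scaler_sumr.
under [in RHS]eq_bigr => a _ do rewrite linear_sum scaler_sumr.
rewrite exchange_big -sumrN; apply: eq_bigr => b _; rewrite -sumrN.
apply: eq_bigr => a _; rewrite !linearZ /= !scalerA ext_wedge_anti scalerN.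
by rewrite mulrC.
Qed.

Lemma vwedge_sqr v x : vwedge v (vwedge v x) = 0.
Proof.
have := vwedge_anti v v x; set y := vwedge _ _ => yN.
have : 2%:R *: y = 0 by rewrite scaler_nat mulr2n {1}yN addNr.
by move/eqP; rewrite scaler_eq0 pnatr_neq0 // => /eqP.
Qed.

Definition gwedge g a : E -> E := vwedge (fun c => ent g c a).

(** On polynomial coefficients [coord_frac_act] is plain substitution, hence additive; the images of
    tensors below are of this kind. *)
Definition ext_poly x := forall J, exists p, x J = to_frac p.

Lemma ext_act_delta g p J : lker g == 0%VS ->
  ext_act e g (ext_fscale (to_frac p) (ext_delta k J)) =
  ext_fscale (to_frac (cact g p)) (ext_act_basis e g J).
Proof.
move=> kg; rewrite /ext_act (bigD1 J) //= !ffunE eqxx mulr1.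
rewrite coord_frac_act_to_frac // big1 ?addr0 // => J' J'N.
rewrite !ffunE (negPf J'N) mulr0 -(tofrac0 {mpoly k[#|sym2_basis n|]}).
by rewrite coord_frac_act_to_frac // coord_ring_act0 /to_frac tofrac0 ext_fscale0l.
Qed.

Lemma ext_act_wedge g p s : lker g == 0%VS ->
  ext_act e g (ext_fscale (to_frac p) (wedge k s)) =
  ext_fscale (to_frac (cact g p)) (wprod (gwedge g) (ext_one k n) s).
Proof.
move=> kg; have [us|Nus] := boolP (uniq s); last first.
  rewrite (wprod_not_uniq _ (fun a => vwedgeZ _) (fun a b => vwedge_anti _ _)) //; last first.
    by move=> a x; apply: vwedge_sqr.
  rewrite /wedge (wprod_not_uniq _ (@ext_wedgeZ k n) (@ext_wedge_anti k n)
    (@ext_wedge_sqr k n)) //.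
  rewrite !ext_fscale0r -(ext_fscale0l (ext_delta k set0)).
  rewrite -(tofrac0 {mpoly k[#|sym2_basis n|]}).
  by rewrite ext_act_delta // coord_ring_act0 /to_frac tofrac0 !ext_fscale0l.
have [b bP] := wprod_sort us.
rewrite /wedge bP; [|exact: ext_wedgeZ|exact: ext_wedge_anti].
rewrite -/(wedge k _) wedge_enum ext_fscaleZr -ext_fscaleZl ext_act_delta //.
rewrite bP; [|by move=> a c x; apply: vwedgeZ|by move=> a c x; apply: vwedge_anti].
by rewrite coord_ring_actZ ext_fscaleZl ext_fscaleZr.
Qed.

Lemma ext_poly_fscale_wedge p s : ext_poly (ext_fscale (to_frac p) (wedge k s)).
Proof.
move=> J; have [b ->] := wedgeP k s; case: ifP => _; last first.
  by exists 0; rewrite !ffunE mulr0 /to_frac tofrac0.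
exists ((-1) ^+ b *: p * (J == [set x in s])%:R); rewrite !ffunE.
by rewrite -mul_mpolyC /to_frac !tofracM rmorph_nat mulrCA mulrA.
Qed.

Lemma ext_actP g (c : k) x y : lker g == 0%VS -> ext_poly x -> ext_poly y ->
  ext_act e g (c *: x + y) = c *: ext_act e g x + ext_act e g y.
Proof.
move=> kg px py; rewrite /ext_act scaler_sumr -big_split /=; apply: eq_bigr => J _.
rewrite !ffunE; have [p ->] := px J; have [q ->] := py J.
rewrite coord_frac_scaleE -tofracM -tofracD mul_mpolyC.
rewrite -[FracField.tofrac _]/(to_frac _) !coord_frac_act_to_frac //.
rewrite coord_ring_actD coord_ring_actZ.
by rewrite {1}/to_frac tofracD ext_fscaleDl ext_fscaleZl.
Qed.

Lemma ext_polyP (c : k) x y : ext_poly x -> ext_poly y -> ext_poly (c *: x + y).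
Proof.
move=> px py J; have [p pE] := px J; have [q qE] := py J.
by exists (c%:MP * p + q); rewrite !ffunE pE qE coord_frac_scaleE -tofracM -tofracD.
Qed.

Lemma ext_act_sum g (I : finType) (c : I -> k) (x : I -> E) : lker g == 0%VS ->
    (forall i, ext_poly (x i)) ->
  ext_act e g (\sum_i c i *: x i) = \sum_i c i *: ext_act e g (x i).
Proof.
move=> kg px; have p0 : ext_poly 0.
  by move=> J; exists 0; rewrite ffunE /to_frac tofrac0.
suff [] : ext_poly (\sum_i c i *: x i) /\
    ext_act e g (\sum_i c i *: x i) = \sum_i c i *: ext_act e g (x i) by [].
elim/big_rec2: _ => [|i y1 y2 _ [py2 <-]].
  split=> //; have := ext_actP 0 kg p0 p0; rewrite !scale0r !add0r => _.
  rewrite /ext_act big1 // => J _; rewrite ffunE -(tofrac0 {mpoly k[#|sym2_basis n|]}).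
  by rewrite coord_frac_act_to_frac // coord_ring_act0 /to_frac tofrac0 ext_fscale0l.
by split; [apply: ext_polyP | apply: ext_actP].
Qed.

End ExteriorAction.

(** * From tensors to Clifford sections *)

Section TensorToClifford.
Variables (k : fieldType) (char0 : [pchar k] =i pred0) (n d : nat).
Local Notation T := (tensor k n d).
Local Notation E := (ext_frac k n).
Local Notation idx := {ffun 'I_d -> 'I_n}.
Implicit Types (u : T) (I : idx) (t h : 'S_d).

Definition pair_monomial t I : coord_ring k n :=
  \prod_(r in lowpts t) qform k (I r) (I (t r)).

Definition fix_wedge t I : E := wedge k [seq I r | r <- enum (fixpts t)].

Definition clifford_term t I : E :=
  ext_fscale (to_frac (pair_monomial t I)) (fix_wedge t I).

(* Pairs the slots interchanged by [t] with the quadratic form and multiplies  *)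
(* the slots fixed by [t] in the exterior algebra.                             *)
Definition clifford_map t u : E := \sum_I (u I : k) *: clifford_term t I.

Fact clifford_map_linear t : linear (clifford_map t).
Proof.
move=> c u v; rewrite /clifford_map scaler_sumr -big_split; apply: eq_bigr => I _.
by rewrite !ffunE scalerDl scalerA.
Qed.

HB.instance Definition _ t := GRing.isLinear.Build k T E _ (clifford_map t)
  (clifford_map_linear t).

Section Equivariance.
Variables (V : vectType k) (e : n.-tuple V) (e_basis : basis_of fullv e).
Variables (t : 'S_d) (tK : involutive t).
Local Notation ent := (gl_entry e).

(** The pairing and wedging of a pure tensor with an arbitrary vector [v r] in slot [r]. Basis
    vectors give [clifford_term], and their images under [g] give its transform, so equivariance
    becomes multilinear expansion. *)
Definition vterm (v : 'I_d -> 'I_n -> k) : E :=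
  ext_fscale (to_frac (\prod_(r in lowpts t)
                \sum_a \sum_b (v r a * v (t r) b) *: qform k a b))
    (wprod (fun r => vwedge (v r)) (ext_one k n) (enum (fixpts t))).

Lemma vterm_ext v v' : v =2 v' -> vterm v = vterm v'.
Proof.
move=> vE; rewrite /vterm; congr (ext_fscale (to_frac _) _).
  apply: eq_bigr => r _; apply: eq_bigr => a _; apply: eq_bigr => b _.
  by rewrite !vE.
elim: (enum _) => //= r s ->; apply: eq_bigr => a _; by rewrite vE.
Qed.

Lemma vterm_delta I : vterm (fun r c => (c == I r)%:R) = clifford_term t I.
Proof.
congr (ext_fscale (to_frac _) _).
  apply: eq_bigr => r _; rewrite (bigD1 (I r)) //= (bigD1 (I (t r))) //= !eqxx.
  rewrite mulr1 scale1r !big1 ?addr0 // => [a /negPf aN|b /negPf bN].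
    by rewrite big1 // => b _; rewrite aN mul0r scale0r.
  by rewrite bN mulr0 scale0r.
rewrite /fix_wedge /wedge /wprod foldr_map; elim: (enum _) => //= r s ->.
rewrite /vwedge (bigD1 (I r)) //= eqxx scale1r big1 ?addr0 // => a /negPf ->.
by rewrite scale0r.
Qed.

Let wprod_out (v v' : 'I_d -> 'I_n -> k) (s : seq 'I_d) :
    (forall r, r \in s -> v r =1 v' r) ->
  wprod (fun r => vwedge (v r)) (ext_one k n) s =
  wprod (fun r => vwedge (v' r)) (ext_one k n) s.
Proof.
elim: s => //= r s IHs vE; rewrite IHs => [|r' r's]; last first.
  by apply: vE; rewrite in_cons r's orbT.
by apply: eq_bigr => a _; rewrite vE ?in_cons ?eqxx.
Qed.

Let wprod_slot v x (s : seq 'I_d) : uniq s -> x \in s ->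
  wprod (fun r => vwedge (v r)) (ext_one k n) s =
  \sum_a v x a *: wprod (fun r => vwedge (slot_upd v x a r)) (ext_one k n) s.
Proof.
elim: s => //= r s IHs /andP[rs us]; rewrite in_cons.
case: (eqVneq x r) => [-> _|xr /= xs].
  apply: eq_bigr => a _; congr (_ *: _).
  rewrite [RHS]/vwedge (bigD1 a) //= /slot_upd !eqxx scale1r big1 ?addr0.
    congr (ext_wedge _ _); apply: wprod_out => r' r's c.
    by case: eqP => // r'r; rewrite -r'r r's in rs.
  by move=> b /negPf ->; rewrite scale0r.
rewrite (IHs us xs) /vwedge.
under [LHS]eq_bigr => b _ do rewrite linear_sum scaler_sumr.
rewrite [LHS]exchange_big /=; apply: eq_bigr => a _; rewrite scaler_sumr.
apply: eq_bigr => b _; rewrite linearZ /= !scalerA mulrC.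
by rewrite {2}/slot_upd eq_sym (negPf xr).
Qed.

Let pairsum (v : 'I_d -> 'I_n -> k) r : coord_ring k n :=
  \sum_a \sum_b (v r a * v (t r) b) *: qform k a b.

Let pairsum_out v v' r : v r =1 v' r -> v (t r) =1 v' (t r) ->
  pairsum v r = pairsum v' r.
Proof.
move=> e1 e2; apply: eq_bigr => a _; apply: eq_bigr => b _.
by rewrite e1 e2.
Qed.

Let lowN r : r \in lowpts t -> t r != r.
Proof. by rewrite inE; apply: contraTneq => ->; rewrite ltnn. Qed.

Let low_low r : r \in lowpts t -> t r \notin lowpts t.
Proof. by rewrite !inE tK -leqNgt; apply: ltnW. Qed.

(** Slot [x] enters only the factor of its own 2-cycle, so linearity of that factor is enough. *)
Let vterm_low v r x : r \in lowpts t -> (x = r) \/ (x = t r) ->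
    (pairsum v r = \sum_a v x a *: pairsum (slot_upd v x a) r) ->
  vterm v = \sum_a v x a *: vterm (slot_upd v x a).
Proof.
move=> rl xE sumE; rewrite /vterm (bigD1 r) //= -/(pairsum v r) sumE mulr_suml.
rewrite ext_fscale_suml; apply: eq_bigr => a _.
rewrite -scalerAl ext_fscaleZl; congr (_ *: _).
rewrite [in RHS](bigD1 r) //=; congr (ext_fscale (to_frac (_ * _)) _).
  apply: eq_bigr => r' /andP[r'l r'N].
  have trN : t r' != r by apply: contraTneq r'l => tr'; rewrite -[r']tK tr' low_low.
  have out z : z != r -> z != t r -> v z =1 slot_upd v x a z.
    move=> z1 z2 c; rewrite /slot_upd; case: eqP => // zx.
    by case: xE zx z1 z2 => -> ->; rewrite eqxx.
  apply: pairsum_out; apply: out => //.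
    by apply: contraTneq r'l => ->; apply: low_low.
  by rewrite (inj_eq perm_inj).
apply: wprod_out => z; rewrite mem_enum inE => /eqP tz c.
rewrite /slot_upd; case: eqP => // zx; case/eqP: (lowN rl).
by case: xE => xE; move: tz; rewrite zx xE ?tK.
Qed.

Lemma vterm_slot v x : vterm v = \sum_a v x a *: vterm (slot_upd v x a).
Proof.
case: (ltngtP x (t x)) => [lt_x|gt_x|/val_inj tx].
- have xl : x \in lowpts t by rewrite inE.
  apply: (vterm_low xl); first by left.
  apply: eq_bigr => a _; rewrite /pairsum [in RHS](bigD1 a) //= [X in _ *: (_ + X)]big1 ?addr0.
    rewrite scaler_sumr; apply: eq_bigr => b _; rewrite scalerA /slot_upd !eqxx.
    by rewrite (negPf (lowN xl)) mul1r.
  move=> b /negPf bN; rewrite big1 // => c _.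
  by rewrite /slot_upd eqxx bN mul0r scale0r.
- have xl : t x \in lowpts t by rewrite inE tK.
  apply: (vterm_low xl); first by right; rewrite tK.
  rewrite /pairsum exchange_big; apply: eq_bigr => b _; rewrite tK scaler_sumr.
  apply: eq_bigr => a _; rewrite (bigD1 b) //= big1 ?addr0.
    rewrite scalerA /slot_upd !eqxx; have := lowN xl; rewrite tK eq_sym => /negPf ->.
    by rewrite mulr1 mulrC.
  by move=> c /negPf cN; rewrite /slot_upd eqxx cN mulr0 scale0r.
have xf : x \in enum (fixpts t) by rewrite mem_enum inE -tx.
rewrite /vterm (wprod_slot _ (enum_uniq _) xf) ext_fscale_sumr.
apply: eq_bigr => a _; rewrite ext_fscaleZr; congr (_ *: ext_fscale (to_frac _) _).
apply: eq_bigr => r rl; apply: pairsum_out => c; rewrite /slot_upd.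
  by case: eqP => // rx; have := lowN rl; rewrite rx -tx eqxx.
case: eqP => // trx; have := lowN rl; rewrite trx -[r]tK trx.
by rewrite -tx eqxx.
Qed.

Lemma clifford_term_act (g : 'End(V)) (a0 : 'I_n) I : lker g == 0%VS ->
  ext_act e g (clifford_term t I) =
  \sum_(K : idx) (\prod_r ent g (K r) (I r)) *: clifford_term t K.
Proof.
move=> kg; rewrite /clifford_term /fix_wedge ext_act_wedge //.
rewrite coord_ring_act_prod.
transitivity (vterm (fun r c => ent g c (I r))).
  congr (ext_fscale (to_frac _) _); last by rewrite /wprod foldr_map.
  by apply: eq_bigr => r _; apply: coord_ring_act_qform.
rewrite (multilinear_expand vterm_ext vterm_slot a0).
by apply: eq_bigr => K _; rewrite vterm_delta.
Qed.

Lemma clifford_map_act (g : 'End(V)) (a0 : 'I_n) u : lker g == 0%VS ->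
  clifford_map t (tensor_act e g u) = ext_act e g (clifford_map t u).
Proof.
move=> kg; rewrite [in RHS]/clifford_map ext_act_sum // => [|I]; last first.
  exact: ext_poly_fscale_wedge.
under [RHS]eq_bigr => I _ do rewrite clifford_term_act // scaler_sumr.
rewrite exchange_big; apply: eq_bigr => K _; rewrite ffunE scaler_suml.
by apply: eq_bigr => I _; rewrite scalerA mulrC.
Qed.

End Equivariance.
End TensorToClifford.

(** * The kernel of the pairing map and the signed centralizer *)

Section CliffordMapKernel.
Variables (k : fieldType) (char0 : [pchar k] =i pred0) (n d : nat).
Variables (t : 'S_d) (tK : involutive t).
Local Notation T := (tensor k n d).
Local Notation idx := {ffun 'I_d -> 'I_n}.
Implicit Types (u : T) (I : idx) (h : 'S_d).

(** The 2-cycles of [t] are permuted by [h], perhaps with their ends exchanged, which [Q] does not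
    see. *)
Lemma prod_lowpts_cent (R : comNzRingType) (Q : 'I_d -> R) h :
    h \in 'C[t] -> (forall r, Q (t r) = Q r) ->
  \prod_(r in lowpts t) Q (h r) = \prod_(r in lowpts t) Q r.
Proof.
move=> Ch Qt; pose lo r := if r \in lowpts t then r else t r.
have loQ r : Q (lo r) = Q r by rewrite /lo; case: ifP.
have low_moved r : r \in lowpts t -> t r != r.
  by rewrite inE; apply: contraTneq => ->; rewrite ltnn.
have lo_low r : t r != r -> lo r \in lowpts t.
  rewrite /lo; case: ifP => // /negbT; rewrite !inE tK -leqNgt leq_eqVlt val_eqE.
  by case: eqP.
have cent_moved g r : g \in 'C[t] -> t r != r -> t (g r) != g r.
  by move=> /perm_cent1P Cg; rewrite -Cg (inj_eq perm_inj).
have loK g r : g \in 'C[t] -> r \in lowpts t -> lo (g^-1%g (lo (g r))) = r.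
  move=> Cg rl; rewrite {2}/lo; case: ifP => _; first by rewrite permK /lo rl.
  rewrite -(perm_cent1P _ _ Cg) permK /lo tK.
  case: ifP => //; move: rl; rewrite !inE tK => lt1 lt2.
  by have := ltn_trans lt1 lt2; rewrite ltnn.
rewrite [RHS](reindex_onto (fun r => lo (h r)) (fun r => lo (h^-1%g r))) /=.
  apply: eq_big => [r|r _]; last by rewrite loQ.
  have [rl|rl] := boolP (r \in lowpts t).
    by rewrite loK // eqxx lo_low // cent_moved // low_moved.
  apply/esym/negbTE; rewrite negb_and -implybE; apply/implyP=> hl.
  apply: contra rl => /eqP <-; apply: lo_low; apply: cent_moved; first by rewrite groupV.
  exact: low_moved.
move=> r rl; have := loK h^-1%g r; rewrite groupV invgK; exact.
Qed.

Lemma clifford_term_cent h I : h \in 'C[t] ->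
  pair_monomial k t [ffun r => I (h r)] = pair_monomial k t I /\
  fix_wedge k t [ffun r => I (h r)] = (-1) ^+ fodd t h *: fix_wedge k t I.
Proof.
move=> Ch; split.
  rewrite /pair_monomial -(prod_lowpts_cent (Q := fun r => qform k (I r) (I (t r))) Ch).
    by apply: eq_bigr => r _; rewrite !ffunE (perm_cent1P _ _ Ch).
  by move=> r; rewrite tK qformC.
rewrite /fix_wedge /fodd -(wprod_perm _ (@ext_wedgeZ k n) (@ext_wedge_anti k n)).
  congr wprod; apply/eq_in_map => r; rewrite mem_enum => fr.
  by rewrite ffunE restr_permE // cent1_norm_fixpts.
exact: restr_perm_on.
Qed.

Lemma clifford_map_perm h u : h \in 'C[t] ->
  clifford_map t (tensor_perm h u) = (-1) ^+ fodd t h *: clifford_map t u.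
Proof.
move=> Ch; rewrite /clifford_map scaler_sumr.
pose f (I : idx) : idx := [ffun r => I (h r)].
have f_bij : {on [pred _ | true], bijective f}.
  exists (fun J : idx => [ffun r => J (h^-1%g r)]) => J _.
    by apply/ffunP=> r; rewrite !ffunE permKV.
  by apply/ffunP=> r; rewrite !ffunE permK.
rewrite [RHS](reindex f) //=; apply: eq_bigr => I _.
have [e1 e2] := clifford_term_cent I Ch.
rewrite ffunE -/(f I) /clifford_term {2}/f e1 e2 ext_fscaleZr !scalerA.
by rewrite mulrCA -signr_addb addbb mulr1.
Qed.

(** Up to a scalar that is nonzero in characteristic zero, [clifford_map t] factors through
    [geps k t]; identities for [geps] in the group algebra thus pass to sections. *)
Lemma clifford_map_geps u :
  clifford_map t (tact (geps k t) u) = #|'C[t]|%:R *: clifford_map t u.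
Proof.
rewrite tact_suml linear_sum (eq_bigr (fun=> clifford_map t u)) => [|h Ch].
  by rewrite sumr_const scaler_nat.
rewrite tactZl tact_gelt linearZ /= clifford_map_perm // scalerA.
by rewrite -signr_addb addbb scale1r.
Qed.

Definition pair_multinom I : 'X_{1..#|sym2_basis n|} :=
  (\sum_(r in lowpts t) U_(qidx (I r) (I (t r))))%MM.

Lemma pair_monomialE I : pair_monomial k t I = 'X_[pair_multinom I].
Proof.
by rewrite -mprodXE; apply: eq_bigr => r _; rewrite qformE.
Qed.

Lemma pair_multinom_count I i : pair_multinom I i =
  count_mem i [seq qidx (I r) (I (t r)) | r <- enum (lowpts t)].
Proof.
rewrite mnm_sumE count_map -sum1_count [RHS]big_mkcond -big_enum /=.
by apply: eq_bigr => r _; rewrite mnm1E; case: eqP.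
Qed.

Lemma pair_multinom_conj I I' : pair_multinom I = pair_multinom I' ->
    perm_eq [seq I r | r <- enum (fixpts t)] [seq I' r | r <- enum (fixpts t)] ->
  exists2 h : 'S_d, h \in 'C[t] & I = [ffun r => I' (h r)].
Proof.
move=> eq_m eq_fix.
have u_pair (a b a' b' : 'I_n) : qidx a b = qidx a' b' ->
    (a = a' /\ b = b') \/ (a = b' /\ b = a').
  by move/(congr1 enum_val); rewrite !enum_val_qidx; apply: pair_low_inj.
have [|h [tE IE]] := invol_conj u_pair tK tK eq_fix.
  by apply/allP=> i _ /=; rewrite -!pair_multinom_count eq_m.
exists h; last by apply/ffunP=> r; rewrite ffunE IE.
by apply/cent1P; rewrite /commute {1}tE conjgE mulKVg.
Qed.

(** The coefficient of the monomial and basis vector of [I0] receives contributions only from the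
    orbit of [I0] under the centralizer, and the signed invariance of [u] makes them all equal. *)
Lemma clifford_map_inj u :
    (forall h, h \in 'C[t] -> tensor_perm h u = (-1) ^+ fodd t h *: u) ->
  clifford_map t u = 0 -> u = 0.
Proof.
move=> u_cent map0; apply/ffunP=> I0; rewrite [RHS]ffunE.
have [I0_inj|] := boolP (dinjectiveb I0 (mem (fixpts t))); last first.
  (* When [I0] repeats on two fixed slots, their transposition lies in the centralizer with sign -1
     and fixes [I0]. *)
  case/dinjectivePn=> r fr [r']; rewrite inE /= => /andP[r'r fr'] Irr'.
  have Ch : tperm r r' \in 'C[t].
    apply/perm_cent1P=> x; case: (tpermP r r' x) => [->|->|xr xr'].
    - by rewrite (fixptsP _ _ fr) tpermL (fixptsP _ _ fr').
    - by rewrite (fixptsP _ _ fr') tpermR (fixptsP _ _ fr).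
    rewrite tpermD //; apply/eqP.
      by move=> rtx; case: xr; rewrite -[x]tK -rtx (fixptsP _ _ fr).
    by move=> rtx; case: xr'; rewrite -[x]tK -rtx (fixptsP _ _ fr').
  apply: (tensor_antisym0 char0 (g := tperm r r')); last first.
    by apply/ffunP=> x; rewrite ffunE; case: tpermP => // ->.
  rewrite u_cent // /fodd (_ : restr_perm _ _ = tperm r r').
    by rewrite odd_tperm eq_sym r'r expr1 scaleN1r.
  apply/permP=> x; have [fx|fx] := boolP (x \in fixpts t).
    by rewrite restr_permE ?cent1_norm_fixpts.
  rewrite (out_perm (restr_perm_on _ _) fx) tpermD //.
    by apply: contraNneq fx => <-.
  by apply: contraNneq fx => <-.
have uI0 : uniq [seq I0 r | r <- enum (fixpts t)] by exact: I0_inj.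
pose J0 := [set x in [seq I0 r | r <- enum (fixpts t)]].
(* The number [sg I] is the coefficient of [J0] in the wedge part of [I]: one of 0, 1 and -1. *)
have [sg sgP] : exists sg : idx -> k, forall I,
    fix_wedge k t I J0 = to_frac (sg I)%:MP /\
    (sg I != 0 -> perm_eq [seq I r | r <- enum (fixpts t)]
                          [seq I0 r | r <- enum (fixpts t)]).
  apply: (fin_all_exists (P := fun (I : idx) (c : k) =>
    fix_wedge k t I J0 = to_frac c%:MP /\
    (c != 0 -> perm_eq [seq I r | r <- enum (fixpts t)]
                          [seq I0 r | r <- enum (fixpts t)]))) => I.
  have [b bE] := wedgeP k [seq I r | r <- enum (fixpts t)].
  rewrite /fix_wedge bE; case: (boolP (uniq _)) => [uI|_]; last first.
    by exists 0; rewrite ffunE mpolyC0 /to_frac tofrac0 eqxx.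
  exists ((-1) ^+ b * (J0 == [set x in [seq I r | r <- enum (fixpts t)]])%:R).
  split; first by rewrite !ffunE coord_frac_scaleE mpolyCM /to_frac tofracM mpolyC_nat rmorph_nat.
  case: (J0 =P _) => [eJ _|_]; last by rewrite mulr0 eqxx.
  by apply: uniq_perm => // x; have := congr1 (fun A : {set 'I_n} => x \in A) eJ; rewrite !inE.
have sg_cent I h : h \in 'C[t] -> sg [ffun r => I (h r)] = (-1) ^+ fodd t h * sg I.
  move=> Ch; have [_ e2] := clifford_term_cent I Ch.
  have [eh _] := sgP [ffun r => I (h r)]; have [eI _] := sgP I.
  move: eh; rewrite e2 ffunE eI coord_frac_scaleE -tofracM -mpolyCM => /eqP.
  by rewrite tofrac_eq mpolyC_eq => /eqP.
have sg0 : sg I0 != 0.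
  have [e0 _] := sgP I0; have [b bE] := wedgeP k [seq I0 r | r <- enum (fixpts t)].
  apply/negP=> /eqP sg00; move: e0.
  rewrite sg00 /fix_wedge bE uI0 !ffunE eqxx coord_frac_scaleE mulr1 => /eqP.
  rewrite tofrac_eq mpolyC_eq.
  by rewrite signr_eq0.
have coef0 : \sum_I (u I : k) * (sg I * (pair_multinom I == pair_multinom I0)%:R) = 0.
  have := congr1 (fun x : ext_frac k n => x J0) map0.
  rewrite /clifford_map sum_ffunE [RHS]ffunE.
  under eq_bigr => I _.
    have [eI _] := sgP I; rewrite !ffunE eI pair_monomialE coord_frac_scaleE.
    rewrite -!tofracM; over.
  rewrite -rmorph_sum => /eqP; rewrite tofrac_eq0 => /eqP/(congr1 (mcoeff (pair_multinom I0))).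
  rewrite raddf_sum mcoeff0 /= => sum0; rewrite -[RHS]sum0; apply: eq_bigr => I _.
  by rewrite mcoeffCM [_ * (sg I)%:MP]mulrC mcoeffCM mcoeffX.
pose N := #|[set I : idx | (pair_multinom I == pair_multinom I0) && (sg I != 0)]|.
have : N%:R * ((u I0 : k) * sg I0) = 0.
  rewrite -[RHS]coef0 mulr_natl -sumr_const big_mkcond; apply: eq_bigr => I _.
  rewrite inE; case: eqP => [eqm|_]; last by rewrite !mulr0.
  have [->|sgI] := eqVneq (sg I) 0; first by rewrite mul0r mulr0.
  have [_ /(_ sgI) eqf] := sgP I; have [h Ch IE] := pair_multinom_conj eqm eqf.
  rewrite mulr1 /= {2}IE sg_cent //.
  have -> : u I = (-1) ^+ fodd t h * u I0.
    have := congr1 (fun w : T => w I0) (u_cent h Ch); rewrite !ffunE.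
    by rewrite -IE.
  by rewrite mulrACA -signr_addb addbb mul1r.
move/eqP; rewrite !mulf_eq0 (negPf sg0) orbF pnatr_neq0 // => /orP[|/eqP //].
rewrite cards_eq0 => /eqP/setP/(_ I0); rewrite !inE eqxx sg0.
by [].
Qed.

End CliffordMapKernel.

(** * Global sections of the Clifford sheaves *)

Lemma mpolyX_neq0 (R : nzRingType) (N : nat) (m : 'X_{1..N}) :
  'X_[m] != 0 :> {mpoly R[N]}.
Proof. by rewrite -msupp_eq0 msuppX. Qed.

Lemma mpoly_div_var (R : comNzRingType) (N : nat) (p : {mpoly R[N]}) (i : 'I_N) m :
    (forall u, u \in msupp p -> (m <= u i)%N) ->
  exists2 q, p = q * 'X_i ^+ m &
    forall d, p \is d.-homog -> q \is (d - m).-homog.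
Proof.
move=> le_m; have subE u : u \in msupp p -> (u - U_(i) *+ m + U_(i) *+ m)%MM = u.
  move=> /le_m lemu; apply: submK; apply/mnm_lepP=> j; rewrite mulmnE mnm1E.
  by case: eqP => [<-|_]; rewrite ?mul1n ?mul0n.
exists (\sum_(u <- msupp p) p@_u *: 'X_[u - U_(i) *+ m]) => [|d /dhomogP p_hom].
  rewrite {1}[p]mpolyE mulr_suml; apply: eq_big_seq => u pu.
  by rewrite mpolyXn -scalerAl -mpolyXD subE.
rewrite big_seq; apply: rpred_sum => u pu; apply: rpredZ; rewrite dhomogX.
have := congr1 mdeg (subE u pu); rewrite mdegD mdegMn mdeg1 mul1n (p_hom u pu).
by move=> <-; rewrite addnK.
Qed.

Section GlobalSections.
Variables (k : fieldType) (n : nat) (n_ge1 : (1 <= n)%N).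
Local Notation N := #|sym2_basis n|.
Implicit Types (x : ext_frac k n) (J : {set 'I_n}).

(** Exterior powers of V with coefficients in Sym^s (Sym^2 V), free of denominators. *)
Definition poly_section (i : nat) x := forall J, x J = 0 \/
  exists s p, [/\ (#|J| + s.*2 = i)%N, p \is s.-homog & x J = to_frac p].

Lemma leq_card_sym2_basis : (n <= N)%N.
Proof.
have diag_inj : injective (fun a : 'I_n => (a, a)) by move=> a b [].
rewrite -[leqLHS]card_ord -cardsT -(card_imset _ diag_inj).
by apply/subset_leq_card/subsetP=> _ /imsetP[a _ ->]; rewrite inE /=.
Qed.

(** A coefficient regular on the charts of two different variables has a denominator that divides
    its numerator. *)
Lemma global_section_poly i x :
  clifford_global_section i x -> poly_section i x.
Proof.
move=> gx J; have [->|xJ] := eqVneq (x J) 0; [by left|right].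
have N_gt0 : (0 < N)%N by apply: leq_trans leq_card_sym2_basis.
have sectP (j : 'I_N) : exists2 s : int, #|J|%:Z = i%:Z - 2 * s &
    twist_section s 'X_j (x J).
  have [||x0|//] := gx 'X_j _ _ J.
  - by rewrite dhomogX /= mdeg1.
  - by rewrite mpolyX_neq0.
  - by rewrite x0 eqxx in xJ.
pose i0 : 'I_N := Ordinal N_gt0.
have [s sE [m [d [p [dE p_hom fE]]]]] := sectP i0.
have XN0 (j : 'I_N) m' : to_frac ('X_j ^+ m' : coord_ring k n) != 0.
  by rewrite tofrac_eq0 expf_neq0 // mpolyX_neq0.
have pN0 : p != 0.
  by apply: contraNneq xJ => p0; rewrite fE p0 /to_frac tofrac0 mul0r.
have le_m u : u \in msupp p -> (m <= u i0)%N.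
  (* With a single variable P(U) is a point, where O(s) has sections even for negative s. But then
     [#|J| <= 1], and [#|J| = i - 2 * s] with [i] nonnegative leaves only [s >= 0]. *)
  move=> pu; have [N1|N_gt1] := leqP N 1.
    have uE : mdeg u = u i0.
      rewrite mdegE (bigD1 i0) //= big1 ?addn0 // => j jN.
      by case/eqP: jN; apply/val_inj/eqP; rewrite -leqn0 -ltnS; apply: leq_trans (ltn_ord j) N1.
    have := dhomog_mf p_hom pu; rewrite /= uE => ->.
    have cJ : (#|J| <= n)%N by rewrite -[leqRHS]card_ord max_card.
    have := leq_card_sym2_basis; lia.
  pose i1 : 'I_N := Ordinal N_gt1.
  have [s' s'E [m' [d' [p' [d'E p'_hom f'E]]]]] := sectP i1.
  have eq_p : p * 'X_i1 ^+ m' = p' * 'X_i0 ^+ m.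
    apply/eqP; rewrite -tofrac_eq !tofracM; apply/eqP.
    have : to_frac p / to_frac 'X_i0 ^+ m = to_frac p' / to_frac 'X_i1 ^+ m'.
      by rewrite -fE -f'E.
    rewrite -!tofracXn => /eqP; rewrite eqr_div ?XN0 // => /eqP.
    by [].
  (* The shifted monomial occurs in a multiple of ['X_i0 ^+ m], and the shift leaves the exponent of
     ['X_i0] alone. *)
  have : (u + U_(i1) *+ m')%MM \in msupp (p' * 'X_i0 ^+ m).
    by rewrite -eq_p mpolyXn mcoeff_msupp addmC mcoeffMX -mcoeff_msupp.
  rewrite mpolyXn => /msuppM_le/allpairsP[[u1 u2] /= [_ ]].
  rewrite msuppX mem_seq1 => /eqP -> /mnmP/(_ i0).
  rewrite !mnmDE !mulmnE !mnm1E eqxx (_ : (i1 == i0) = false) // mul0n addn0 mul1n => ->.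
  exact: leq_addl.
have [q pE q_hom] := mpoly_div_var le_m.
have [u0 pu0] : exists u, u \in msupp p.
  have := pN0; rewrite -msupp_eq0; case: (msupp p) => // u r _.
  by exists u; rewrite mem_head.
have lemd : (m <= d)%N.
  rewrite -(dhomog_mf p_hom pu0); apply: leq_trans (le_m u0 pu0) _.
  by rewrite /= mdegE (bigD1 i0) //= leq_addr.
exists (d - m)%N, q; split; [lia | exact: q_hom|].
have X0 : to_frac ('X_i0 : coord_ring k n) ^+ m != 0.
  by have := XN0 i0 m; rewrite {1}/to_frac tofracXn.
have pE' : to_frac p = to_frac q * to_frac 'X_i0 ^+ m.
  by rewrite -tofracXn -tofracM -pE.
by rewrite fE pE' (mulfK X0).
Qed.

Lemma poly_global_section i x :
  poly_section i x -> clifford_global_section i x.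
Proof.
clear n_ge1 => px l l_hom lN0 J.
have [->|[s [p [sE p_hom xE]]]] := px J; [by left|right].
exists s%:Z; first by lia.
by exists 0%N, s, p; split=> //; [rewrite addr0 | rewrite expr0 divr1].
Qed.

Section CliffordMapSections.
Variable d : nat.
Local Notation T := (tensor k n d).
Local Notation idx := {ffun 'I_d -> 'I_n}.

Lemma pair_monomial_homog (t : 'S_d) (I : idx) :
  pair_monomial k t I \is #|lowpts t|.-homog.
Proof.
rewrite pair_monomialE dhomogX /= /pair_multinom mdeg_sum /=.
by rewrite (eq_bigr (fun=> 1%N)) ?sum1_card // => r _; rewrite mdeg1.
Qed.

(** The image lives on the sets [J] with as many elements as [t] has fixed points, which separates
    the various [m]. *)
Lemma clifford_map_coord (t : 'S_d) (u : T) J : exists p,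
  [/\ p \is #|lowpts t|.-homog, clifford_map t u J = to_frac p &
      #|J| != #|fixpts t| -> p = 0].
Proof.
rewrite /clifford_map sum_ffunE; apply: (big_ind (fun f => exists p,
  [/\ p \is #|lowpts t|.-homog, f = to_frac p & #|J| != #|fixpts t| -> p = 0])).
- by exists 0; rewrite dhomog0 /to_frac tofrac0.
- move=> _ _ [p [p_hom -> p0]] [q [q_hom -> q0]]; exists (p + q).
  rewrite /to_frac tofracD; split=> // [|JN]; first exact: dhomogD.
  by rewrite p0 // q0 // addr0.
move=> I _; have [b bE] := wedgeP k [seq I r | r <- enum (fixpts t)].
rewrite !ffunE /fix_wedge bE; case: ifP => [uI|_]; last first.
  by exists 0; rewrite ffunE mulr0 scaler0 dhomog0 /to_frac tofrac0.
exists ((u I : k) *: ((-1) ^+ b * (J == [set x in [seq I r | r <- enum (fixpts t)]])%:R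
   *: pair_monomial k t I)); split.
- by do 2!apply: rpredZ; apply: pair_monomial_homog.
- rewrite !ffunE !coord_frac_scaleE -!mul_mpolyC /to_frac !tofracM.
  by rewrite mpolyCM tofracM mpolyC_nat rmorph_nat (mulrC (tofrac (pair_monomial k t I))).
move=> JN; case: eqP => [JE|]; last by rewrite mulr0 scale0r scaler0.
case/eqP: JN; rewrite JE cardsE; move/card_uniqP: uI => ->.
by rewrite size_map -cardE.
Qed.

Lemma clifford_map_section (t : 'S_d) (u : T) : involutive t ->
  poly_section d (clifford_map t u).
Proof.
move=> tK J; have [p [p_hom xE p0]] := clifford_map_coord t u J.
have [JE|JN] := eqVneq #|J| #|fixpts t|; last first.
  by left; rewrite xE p0 // /to_frac tofrac0.
by right; exists #|lowpts t|, p; rewrite JE card_fix_low.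
Qed.

Lemma map_nth_index (X Y : eqType) (y0 : Y) (s : seq X) (K : seq Y) :
  uniq s -> size K = size s -> [seq nth y0 K (index z s) | z <- s] = K.
Proof.
move=> us sz; apply: (@eq_from_nth _ y0); first by rewrite size_map sz.
move=> i; rewrite size_map => lti; case: s us sz lti => // x0 s us sz lti.
by rewrite (nth_map x0) // index_uniq.
Qed.

(** The index function lists [J] in increasing order on the fixed points and the successive
    variables of [m] on the 2-cycles, so that neither sign nor coefficient appears. *)
Lemma clifford_term_surj (t : 'S_d) (m : 'X_{1..N}) J : involutive t ->
    #|J| = #|fixpts t| -> mdeg m = #|lowpts t| ->
  exists I : idx, clifford_term k t I = ext_fscale (to_frac 'X_[m]) (ext_delta k J).
Proof.
move=> tK cJ cm; pose a0 : 'I_n := Ordinal n_ge1.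
have N_gt0 : (0 < N)%N by apply: leq_trans leq_card_sym2_basis.
pose K r := enum_val (nth (Ordinal N_gt0) (m2s m) (index r (enum (lowpts t)))).
pose I : idx := [ffun r => if r \in fixpts t then nth a0 (enum J) (index r (enum (fixpts t)))
                 else if r \in lowpts t then (K r).1 else (K (t r)).2].
have low_fix r : r \in lowpts t -> r \notin fixpts t.
  by rewrite !inE; apply: contraTneq => ->; rewrite ltnn.
exists I; rewrite /clifford_term /fix_wedge.
have -> : [seq I r | r <- enum (fixpts t)] = enum J.
  rewrite -[RHS](map_nth_index a0 (enum_uniq (fixpts t))) -?cardE //.
  by apply/eq_in_map => r; rewrite mem_enum ffunE => ->.
rewrite wedge_enum; congr (ext_fscale (to_frac _) _).
transitivity (\prod_(i <- m2s m) 'X_i : coord_ring k n).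
  have mE : [seq nth (Ordinal N_gt0) (m2s m) (index r (enum (lowpts t))) |
             r <- enum (lowpts t)] = m2s m.
    by apply: map_nth_index; rewrite ?enum_uniq // size_m2s cm cardE.
  rewrite -[in RHS]mE big_map big_enum /=; apply: eq_bigr => r rl.
  rewrite mpolyX_qform -/(K r) !ffunE (negPf (low_fix r rl)) rl.
  have -> : (t r \in fixpts t) = false.
    by rewrite inE tK eq_sym; have := low_fix r rl; rewrite inE => /negPf.
  have -> : (t r \in lowpts t) = false.
    by rewrite inE tK; move: rl; rewrite inE; case: ltngtP.
  by rewrite tK.
rewrite mprodXE -[in RHS](s2mK m); congr 'X_[_]; apply/mnmP=> i.
rewrite mnm_sumE mnmE -sum1_count [RHS]big_mkcond; apply: eq_bigr => j _.
by rewrite mnm1E /=; case: eqP.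
Qed.

Lemma std_invol_ok (m s : nat) : (m + s.*2 = d)%N -> @is_invol_fix d m (std_invol d m).
Proof.
move=> ms; pose f (r : nat) := if (r < s.*2)%N then (if odd r then r.-1 else r.+1) else r.
have f_lt (r : 'I_d) : (f r < d)%N.
  have := ltn_ord r; rewrite /f; case: ifP => // lt_r; case: ifP => odd_r; lia.
pose g r : 'I_d := Ordinal (f_lt r).
have gK : involutive g.
  move=> r; apply: val_inj => /=; rewrite /f.
  case lt_r: (r < s.*2)%N; last by rewrite lt_r.
  case odd_r: (odd r); last first.
    have -> : (r.+1 < s.*2)%N by lia.
    by rewrite /= odd_r.
  have -> : (r.-1 < s.*2)%N by lia.
  have -> : odd r.-1 = false by lia.
  by case: (val r) odd_r.
apply: (@std_involP _ _ (perm (inv_inj gK))); apply/is_invol_fixP.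
split; first by move=> r; rewrite !permE gK.
have -> : fixpts (perm (inv_inj gK)) = [set r : 'I_d | ~~ (r < s.*2)%N].
  apply/setP=> r; rewrite !inE permE -val_eqE /= /f.
  case lt_r: (r < s.*2)%N; last by rewrite eqxx.
  by case odd_r: (odd r); lia.
have -> : [set r : 'I_d | ~~ (r < s.*2)%N] = ~: [set r : 'I_d | (r < s.*2)%N].
  by apply/setP=> r; rewrite !inE.
rewrite cardsCs setCK card_ord.
have le_sd : (s.*2 <= d)%N by lia.
have -> : [set r : 'I_d | (r < s.*2)%N] = [set widen_ord le_sd r | r : 'I_s.*2].
  apply/setP=> r; rewrite inE; apply/idP/imsetP => [lt_r|[r' _ ->]]; last by rewrite /= ltn_ord.
  by exists (Ordinal lt_r) => //; apply: val_inj.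
rewrite card_imset ?card_ord; first by lia.
by move=> r r' /(congr1 val) /= /val_inj.
Qed.

Lemma poly_section_clifford_map x : poly_section d x ->
  exists U : 'I_d.+1 -> T,
    x = \sum_(m < d.+1 | is_invol_fix m (std_invol d m)) clifford_map (std_invol d m) (U m).
Proof.
pose Q x := exists U : 'I_d.+1 -> T,
    x = \sum_(m < d.+1 | is_invol_fix m (std_invol d m)) clifford_map (std_invol d m) (U m).
have Q0 : Q 0 by exists (fun=> 0); rewrite big1 // => m _; rewrite linear0.
have QD y z : Q y -> Q z -> Q (y + z).
  case=> [U ->] [W ->]; exists (fun m => U m + W m); rewrite -big_split.
  by apply: eq_bigr => m _; rewrite linearD.
have QZ c y : Q y -> Q (c *: y).
  case=> [U ->]; exists (fun m => c *: U m); rewrite scaler_sumr.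
  by apply: eq_bigr => m _; rewrite linearZ.
move=> px; have -> : x = \sum_J ext_fscale (x J) (ext_delta k J).
  apply/ffunP=> J; rewrite sum_ffunE (bigD1 J) //= !ffunE eqxx mulr1.
  by rewrite big1 ?addr0 // => J' J'N; rewrite !ffunE eq_sym (negPf J'N) mulr0.
apply: (big_ind Q) => // J _; have [->|[s [p [sE p_hom ->]]]] := px J.
  by rewrite ext_fscale0l.
rewrite [p]mpolyE ext_fscale_suml big_seq; apply: (big_ind Q) => // m pm.
rewrite ext_fscaleZl; apply: QZ.
have J_ok := std_invol_ok sE; have /is_invol_fixP[tK cf] := J_ok.
have lt_J : (#|J| < d.+1)%N by rewrite ltnS -sE leq_addr.
have [I <-] : exists I : idx, clifford_term k (std_invol d #|J|) I =
    ext_fscale (to_frac 'X_[m]) (ext_delta k J).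
  apply: clifford_term_surj => //; rewrite -[LHS]/((mdeg : measure _) m).
  have := card_fix_low tK; rewrite (dhomog_mf p_hom pm) cf; lia.
exists (fun m' => if m' == Ordinal lt_J then [ffun I' => (I' == I)%:R] else 0).
rewrite (bigD1 (Ordinal lt_J)) //= eqxx [X in _ + X]big1 => [|m' /andP[_ /negPf ->]].
  rewrite addr0 /clifford_map (bigD1 I) //= ffunE eqxx scale1r big1 ?addr0 //.
  by move=> I' /negPf I'N; rewrite ffunE I'N scale0r.
by rewrite linear0.
Qed.

End CliffordMapSections.

End GlobalSections.

(** * The isomorphism *)

(** The inverse is obtained by choice and is arbitrary outside [rep_mem]. The stability of the
    source is a hypothesis, as a [glrep] does not record it. *)
Lemma glrep_iso_sym (k : fieldType) (V : vectType k) (A B : glrep V)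
    (psi : rep_space A -> rep_space B) :
    (forall (c : k) (x y : rep_space A), rep_mem x -> rep_mem y -> rep_mem (c *: x + y)) ->
    (forall (g : 'End(V)) (x : rep_space A), lker g == 0%VS -> rep_mem x ->
       rep_mem (rep_act g x)) ->
    glrep_iso psi ->
  exists phi : rep_space B -> rep_space A, glrep_iso phi.
Proof.
move=> A_lin A_act [psi_mem psi_lin psi_inj psi_surj psi_eq].
have ex z : exists x, rep_mem z -> rep_mem x /\ psi x = z.
  have [zB|zB] := classic (rep_mem z); last by exists 0.
  by have [x xA xz] := psi_surj z zB; exists x.
pose phi z := proj1_sig (constructive_indefinite_description _ (ex z)).
have phiP z : rep_mem z -> rep_mem (phi z) /\ psi (phi z) = z.
  exact: proj2_sig (constructive_indefinite_description _ (ex z)).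
have phiK x : rep_mem x -> phi (psi x) = x.
  move=> xA; have [mx ex'] := phiP _ (psi_mem _ xA).
  exact: psi_inj.
exists phi; split.
- by move=> z /phiP[].
- move=> c x y /phiP[xA <-] /phiP[yA <-].
  by rewrite -psi_lin // !phiK //; apply: A_lin.
- by move=> x y /phiP[_ {2}<-] /phiP[_ {2}<-] ->.
- by move=> x xA; exists (psi x); [apply: psi_mem | apply: phiK].
- move=> g x kg /phiP[xA <-].
  by rewrite -psi_eq // !phiK //; apply: A_act.
Qed.

Lemma gyoung_ext (k : fieldType) (d : nat) (row row' col col' : 'I_d -> nat) :
  row =1 row' -> col =1 col' -> gyoung k row col = gyoung k row' col'.
Proof.
have stab_ext (f f' : 'I_d -> nat) : f =1 f' -> fstab f = fstab f'.
  by move=> ff'; apply/setP=> s; rewrite !inE; apply: eq_forallb => r; rewrite !ff'.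
move=> /stab_ext eq_row /stab_ext eq_col.
by rewrite /gyoung /galt /gsym eq_row eq_col.
Qed.

Section Assembly.
Variables (k : fieldType) (char0 : [pchar k] =i pred0) (n : nat) (n_ge1 : (1 <= n)%N).
Variables (V : vectType k) (e : n.-tuple V) (e_basis : basis_of fullv e) (d : nat).
Local Notation A := (galg k 'S_d).
Local Notation T := (tensor k n d).
Local Notation YD := (young_diagram n d).
Implicit Types (be : YD) (f : {ffun YD -> T}).

Lemma schur_memE be (u : T) : schur_mem be u <->
  exists v, u = tact (gyoung k (box_row be) (box_col be)) v.
Proof.
by split=> [[v ->]|[v ->]]; exists v; rewrite young_symmetrizerE.
Qed.

(** The decomposition of [geps] involves diagrams with up to [d] rows, the Schur side those with up
    to [n]; a diagram missed by [pad] has more than [n] rows and kills tensors. *)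
Lemma pad_exists : exists pad : YD -> young_diagram d d,
  [/\ injective pad,
      forall be, gyoung k (box_row be) (box_col be) = gyd k (pad be) &
      forall al, (forall be, pad be != al) -> forall u : T, tact (gyd k al) u = 0].
Proof.
have pad_ex be : exists al : young_diagram d d,
    forall i, nth 0%N (row_lengths al) i = nth 0%N (row_lengths be) i.
  by apply: resize_diagram => i; apply: row_lengths_nth_eq0.
have [pad padE] := fin_all_exists pad_ex.
have nth_inj be be' :
    (forall i, nth 0%N (row_lengths be) i = nth 0%N (row_lengths be') i) -> be = be'.
  move=> eq_nth; apply: row_count_inj => i; rewrite /row_count.
  by have [eq_row _] := eq_nth_boxes eq_nth; apply: eq_card => r; rewrite !inE eq_row.
exists pad; split=> [be be' eq_pad|be|al alN u].
- by apply: nth_inj => i; rewrite -!padE eq_pad.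
- by have [er ec] := eq_nth_boxes (padE be); apply: gyoung_ext => r; rewrite ?er ?ec.
have [al0|al_pos] := eqVneq (nth 0%N (row_lengths al) n) 0%N.
  have [i lei|be beE] := @resize_diagram d n d al.
    by have := row_lengths_nth_le al lei; rewrite al0 leqn0 => /eqP.
  have /eqP[] := alN be; apply: row_count_inj => i; rewrite /row_count.
  have eq_nth j : nth 0%N (row_lengths (pad be)) j = nth 0%N (row_lengths al) j.
    by rewrite padE beE.
  by have [eq_row _] := eq_nth_boxes eq_nth; apply: eq_card => r; rewrite !inE eq_row.
apply: (tact_gyoung_tall char0); first exact: young_is_diagram.
have [|r rn _] := @box_exists _ _ al n 0; first by rewrite lt0n.
by exists r; rewrite rn.
Qed.

(** The map starts from the Schur side, where [f be] already lies in the image of the Young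
    symmetrizer: it applies [E], then [clifford_map], which contains [geps] up to a scalar. *)
Lemma assembly : exists psi : rep_space (schur_sum_rep e d) -> rep_space (clifford_rep e d),
  glrep_iso psi.
Proof.
have [EG EGP] := fin_all_exists (fixnum_dual char0 (d := d)).
pose EE al := (EG al).1; pose GG al := (EG al).2.
have dual al : gyd k al * (EE al * geps k (std_invol d (fixnum al))) * GG al * gyd k al
    = gyd k al by apply: EGP.
have [pad [pad_inj padE pad_out]] := pad_exists.
pose a0 : 'I_n := Ordinal n_ge1.
pose tt be := std_invol d (fixnum (pad be)).
have tt_ok be : is_invol_fix (fixnum (pad be)) (tt be).
  exact: std_involP (fixnum_invol (pad be)).
have ttK be : involutive (tt be) by have /is_invol_fixP[] := tt_ok be.
pose psi (f : {ffun YD -> T}) : ext_frac k n :=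
  \sum_be clifford_map (tt be) (tact (EE (pad be)) (f be)).
have memP (f : {ffun YD -> T}) : (forall be, schur_mem be (f be)) ->
    exists v : YD -> T, forall be, f be = tact (gyd k (pad be)) (v be).
  move=> mf; apply: (fin_all_exists (P := fun be v => f be = tact (gyd k (pad be)) v)).
  by move=> be; have /schur_memE[v ->] := mf be; exists v; rewrite padE.
have psi_lin c (f f' : {ffun YD -> T}) : psi (c *: f + f') = c *: psi f + psi f'.
  rewrite /psi scaler_sumr -big_split; apply: eq_bigr => be _.
  by rewrite !ffunE !linearP.
have fix_lt be : (fixnum (pad be) < d.+1)%N.
  by rewrite ltnS -[leqRHS]card_ord max_card.
have poly0 : poly_section d (0 : ext_frac k n) by move=> J; left; rewrite ffunE.
have polyD (x y : ext_frac k n) : poly_section d x -> poly_section d y -> poly_section d (x + y).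
  move=> px py J; rewrite !ffunE; have [->|[s [p [sE p_hom pE]]]] := px J.
    by rewrite add0r; apply: py.
  have [->|[s' [q [s'E q_hom qE]]]] := py J; first by rewrite addr0; right; exists s, p.
  have ss' : s = s' by apply/double_inj/(@addnI #|J|); rewrite sE s'E.
  right; exists s, (p + q); rewrite pE qE /to_frac tofracD; split=> //.
  by apply: dhomogD => //; rewrite ss'.
exists psi; split.
- move=> f /= _; apply: poly_global_section.
  rewrite /psi; apply: (big_ind (@poly_section k n d)) => // be _.
  exact: clifford_map_section.
- by move=> c f f' _ _; apply: psi_lin.
- move=> f f' /= /memP[v fE] /memP[v' f'E] eq_psi.
  pose w be := v be - v' be; pose g : {ffun YD -> T} := f - f'.
  have gE be : g be = tact (gyd k (pad be)) (w be).
    by rewrite /g !ffunE fE f'E linearB.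
  have g0 : psi g = 0.
    by rewrite /g addrC -scaleN1r psi_lin scaleN1r eq_psi addNr.
  suff gbe be0 : g be0 = 0.
    apply/eqP; rewrite -subr_eq0; apply/eqP/ffunP=> be; rewrite -/g gbe.
    by rewrite ffunE.
  pose m := fixnum (pad be0); pose t := std_invol d m.
  (* The other diagrams contribute only to sets [J] of other sizes, so [psi g = 0] splits according
     to the number of fixed points. *)
  pose W := \sum_(be | fixnum (pad be) == m) tact (EE (pad be)) (g be).
  have W0 : clifford_map t W = 0.
    apply/ffunP=> J; rewrite [RHS]ffunE.
    have [_ fixt] := is_invol_fixP _ _ (tt_ok be0).
    have [p [_ pE p0]] := clifford_map_coord t W J.
    have [cJ|cJ] := eqVneq #|J| m; last first.
      by rewrite pE p0 ?fixt // /to_frac tofrac0.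
    have := congr1 (fun x : ext_frac k n => x J) g0.
    rewrite /psi (bigID (fun be => fixnum (pad be) == m)) /= ffunE [RHS]ffunE.
    rewrite [X in _ + X]sum_ffunE [X in _ + X]big1 => [|be beN]; last first.
      have [_ fixbe] := is_invol_fixP _ _ (tt_ok be).
      have [q [_ -> q0]] := clifford_map_coord (tt be) (tact (EE (pad be)) (g be)) J.
      by rewrite q0 /to_frac ?tofrac0 // fixbe cJ eq_sym.
    rewrite addr0 => <-; congr (fun_of_fin _ J); rewrite /W linear_sum.
    by apply: eq_bigr => be /eqP beE; rewrite /tt beE.
  have epsW : tact (geps k t) W = 0.
    apply: (clifford_map_inj char0 (ttK be0)) => [h Ch|].
      rewrite -tact_gelt tactM -tactZl; congr tact.
      (* Applying [gtau] to [gepsMl] gives the rule for multiplication on the right. *)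
      rewrite -[LHS]gtauK gtauM gtau_gelt gtau_geps gepsMl ?groupV //.
      by rewrite linearZ /= gtau_geps foddV.
    by rewrite clifford_map_geps // W0 scaler0.
  (* Multiplying by [G] and the symmetrizer of [pad be0] restores the term of [be0] by duality and
     kills the others by orthogonality. *)
  have : tact (geps k t * (GG (pad be0) * gyd k (pad be0))) W = 0.
    by rewrite -tactM epsW linear0.
  rewrite /W linear_sum (bigD1 be0) //= [X in _ + X]big1 => [|be /andP[_ beN]].
    rewrite addr0 gE !tactM => <-; congr tact.
    by rewrite -[LHS]dual !mulrA.
  rewrite gE !tactM; set y := (X in tact X _); suff -> : y = 0 by rewrite tact0l.
  rewrite -(gyd_orth char0 (EE (pad be) * geps k t * GG (pad be0))
    (be := pad be0) (al := pad be)).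
    by rewrite /y !mulrA.
  by rewrite (inj_eq pad_inj).
- move=> x /= /(global_section_poly n_ge1)/(poly_section_clifford_map n_ge1)[U xE].
  have zP (m : 'I_d.+1) : exists z : young_diagram d d -> A,
      is_invol_fix m (std_invol d m) -> geps k (std_invol d m) =
      \sum_(al | fixnum al == m) z al * gyd k al * (EE al * geps k (std_invol d m)).
    have [ok|nok] := boolP (is_invol_fix m (std_invol d m)); last by exists (fun=> 0).
    by have [z zE] := geps_decomposition char0 dual ok; exists z.
  have [z {}zP] := fin_all_exists zP.
  pose mm be : 'I_d.+1 := Ordinal (fix_lt be).
  (* The tensor [U m] is distributed among the diagrams by the coefficients [z] in the decomposition
     of [geps]. *)
  exists [ffun be => tact (gyd k (pad be)) (tact (z (mm be) (pad be)) (U (mm be)))].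
    move=> be; apply/schur_memE; rewrite ffunE padE.
    by exists (tact (z (mm be) (pad be)) (U (mm be))).
  rewrite xE /psi [LHS](partition_big mm (fun m : 'I_d.+1 => is_invol_fix m (std_invol d m))) /=.
    apply: eq_bigr => m m_ok; have /is_invol_fixP[mK _] := m_ok.
    (* Multiplied by the order of the centralizer, the section becomes the image of [geps] applied
       to [U m], which the decomposition expands. *)
    apply: (scalerI (card_cent1_neq0 char0 (std_invol d m))).
    rewrite -[RHS]clifford_map_geps // (zP m m_ok) tact_suml [RHS]linear_sum /=.
    pose F al := #|'C[std_invol d m]|%:R *:
      clifford_map (std_invol d m) (tact (z m al * gyd k al * EE al) (U m)).
    rewrite [RHS](eq_bigr F) => [|al _]; last first.
      by rewrite mulrA -tactM clifford_map_geps.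
    rewrite [RHS](bigID (fun al => al \in codom pad)) /= [X in _ = _ + X]big1.
      rewrite addr0 scaler_sumr.
      rewrite [RHS](eq_bigl (fun al => (al \in [set pad be | be in [pred be | mm be == m]]))).
        rewrite big_imset /=; last by move=> be be' _ _; apply: pad_inj.
        apply: eq_bigr => be /eqP beE; rewrite ffunE /F !tactM.
        by rewrite mulrA -beE.
      move=> al; apply/andP/imsetP => [[/eqP al_m /codomP[be alE]]|[be beE ->]].
        by exists be; rewrite // inE -val_eqE /= -alE al_m.
      by rewrite codom_f; move: beE; rewrite inE -val_eqE.
    move=> al /andP[_ alN]; rewrite /F -(tactM (z m al * gyd k al)) -(tactM (z m al)).
    rewrite pad_out ?linear0 ?scaler0 // => be.
    by apply: contraNneq alN => <-; apply: codom_f.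
  by move=> be _; apply: tt_ok.
- move=> g f kg _; rewrite /psi /=.
  transitivity (\sum_be ext_act e g (clifford_map (tt be) (tact (EE (pad be)) (f be)))).
    apply: eq_bigr => be _; rewrite ffunE -tensor_act_tact.
    exact: clifford_map_act.
  under [in RHS]eq_bigr => be _ do rewrite -[clifford_map _ _]scale1r.
  rewrite ext_act_sum // => [|be J].
    by apply: eq_bigr => be _; rewrite scale1r.
  have [p [_ pE _]] := clifford_map_coord (tt be) (tact (EE (pad be)) (f be)) J.
  by exists p.
Qed.

End Assembly.

Theorem theorem1p1 (k : fieldType) (char0 : [pchar k] =i pred0)
    (n : nat) (n_ge1 : (1 <= n)%N) (V : vectType k) (e : n.-tuple V)
    (e_basis : basis_of fullv e) :
  graded_glrep_isomorphic (clifford_coordinate_algebra e) (schur_sum_rep e).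
Proof.
have iso d : exists phi : rep_space (clifford_rep e d) -> rep_space (schur_sum_rep e d),
    glrep_iso phi.
  have [psi psi_iso] := assembly char0 n_ge1 e_basis d.
  apply: glrep_iso_sym psi_iso => [c f f' /= mf mf' be|g f _ /= mf be].
    have /schur_memE[u uE] := mf be; have /schur_memE[u' u'E] := mf' be.
    by apply/schur_memE; exists (c *: u + u'); rewrite !ffunE uE u'E linearP.
  have /schur_memE[u uE] := mf be; apply/schur_memE.
  by exists (tensor_act e g u); rewrite ffunE uE tensor_act_tact.
exists (fun d => proj1_sig (constructive_indefinite_description _ (iso d))) => d.
exact: proj2_sig (constructive_indefinite_description _ (iso d)).
Qed.
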